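(* Let $2<p<\infty$. There is a Banach space which has the local MAP for $\mathcal I_p$ and the local MAP for $\mathcal N_p$, but lacks the weak BAP for $\mathcal I_p$ and lacks the weak BAP for $\mathcal N_p$.
   Context: All Banach spaces are over the same field, real or complex. $\mathcal F(X;Y)$ denotes the finite rank bounded operators, $\mathcal F(X)=\mathcal F(X;X)$; $p^*$ is the conjugate index of $p$. $\mathcal I_p$ is the Banach operator ideal of $p$-integral operators (the maximal ideal associated with the Chevet–Saphar tensor norm $g_p$): $T\in\mathcal I_p(X;Y)$ iff $J_YT=B\,i_p\,A$ for some probability measure $\mu$, bounded $A\colon X\to L_\infty(\mu)$, $B\colon L_p(\mu)\to Y^{**}$, with $i_p\colon L_\infty(\mu)\to L_p(\mu)$ the canonical map and $J_Y\colon Y\to Y^{**}$ the canonical inclusion; $\|T\|_{\mathcal I_p}=\inf\|A\|\|B\|$. $\mathcal N_p$ is the Banach operator ideal of $p$-nuclear operators: $T\in\mathcal N_p(X;Y)$ iff $T=\sum_n x_n^*\otimes y_n$ with $(x_n^* )\in\ell_p(X^* )$ and $(y_n)$ weakly $p^*$-summable in $Y$; $\|T\|_{\mathcal N_p}=\inf\big(\sum\|x_n^*\|^p\big)^{1/p}\sup_{y^*\in B_{Y^*}}\big(\sum|y^*(y_n)|^{p^*}\big)^{1/p^*}$. For a Banach operator ideal $\mathcal A$ and $1\le\lambda<\infty$: $X$ has the weak $\lambda$-BAP for $\mathcal A$ if for every Banach space $Y$ and each $T\in\mathcal A(X;Y)$ there is a net $(S_\alpha)$ in $\mathcal F(X)$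 such that $S_\alpha\to I_X$ pointwise and $\limsup_\alpha\|TS_\alpha\|_{\mathcal A}\le\lambda\|T\|_{\mathcal A}$; the weak BAP for $\mathcal A$ means this for some $\lambda$. $X$ has the local MAP for $\mathcal A$ if for every Banach space $Y$ and each $T\in\mathcal A(X;Y)$ there is a net $(T_\alpha)$ in $\mathcal F(X;Y)$ such that $T_\alpha\to T$ pointwise and $\limsup_\alpha\|T_\alpha\|_{\mathcal A}\le\|T\|_{\mathcal A}$. *)

(* Defs.v *)
From HB Require Import structures.
From mathcomp Require Import all_boot all_order all_algebra.
From mathcomp Require Import complex.
From mathcomp Require Import all_classical all_reals all_analysis.
From mathcomp Require Import measurable_realfun ess_sup_inf.

Set Implicit Arguments.
Unset Strict Implicit.
Unset Printing Implicit Defensive.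

Import Order.TTheory GRing.Theory Num.Theory.
Import numFieldNormedType.Exports.

Local Open Scope classical_set_scope.
Local Open Scope ring_scope.

(* The scalar field is fixed once for all spaces: R itself or R[i].  [re], [im]
   and [ofR] move between it and R uniformly in the two cases. *)
Variant scalars := RealScalars | ComplexScalars.

Section scalar_field.
Context (R : realType).

Definition scalar_field (s : scalars) : numFieldType :=
  match s with RealScalars => R | ComplexScalars => R[i] end.

Definition re {s : scalars} : scalar_field s -> R :=
  match s with
  | RealScalars => fun z : R => z
  | ComplexScalars => fun z : R[i] => complex.Re z
  end.

Definition im {s : scalars} : scalar_field s -> R :=
  match s with
  | RealScalars => fun=> 0
  | ComplexScalars => fun z : R[i] => complex.Im z
  end.

Definition ofR {s : scalars} : R -> scalar_field s :=
  match s with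
  | RealScalars => fun r => r
  | ComplexScalars => fun r => (r%:C)%C
  end.

Context {s : scalars}.
Local Notation K := (scalar_field s).

Lemma ofRK : cancel (@ofR s) re. Proof. by case: s. Qed.

Lemma ofRD : {morph @ofR s : a b / a + b}.
Proof. by case: s => //= a b; rewrite rmorphD. Qed.

Lemma ofRM : {morph @ofR s : a b / a * b}.
Proof. by case: s => //= a b; rewrite rmorphM. Qed.

Lemma ofR0 : @ofR s 0 = 0. Proof. by case: s. Qed.
Lemma ofR1 : @ofR s 1 = 1. Proof. by case: s. Qed.

Lemma ler_ofR (a b : R) : (ofR a <= ofR b :> K) = (a <= b).
Proof. by case: s => //=; exact: lecR. Qed.

Lemma ofR_re (z : K) : 0 <= z -> ofR (re z) = z.
Proof.
case: s z => //= z z0; exact: (RRe_real (ger0_real z0)).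
Qed.

Lemma reD (z w : K) : re (z + w) = re z + re w.
Proof. by case: s z w => //= [] [a b] [c d]. Qed.

Lemma imD (z w : K) : im (z + w) = im z + im w.
Proof. by case: s z w => [z w|[a b] [c d]] //=; rewrite addr0. Qed.

Lemma reM (z w : K) : re (z * w) = re z * re w - im z * im w.
Proof. by case: s z w => [z w|[a b] [c d]] //=; rewrite mul0r subr0. Qed.

Lemma imM (z w : K) : im (z * w) = re z * im w + im z * re w.
Proof. by case: s z w => [z w|[a b] [c d]] //=; rewrite mulr0 mul0r addr0. Qed.

Lemma re0 : re (0 : K) = 0. Proof. by case: s. Qed.
Lemma im0 : im (0 : K) = 0. Proof. by case: s. Qed.

Lemma re_normE (z : K) : re `|z| = Num.sqrt (re z ^+ 2 + im z ^+ 2).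
Proof.
case: s z => [z|z] /=; first by rewrite expr0n addr0 sqrtr_sqr.
exact: (congr1 (@complex.Re R) (normc_def z)).
Qed.

End scalar_field.
Arguments re {R s}.
Arguments im {R s}.
Arguments ofR {R s}.

(* In a normed space over K the library norm takes its values in K; [nrm] is
   the same norm as a real number. *)
Definition nrm {R : realType} {s : scalars}
  {V : normedZmodType (scalar_field R s)} (x : V) : R := re `|x|.

Section nrm.
Context {R : realType} {s : scalars}.
Local Notation K := (scalar_field R s).

Lemma nrmE (V : normedZmodType K) (x : V) : `|x| = ofR (nrm x).
Proof. by rewrite /nrm ofR_re. Qed.

Lemma nrm_ge0 (V : normedZmodType K) (x : V) : 0 <= nrm x.
Proof. by rewrite -(@ler_ofR R s) ofR0 -nrmE. Qed.

Lemma nrm0 (V : normedZmodType K) : nrm (0 : V) = 0.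
Proof. by rewrite /nrm normr0 re0. Qed.

Lemma nrm0_eq0 (V : normedZmodType K) (x : V) : nrm x = 0 -> x = 0.
Proof. by move=> x0; apply/normr0_eq0; rewrite nrmE x0 ofR0. Qed.

Lemma ler_nrmD (V : normedZmodType K) (x y : V) :
  nrm (x + y) <= nrm x + nrm y.
Proof. by rewrite -(@ler_ofR R s) ofRD -!nrmE ler_normD. Qed.

Lemma nrmZ (V : normedModType K) (a : K) (x : V) :
  nrm (a *: x) = nrm a * nrm x.
Proof. by apply: (can_inj (@ofRK R s)); rewrite ofRM -!nrmE normrZ. Qed.

Lemma nrmM (a b : K) : nrm (a * b) = nrm a * nrm b.
Proof. by apply: (can_inj (@ofRK R s)); rewrite ofRM -!nrmE normrM. Qed.

Lemma nrm_ofR (a : R) : 0 <= a -> nrm (ofR a : K) = a.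
Proof.
by move=> a0; apply: (can_inj (@ofRK R s)); rewrite -nrmE ger0_norm// -ofR0 ler_ofR.
Qed.

End nrm.

Section bounded_operators.
Context {R : realType} {s : scalars}.
Local Notation K := (scalar_field R s).
Context (V W : normedModType K).

Definition bounded_linear : {pred V -> W} :=
  mem [set f : V -> W | linear f /\ continuous f].

(* V and W need not be complete; the norm on bop V W is the operator norm, see
   [nrm_bopE]. *)
Record bop := Bop { bop_val :> V -> W; bop_valP : bop_val \in bounded_linear }.

HB.instance Definition _ := [isSub for bop_val].
HB.instance Definition _ := [Choice of bop by <:].

Lemma bounded_linear_submod : submod_closed bounded_linear.
Proof.
split.
  rewrite inE; split => [a x y|x]; first by rewrite /= scaler0 addr0.
  exact: cvg_cst.
move=> a f g; rewrite !inE => -[lf cf] [lg cg]; split.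
- move=> b x y.
  rewrite !fctE /= lf lg !scalerDr !scalerA (mulrC a b) !addrA.
  by congr (_ + _); rewrite -!addrA; congr (_ + _); rewrite addrC.
- by move=> x; apply: cvgD; [apply: cvgZr; exact: cf|exact: cg].
Qed.

HB.instance Definition _ :=
  GRing.isSubmodClosed.Build _ _ bounded_linear bounded_linear_submod.
HB.instance Definition _ := [SubChoice_isSubLmodule of bop by <:].

End bounded_operators.
Section operator_norm.
Context {R : realType} {s : scalars}.
Local Notation K := (scalar_field R s).
Context (V W : normedModType K).
Implicit Type f : bop V W.

Lemma bop_linear f : linear f.
Proof. by have := bop_valP f; rewrite inE => -[]. Qed.

Lemma bop_continuous f : continuous f.
Proof. by have := bop_valP f; rewrite inE => -[]. Qed.

HB.instance Definition _ f := GRing.isLinear.Build K V W *:%R f (bop_linear f).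

Definition opnorm f : R := sup [set nrm (f x) | x in [set x : V | nrm x <= 1]].

Lemma bop_bounded f : exists2 M : R, 0 <= M & forall x, nrm (f x) <= M * nrm x.
Proof.
have /linear_boundedP/pinfty_ex_gt0[r r0 fr] :=
  continuous_linear_bounded 0 (@bop_continuous f 0).
exists (re r); first by rewrite -(@ler_ofR R s) ofR0 ofR_re ltW.
by move=> x; rewrite -(@ler_ofR R s) ofRM -!nrmE ofR_re ?(ltW r0)//; exact: fr.
Qed.

Lemma opnorm_has_sup f :
  has_sup [set nrm (f x) | x in [set x : V | nrm x <= 1]].
Proof.
split; first by exists (nrm (f 0)), 0; rewrite //= nrm0.
have [M M0 fM] := bop_bounded f; exists M => _ [x /= x1 <-].
by rewrite (le_trans (fM x))// ler_piMr.
Qed.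

Lemma ler_opnorm f x : nrm (f x) <= opnorm f * nrm x.
Proof.
have [->|x0] := eqVneq x 0; first by rewrite linear0 !nrm0 mulr0.
have nx0 : 0 < nrm x.
  by rewrite lt0r nrm_ge0 andbT; apply: contra x0 => /eqP/nrm0_eq0/eqP.
pose c : K := ofR (nrm x)^-1.
have cE : nrm c = (nrm x)^-1 by rewrite nrm_ofR// invr_ge0 ltW.
have -> : nrm (f x) = nrm (f (c *: x)) * nrm x.
  by rewrite linearZ/= nrmZ cE mulrAC mulVf ?mul1r// gt_eqF.
rewrite ler_wpM2r ?nrm_ge0//.
apply: (sup_upper_bound (opnorm_has_sup f)); exists (c *: x) => //=.
by rewrite nrmZ cE mulVf// gt_eqF.
Qed.

Lemma opnorm_le f M : 0 <= M -> (forall x, nrm (f x) <= M * nrm x) ->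
  opnorm f <= M.
Proof.
move=> M0 fM; apply: ge_sup; first by case: (opnorm_has_sup f).
by move=> _ [x /= x1 <-]; rewrite (le_trans (fM x))// ler_piMr.
Qed.

Lemma opnorm_ge0 f : 0 <= opnorm f.
Proof.
apply: (@le_trans _ _ (nrm (f 0))); first exact: nrm_ge0.
by apply: (sup_upper_bound (opnorm_has_sup f)); exists 0; rewrite //= nrm0.
Qed.

Let bop_norm f : K := ofR (opnorm f).

Let bop_normD f g : bop_norm (f + g) <= bop_norm f + bop_norm g.
Proof.
rewrite /bop_norm -ofRD ler_ofR; apply: opnorm_le.
  by rewrite addr_ge0 ?opnorm_ge0.
move=> x; rewrite mulrDl (le_trans (ler_nrmD _ _))//.
by rewrite lerD// ler_opnorm.
Qed.

Let bop_normZ (a : K) f : bop_norm (a *: f) = `|a| * bop_norm f.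
Proof.
rewrite /bop_norm nrmE -ofRM; congr ofR.
have h (b : K) (g : bop V W) : opnorm (b *: g) <= nrm b * opnorm g.
  apply: opnorm_le; first by rewrite mulr_ge0 ?nrm_ge0 ?opnorm_ge0.
  by move=> x; rewrite nrmZ -mulrA ler_wpM2l ?nrm_ge0 ?ler_opnorm.
apply/eqP; rewrite eq_le h/=.
have [->|a0] := eqVneq a 0; first by rewrite nrm0 mul0r opnorm_ge0.
rewrite -{1}[f](scalerK a0) (le_trans (ler_wpM2l (nrm_ge0 _) (h _ _)))//.
rewrite mulrA -nrmM mulfV// /nrm normr1 -[X in re X](@ofR1 R s) ofRK.
by rewrite mul1r.
Qed.

Let bop_norm0_eq0 f : bop_norm f = 0 -> f = 0.
Proof.
rewrite /bop_norm -(@ofR0 R s) => /(can_inj (@ofRK R s)) f0.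
apply/val_inj/funext => x; apply/nrm0_eq0/eqP.
by rewrite eq_le nrm_ge0 andbT (le_trans (ler_opnorm _ _))// f0 mul0r.
Qed.

HB.instance Definition _ := Lmodule_isNormed.Build K (bop V W)
  bop_normD bop_normZ bop_norm0_eq0.

Lemma nrm_bopE f : nrm f = opnorm f.
Proof. exact: ofRK. Qed.

Lemma bounded_linearP (f : V -> W) (M : R) : linear f ->
  (forall x, nrm (f x) <= M * nrm x) -> f \in @bounded_linear R s V W.
Proof.
move=> lf fM; rewrite inE; split=> //.
pose g := GRing.isLinear.Build K V W *:%R f lf.
pose F : {linear V -> W} := HB.pack f g.
apply: (@bounded_linear_continuous _ _ _ F); apply/linear_boundedP.
near=> r => x; apply: (@le_trans _ _ (ofR M * `|x|)).
  by rewrite !nrmE -ofRM ler_ofR.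
rewrite ler_wpM2r//; near: r; apply: nbhs_pinfty_ge.
rewrite realE; case: (leP 0 M) => M0.
  by rewrite -(@ofR0 R s) !ler_ofR M0.
by rewrite -(@ofR0 R s) !ler_ofR (ltW M0) orbT.
Unshelve. all: by end_near. Qed.

End operator_norm.

Section composition.
Context {R : realType} {s : scalars}.
Local Notation K := (scalar_field R s).

Lemma bop_comp_subproof (U V W : normedModType K) (g : bop V W) (f : bop U V) :
  g \o f \in @bounded_linear R s U W.
Proof.
rewrite inE; split=> [a x y|x]; first by rewrite /= !linearP.
by apply: continuous_comp; exact: bop_continuous.
Qed.

Definition bop_comp (U V W : normedModType K) (g : bop V W) (f : bop U V) :=
  Bop (bop_comp_subproof g f).

Definition dual (V : normedModType K) : normedModType K := bop V K^o.

Section bidual.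
Context (V : normedModType K).

Lemma evaluation_subproof (x : V) :
  (fun f : dual V => f x : K^o) \in @bounded_linear R s (dual V) K^o.
Proof.
apply: (@bounded_linearP _ _ _ _ _ (nrm x)) => [a f g //|f].
by rewrite mulrC nrm_bopE; exact: ler_opnorm.
Qed.

Definition bidual_embedding (x : V) : dual (dual V) :=
  Bop (evaluation_subproof x).

End bidual.
End composition.
Section Lnorm_monotone.
Context d {T : measurableType d} {R : realType}.
Variable mu : {measure set T -> \bar R}.
Local Open Scope ereal_scope.

Lemma ae_le_Lnorm (f g : T -> R) (p : \bar R) : 1 <= p ->
  measurable_fun setT f -> measurable_fun setT g ->
  (\forall x \ae mu, 0 <= f x <= g x)%R ->
  'N[mu]_p[EFin \o f] <= 'N[mu]_p[EFin \o g].
Proof.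
case: p => [r||//] r1 mf mg fg; rewrite unlock.
- have r0 : (0 < r)%R by rewrite (lt_le_trans ltr01).
  have mp (h : T -> R) : measurable_fun setT h ->
      measurable_fun setT (fun x => `|h x| `^ r)%R.
    move=> mh.
    apply: (@measurableT_comp _ _ _ _ _ _ (@powR R ^~ r)) => //.
    exact: measurableT_comp.
  rewrite gt0_ler_poweR ?invr_ge0 ?(ltW r0)//.
  + by rewrite in_itv/= leey integral_ge0// => x _; exact: poweR_ge0.
  + by rewrite in_itv/= leey integral_ge0// => x _; exact: poweR_ge0.
  apply: ae_ge0_le_integral => //.
  + by move=> x _; exact: poweR_ge0.
  + exact/measurable_EFinP/mp.
  + by move=> x _; exact: poweR_ge0.
  + exact/measurable_EFinP/mp.
  apply: filterS fg => x /andP[f0 fg] _.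
  rewrite /= lee_fin ge0_ler_powR ?nnegrE ?(ltW r0)//.
  by rewrite !ger0_norm// (le_trans f0).
- case: ifPn => // _; apply: le_ess_sup.
  apply: filterS fg => x /andP[f0 fg] /=.
  by rewrite lee_fin !ger0_norm// (le_trans f0).
Qed.

End Lnorm_monotone.

Section Lfunctions.
Context d {T : measurableType d} {R : realType} {s : scalars}.
Local Notation K := (scalar_field R s).
Implicit Type f : T -> K.

Definition scalar_measurable f :=
  measurable_fun setT (re \o f) /\ measurable_fun setT (im \o f).

Lemma scalar_measurable_nrm f :
  scalar_measurable f -> measurable_fun setT (nrm \o f).
Proof.
move=> [mr mi].
rewrite (_ : _ \o _ =
    @powR R ^~ 2^-1 \o ((fun x => (re \o f) x ^+ 2) \+ (fun x => (im \o f) x ^+ 2))); last first.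
  apply/funext => x /=.
  by rewrite powR12_sqrt ?addr_ge0 ?sqr_ge0// /nrm re_normE.
apply: measurableT_comp; first exact: measurable_powR.
by apply: measurable_funD; exact: measurable_funX.
Qed.

Lemma scalar_measurable0 : scalar_measurable 0.
Proof.
by split; (rewrite (_ : _ \o _ = cst 0); [exact: measurable_cst|]);
  apply/funext => x; rewrite /= ?re0 ?im0.
Qed.

Lemma scalar_measurableD f g :
  scalar_measurable f -> scalar_measurable g -> scalar_measurable (f + g).
Proof.
move=> [fr fi] [gr gi]; split.
  rewrite (_ : _ \o _ = (re \o f) \+ (re \o g)); first exact: measurable_funD.
  by apply/funext => x; rewrite /= reD.
rewrite (_ : _ \o _ = (im \o f) \+ (im \o g)); first exact: measurable_funD.
by apply/funext => x; rewrite /= imD.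
Qed.

Lemma scalar_measurableZ (a : K) f :
  scalar_measurable f -> scalar_measurable (a \*: f).
Proof.
move=> [fr fi]; split.
  rewrite (_ : _ \o _ = (cst (re a) \* (re \o f)) \- (cst (im a) \* (im \o f))).
    by apply: measurable_funB; exact: measurable_funM.
  by apply/funext => x; rewrite /= reM.
rewrite (_ : _ \o _ = (cst (re a) \* (im \o f)) \+ (cst (im a) \* (re \o f))).
  by apply: measurable_funD; exact: measurable_funM.
by apply/funext => x; rewrite /= imM.
Qed.

Variables (mu : {measure set T -> \bar R}) (p : \bar R).

Definition Lfunction_pred : {pred T -> K} :=
  mem [set f : T -> K | scalar_measurable f /\ finite_norm mu p (nrm \o f)].

Variable p1 : (1 <= p)%E.

Lemma Lnorm_nrmD f g : scalar_measurable f -> scalar_measurable g ->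
  ('N[mu]_p[EFin \o (nrm \o (f + g)%R)] <=
   'N[mu]_p[EFin \o (nrm \o f)] + 'N[mu]_p[EFin \o (nrm \o g)])%E.
Proof.
move=> mf mg; have [mf' mg'] := (scalar_measurable_nrm mf, scalar_measurable_nrm mg).
apply: (le_trans _ (eminkowski mu mf' mg' p1)); apply: ae_le_Lnorm => //.
- exact/scalar_measurable_nrm/scalar_measurableD.
- exact: measurable_funD.
by apply: aeW => x /=; rewrite nrm_ge0 ler_nrmD.
Qed.

Lemma Lnorm_nrmZ (a : K) f : scalar_measurable f ->
  finite_norm mu p (nrm \o f) ->
  ('N[mu]_p[EFin \o (nrm \o (a \*: f)%R)] =
   (nrm a)%:E * 'N[mu]_p[EFin \o (nrm \o f)])%E.
Proof.
move=> mf ff.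
have fL : (nrm \o f) \in Lfun mu p.
  by apply/andP; rewrite !inE; split=> //=; exact: scalar_measurable_nrm.
have := LnormZ (Lfun_Sub p1 fL) (nrm a).
rewrite ger0_norm ?nrm_ge0// => <-.
by apply: eq_Lnorm => x /=; rewrite nrmM.
Qed.

Lemma Lfunction_submod : submod_closed Lfunction_pred.
Proof.
split.
  rewrite inE /=; split; first exact: scalar_measurable0.
  rewrite /finite_norm (_ : _ \o _ = cst 0%E).
    by rewrite Lnorm0// gt_eqF// (lt_le_trans _ p1).
  by apply/funext => x /=; rewrite nrm0.
move=> a f g; rewrite !inE => -[mf ff] [mg fg]; split.
  by apply: scalar_measurableD => //; exact: scalar_measurableZ.
rewrite /finite_norm (le_lt_trans (Lnorm_nrmD _ _))//.
  exact: scalar_measurableZ.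
rewrite lte_add_pinfty// Lnorm_nrmZ//.
by rewrite lte_mul_pinfty ?lee_fin ?nrm_ge0.
Qed.

End Lfunctions.

Section Lfct.
Context d (T : measurableType d) (R : realType) (s : scalars).
Local Notation K := (scalar_field R s).
Variables (mu : {measure set T -> \bar R}) (p : \bar R).

Record Lfct (p1 : (1 <= p)%E) := MkLfct {
  Lfct_val :> T -> K;
  Lfct_valP : Lfct_val \in @Lfunction_pred _ T R s mu p }.

Variable p1 : (1 <= p)%E.

HB.instance Definition _ := [isSub for @Lfct_val p1].
HB.instance Definition _ := [Choice of Lfct p1 by <:].
HB.instance Definition _ := GRing.isSubmodClosed.Build _ _
  (@Lfunction_pred _ T R s mu p) (@Lfunction_submod _ T R s mu p p1).
HB.instance Definition _ := [SubChoice_isSubLmodule of Lfct p1 by <:].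

Lemma Lfct_measurable (f : Lfct p1) : scalar_measurable f.
Proof. by have := Lfct_valP f; rewrite inE => -[]. Qed.

Lemma Lfct_finite (f : Lfct p1) : finite_norm mu p (nrm \o f).
Proof. by have := Lfct_valP f; rewrite inE => -[]. Qed.

Definition ae_null : {pred Lfct p1} :=
  mem [set f : Lfct p1 | \forall x \ae mu, f x = 0].

Lemma ae_null_zmod : zmod_closed ae_null.
Proof.
split; first by rewrite inE /=; exact: aeW.
move=> f g; rewrite !inE /=; apply: filterS2 => x fx gx.
by rewrite !fctE fx gx subr0.
Qed.

HB.instance Definition _ := GRing.isZmodClosed.Build _ ae_null ae_null_zmod.

(* L_p(mu) over the scalar field K; the library's LspaceType is only over R. *)
Definition Lp : Type := {ideal_quot ae_null}.
HB.instance Definition _ := Choice.on Lp.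
HB.instance Definition _ := EqQuotient.on Lp.
HB.instance Definition _ := GRing.Zmodule.on Lp.
HB.instance Definition _ := ZmodQuotient.on Lp.

Local Open Scope quotient_scope.

Lemma Lp_eqP (f g : Lfct p1) :
  \pi_Lp f = \pi_Lp g <-> \forall x \ae mu, f x = g x.
Proof.
split.
- move/eqP; rewrite -Quotient.idealrBE inE /=; apply: filterS => x.
  by rewrite !fctE => /eqP; rewrite subr_eq0 => /eqP.
- move=> fg; apply/eqP; rewrite -Quotient.idealrBE inE /=; move: fg.
  by apply: filterS => x fg; rewrite !fctE fg subrr.
Qed.

Lemma Lp_reprP (f : Lfct p1) : \forall x \ae mu, repr (\pi_Lp f) x = f x.
Proof. by apply/Lp_eqP; rewrite reprK. Qed.

Definition Lp_scale (a : K) (u : Lp) : Lp := \pi_Lp (a *: repr u).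

Lemma Lp_scale_pi (a : K) (f : Lfct p1) :
  Lp_scale a (\pi_Lp f) = \pi_Lp (a *: f).
Proof.
apply/Lp_eqP; have := Lp_reprP f; apply: filterS => x fx.
exact: (congr1 (fun z : K => a * z) fx).
Qed.

Lemma Lp_add_pi (f g : Lfct p1) : \pi_Lp f + \pi_Lp g = \pi_Lp (f + g).
Proof. exact/esym/pi_addr. Qed.

Let Lp_scaleA a b u : Lp_scale a (Lp_scale b u) = Lp_scale (a * b) u.
Proof. by rewrite -[u]reprK (Lp_scale_pi b) !Lp_scale_pi scalerA. Qed.

Let Lp_scale1 : left_id 1 Lp_scale.
Proof. by move=> u; rewrite -[u]reprK Lp_scale_pi scale1r. Qed.

Let Lp_scaleDr : right_distributive Lp_scale +%R.
Proof.
move=> a u v; rewrite -[u]reprK -[v]reprK.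
by rewrite Lp_add_pi (Lp_scale_pi _ (_ + _)) scalerDr -Lp_add_pi -!Lp_scale_pi.
Qed.

Let Lp_scaleDl u : {morph Lp_scale^~ u : a b / a + b}.
Proof.
move=> a b; rewrite -[u]reprK (Lp_scale_pi (a + b)) scalerDl -Lp_add_pi.
by rewrite -!Lp_scale_pi.
Qed.

HB.instance Definition _ := GRing.Zmodule_isLmodule.Build K Lp
  Lp_scaleA Lp_scale1 Lp_scaleDr Lp_scaleDl.

Definition Lfct_norm (f : Lfct p1) : R := fine 'N[mu]_p[EFin \o (nrm \o f)].

Lemma Lfct_normE (f : Lfct p1) :
  ((Lfct_norm f)%:E = 'N[mu]_p[EFin \o (nrm \o f)])%E.
Proof. by rewrite fineK// ge0_fin_numE ?Lnorm_ge0//; exact: Lfct_finite. Qed.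

Definition Lp_norm (u : Lp) : K := ofR (Lfct_norm (repr u)).

Lemma Lp_norm_pi (f : Lfct p1) : Lp_norm (\pi_Lp f) = ofR (Lfct_norm f).
Proof.
congr ofR; congr fine; apply/eqP; rewrite eq_le.
by apply/andP; split; apply: ae_le_Lnorm => //;
  do ?[exact/scalar_measurable_nrm/Lfct_measurable];
  have := Lp_reprP f; apply: filterS => x fx; rewrite /= fx nrm_ge0 /=.
Qed.

Let Lp_normD u v : Lp_norm (u + v) <= Lp_norm u + Lp_norm v.
Proof.
rewrite -[u]reprK -[v]reprK Lp_add_pi !Lp_norm_pi -ofRD ler_ofR.
rewrite -lee_fin EFinD !Lfct_normE.
by apply: Lnorm_nrmD => //; exact: Lfct_measurable.
Qed.

Let Lp_normZ (a : K) u : Lp_norm (a *: u) = `|a| * Lp_norm u.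
Proof.
rewrite -[u]reprK [_ *: _]Lp_scale_pi !Lp_norm_pi nrmE -ofRM.
congr ofR; apply/EFin_inj; rewrite EFinM !Lfct_normE.
by apply: Lnorm_nrmZ => //; [exact: Lfct_measurable|exact: Lfct_finite].
Qed.

Let Lp_norm0_eq0 u : Lp_norm u = 0 -> u = 0.
Proof.
rewrite -[u]reprK Lp_norm_pi -(@ofR0 R s) => /(can_inj (@ofRK R s))/eqP.
rewrite -eqe Lfct_normE => /eqP u0.
rewrite -[0]pi_zeror; apply/Lp_eqP.
have mu' : measurable_fun setT (EFin \o (nrm \o repr u)).
  exact/measurable_EFinP/scalar_measurable_nrm/Lfct_measurable.
have := Lnorm_eq0_eq0 mu' (lt_le_trans lte01 p1) u0.
by apply: filterS => x /(_ I) [] /nrm0_eq0.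
Qed.

HB.instance Definition _ := Lmodule_isNormed.Build K Lp
  Lp_normD Lp_normZ Lp_norm0_eq0.

End Lfct.
Arguments Lp {d T R} s mu {p} p1.

Section canonical_map.
Context d (T : measurableType d) (R : realType) (s : scalars).
Variables (mu : probability T R) (p : \bar R) (p1 : (1 <= p)%E).
Local Open Scope quotient_scope.

Local Notation Linfty := (Lp s mu (leey 1)).

Lemma Linfty_Lfct_subproof (f : Lfct s mu (leey 1)) :
  (f : T -> _) \in @Lfunction_pred _ T R s mu p.
Proof.
have mf := Lfct_measurable f; rewrite inE; split=> //.
have fL : (nrm \o f) \in Lfun mu +oo%E.
  apply/andP; rewrite !inE; split; first exact: scalar_measurable_nrm.
  exact: Lfct_finite.
have mu_fin : mu [set: T] \is a fin_num by exact: fin_num_measure.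
by have /andP[_] := Lfun_subset p1 (leey 1) mu_fin (leey p) fL; rewrite inE.
Qed.

Definition Linfty_to_Lp (u : Linfty) : Lp s mu p1 :=
  \pi_(Lp s mu p1) (MkLfct p1 (Linfty_Lfct_subproof (repr u))).

End canonical_map.

Section operators.
Context {R : realType} {s : scalars}.
Local Notation K := (scalar_field R s).

Definition finite_rank (X Y : normedModType K) (T : bop X Y) : Prop :=
  exists (n : nat) (e : 'I_n -> Y), forall x : X,
    exists c : 'I_n -> K, T x = \sum_i c i *: e i.

Lemma rank_one_subproof (X Y : normedModType K) (f : dual X) (y : Y) :
  (fun x : X => (f x : K) *: y) \in @bounded_linear R s X Y.
Proof.
apply: (@bounded_linearP _ _ _ _ _ (nrm f * nrm y)) => [a x x'|x].
  by rewrite linearP scalerDl scalerA.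
rewrite nrmZ mulrAC ler_wpM2r ?nrm_ge0// [nrm f]nrm_bopE.
exact: ler_opnorm.
Qed.

Definition rank_one (X Y : normedModType K) (f : dual X) (y : Y) : bop X Y :=
  Bop (rank_one_subproof f y).

(* Only the data (classes of operators and ideal norm): the approximation
   properties below do not refer to the ideal axioms. *)
Record operator_ideal := OperatorIdeal {
  in_ideal : forall X Y : completeNormedModType K, bop X Y -> Prop;
  ideal_norm : forall X Y : completeNormedModType K, bop X Y -> \bar R }.

End operators.
Arguments operator_ideal : clear implicits.

Section p_integral.
Context {R : realType} (s : scalars) (p : R) (p1 : (1 <= p%:E)%E).
Local Notation K := (scalar_field R s).

Definition integral_factorization (X Y : normedModType K) (T : bop X Y)
    (d : measure_display) (Omega : measurableType d) (mu : probability Omega R)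
    (A : bop X (Lp s mu (leey 1))) (B : bop (Lp s mu p1) (dual (dual Y))) :=
  forall x : X, bidual_embedding (T x) = B (Linfty_to_Lp p1 (A x)).

Definition p_integral (X Y : normedModType K) (T : bop X Y) : Prop :=
  exists (d : measure_display) (Omega : measurableType d)
    (mu : probability Omega R) (A : bop X (Lp s mu (leey 1)))
    (B : bop (Lp s mu p1) (dual (dual Y))), integral_factorization T A B.

Definition p_integral_norm (X Y : normedModType K) (T : bop X Y) : \bar R :=
  ereal_inf [set c | exists (d : measure_display) (Omega : measurableType d)
    (mu : probability Omega R) (A : bop X (Lp s mu (leey 1)))
    (B : bop (Lp s mu p1) (dual (dual Y))),
    integral_factorization T A B /\ c = (nrm A * nrm B)%:E].

Definition p_integral_ideal : operator_ideal R s :=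
  OperatorIdeal (fun X Y => @p_integral X Y) (fun X Y => @p_integral_norm X Y).

End p_integral.

Section p_nuclear.
Context {R : realType} (s : scalars) (p : R).
Local Notation K := (scalar_field R s).

(* ell_q norm of a sequence, see [Lnorm_counting]; the sup norm for q = +oo. *)
Definition lp_norm (q : \bar R) (u : nat -> R) : \bar R :=
  'N[counting]_q[EFin \o u].

Definition weakly_summable (Y : normedModType K) (q : \bar R) (y : nat -> Y) :=
  forall f : dual Y, (lp_norm q (fun n => nrm (f (y n))) < +oo)%E.

Definition weak_lp_norm (Y : normedModType K) (q : \bar R) (y : nat -> Y) :=
  ereal_sup [set lp_norm q (fun n => nrm (f (y n))) |
    f in [set f : dual Y | nrm f <= 1]].

Definition nuclear_representation (X Y : normedModType K) (T : bop X Y)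
    (f : nat -> dual X) (y : nat -> Y) : Prop :=
  [/\ (lp_norm p%:E (fun n => nrm (f n)) < +oo)%E,
      weakly_summable (hoelder_conjugate p%:E) y &
      series (fun n => rank_one (f n) (y n)) @ \oo --> T].

Definition p_nuclear (X Y : normedModType K) (T : bop X Y) : Prop :=
  exists (f : nat -> dual X) (y : nat -> Y), nuclear_representation T f y.

Definition p_nuclear_norm (X Y : normedModType K) (T : bop X Y) : \bar R :=
  ereal_inf [set c | exists (f : nat -> dual X) (y : nat -> Y),
    nuclear_representation T f y /\
    c = (lp_norm p%:E (fun n => nrm (f n)) *
         weak_lp_norm (hoelder_conjugate p%:E) y)%E].

Definition p_nuclear_ideal : operator_ideal R s :=
  OperatorIdeal (fun X Y => @p_nuclear X Y) (fun X Y => @p_nuclear_norm X Y).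

End p_nuclear.

Definition directed (I : Type) (le : I -> I -> Prop) : Prop :=
  [/\ (exists i : I, True), (forall i, le i i),
      (forall i j k, le i j -> le j k -> le i k) &
      (forall i j, exists2 k, le i k & le j k)].

Definition tails (I : Type) (le : I -> I -> Prop) : set_system I :=
  [set A | exists i, forall j, le i j -> A j].

Definition net_limsup (R : realType) (I : Type) (le : I -> I -> Prop)
    (f : I -> \bar R) : \bar R :=
  ereal_inf [set ereal_sup [set f j | j in le i] | i in [set: I]].

Section approximation_properties.
Context {R : realType} {s : scalars}.
Local Notation K := (scalar_field R s).
Variables (A : operator_ideal R s) (X : completeNormedModType K).

Definition weak_lambda_BAP (lambda : R) : Prop :=
  forall (Y : completeNormedModType K) (T : bop X Y), in_ideal A T ->
  exists (I : Type) (le : I -> I -> Prop) (S : I -> bop X X),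
    [/\ directed le, (forall a, finite_rank (S a)),
        (forall x : X, S a x @[a --> tails le] --> x) &
        (net_limsup le (fun a => ideal_norm A (bop_comp T (S a))) <=
         lambda%:E * ideal_norm A T)%E].

Definition weak_BAP : Prop :=
  exists2 lambda : R, 1 <= lambda & weak_lambda_BAP lambda.

Definition local_MAP : Prop :=
  forall (Y : completeNormedModType K) (T : bop X Y), in_ideal A T ->
  exists (I : Type) (le : I -> I -> Prop) (S : I -> bop X Y),
    [/\ directed le, (forall a, finite_rank (S a)),
        (forall x : X, S a x @[a --> tails le] --> T x) &
        (net_limsup le (fun a => ideal_norm A (S a)) <=
         ideal_norm A T)%E].

End approximation_properties.

Lemma lee1_gt2 (R : realType) (p : R) : 2 < p -> (1 <= p%:E)%E.
Proof. by move=> p2; rewrite lee_fin ltW// (lt_trans _ p2)// ltr1n. Qed.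

(* Main.v *)
From HB Require Import structures.
Require Import Defs.
From mathcomp Require Import all_boot all_order all_algebra.
From mathcomp Require Import complex lra ring zify.
From mathcomp Require Import all_classical all_reals all_analysis.
From mathcomp Require Import ess_sup_inf.

(** The two local properties hold for every Banach space, so all the work is in
    finding one space without the weak properties; the same space serves both
    ideals.

    Local approximation. A p-nuclear operator is approximated in operator norm
    by the partial sums of a representation, whose nuclear norms do not exceed
    the norm of that representation ([local_MAP_p_nuclear]). For a p-integral
    operator with factorization B i_p A, finitely many functions A x_i are
    nearly constant on the cells of a finite partition of the measure space;
    replacing a function by the values of functionals carried by the cells
    gives a factorization through a finite-dimensional L_p space, at the cost
    of a small error at the x_i. The second factor still takes values in the
    bidual of Y, and the principle of local reflexivity brings it down to Y
    ([integral_local_approximation], [local_MAP_p_integral]). Local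
    reflexivity is derived from Helly's lemma, which comes from the
    Hahn-Banach theorem, which comes from Zorn's lemma.

    Failure of the weak approximation property. Let A be an infinite matrix
    with A^2 = 0 whose trace is nevertheless 1, the partial sums of the trace
    being equal to 1 at the ends of the levels below. Let X be the space of
    bounded sequences f with f A = 0; it contains the rows a_n of A. If S is
    an operator of finite rank on X, the series of the (S a_n)(n) has sum 0:
    for S = phi (x) v its value is phi (v A), and v A = 0
    ([finite_rank_trace]). If S_alpha tends to the identity pointwise, each
    finite piece of that series tends to the corresponding piece of the trace
    of A. The two facts contradict each other as soon as the tails are small
    uniformly in alpha. Now let T from X to l_infinity multiply the n-th
    coordinate by w_n > 0. The n-th term of the series is at most
    ||T S_alpha|| ||a_n|| / w_n, and the operator norm is at most the ideal
    norm; so a bound on the ideal norms of the T S_alpha is excluded when the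
    sum of the ||a_n|| / w_n is finite ([not_weak_BAP]). And T belongs to both
    ideals when the sum of the w_n^p is finite
    ([weight_nuclear_representation], [weight_p_integral]).

    The matrix. On level k put a space of dimension 3 * 2^k, split into the
    range of U_k, of dimension 2^k, and the range of V_k, of dimension 2^(k+1).
    With left inverses U_k^-1 and V_k^-1 that vanish on the other summand,
    let
      A = sum_k 2^-(k+1) (V_k - U_(k+1)) (V_k^-1 + U_(k+1)^-1),
    where the index tells on which level a vector lives. Since
    V_k^-1 V_k - U_(k+1)^-1 U_(k+1) = 1 - 1, the square is 0, and the traces
    of the summands telescope ([traceful_matrix_sq], [traceful_matrix_trace]).
    The blocks of A on level k are, up to a factor of order 2^-k, built from
    products of one orthogonal matrix with the transpose of another. Twisting
    Hadamard matrices by signs chosen with an averaging argument makes all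
    entries of those products of order k 2^(-k/2) ([flat_signs], [flat_bases]), so that
    rows on level k have sup norm of order k 2^(-3k/2). With about 2^k rows on
    level k and w_n = 2^(-tk) there, the sum of the ||a_n|| / w_n is finite
    for t < 1/2 and the sum of the w_n^p for t > 1/p: some t does both exactly
    when p > 2 ([traceful_square_zero_exists]). *)

Set Implicit Arguments.
Unset Strict Implicit.
Unset Printing Implicit Defensive.

Import Order.TTheory GRing.Theory Num.Theory.
Import numFieldNormedType.Exports.

Local Open Scope classical_set_scope.
Local Open Scope ring_scope.

(** * Scalars and norms, real or complex *)

Section scalar_norms.
Context {R : realType} {s : scalars}.
Local Notation K := (scalar_field R s).

Lemma ofRN (a : R) : ofR (- a) = - ofR a :> K.
Proof. by case: s => //=; rewrite rmorphN. Qed.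

Lemma ofR_sum I (r : seq I) (P : pred I) (F : I -> R) :
  ofR (\sum_(i <- r | P i) F i) = \sum_(i <- r | P i) ofR (F i) :> K.
Proof. by rewrite (big_morph _ (@ofRD R s) (@ofR0 R s)). Qed.

Lemma reN (z : K) : re (- z) = - re z.
Proof. by case: s z => //= -[]. Qed.

Lemma re_sum I (r : seq I) (P : pred I) (F : I -> K) :
  re (\sum_(i <- r | P i) F i) = \sum_(i <- r | P i) re (F i).
Proof. by rewrite (big_morph _ (@reD R s) (@re0 R s)). Qed.

Lemma ler_re_nrm (z : K) : `|re z| <= nrm z.
Proof.
rewrite /nrm re_normE -sqrtr_sqr ler_wsqrtr// lerDl; exact: sqr_ge0.
Qed.

Lemma nrm_le_reim (z : K) : nrm z <= `|re z| + `|im z|.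
Proof.
rewrite /nrm re_normE -[leRHS]ger0_norm ?addr_ge0// -sqrtr_sqr ler_wsqrtr//.
rewrite sqrrD !real_normK ?num_real//.
by have := mulr_ge0 (normr_ge0 (re z)) (normr_ge0 (im z)); lra.
Qed.

Lemma nrm1 : nrm (1 : K) = 1.
Proof. by rewrite /nrm normr1 -[X in re X](@ofR1 R s) ofRK. Qed.

Lemma nrmN (V : normedZmodType K) (x : V) : nrm (- x) = nrm x.
Proof. by rewrite /nrm normrN. Qed.

Lemma nrm_distC (V : normedZmodType K) (x y : V) : nrm (x - y) = nrm (y - x).
Proof. by rewrite /nrm distrC. Qed.

Lemma nrm_normr (a : R) : nrm (ofR a : K) = `|a|.
Proof.
have [a0|a0] := leP 0 a; first by rewrite nrm_ofR// ger0_norm.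
by rewrite -nrmN -ofRN nrm_ofR ?oppr_ge0 ?ltW// ltr0_norm.
Qed.

Lemma ler_nrm_sum (V : normedZmodType K) I (r : seq I) (P : pred I) (F : I -> V) :
  nrm (\sum_(i <- r | P i) F i) <= \sum_(i <- r | P i) nrm (F i).
Proof.
elim/big_ind2 : _ => [|x a y b xa yb|//]; first by rewrite nrm0.
by rewrite (le_trans (ler_nrmD _ _))// lerD.
Qed.

Lemma ex_phase (z : K) : exists2 u : K, nrm u = 1 & u * z = ofR (nrm z).
Proof.
have [->|z0] := eqVneq z 0; first by exists 1; rewrite ?nrm1// mulr0 nrm0 ofR0.
exists (`|z| / z); last by rewrite divfK// nrmE.
by rewrite /nrm normrM normfV normr_id mulfV ?normr_eq0// -[X in re X](@ofR1 R s) ofRK.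
Qed.

Lemma nrm_gt0 (V : normedZmodType K) (x : V) : x != 0 -> 0 < nrm x.
Proof.
by move=> x0; rewrite lt0r nrm_ge0 andbT; apply: contra x0 => /eqP/nrm0_eq0/eqP.
Qed.

End scalar_norms.

(** * The Hahn-Banach theorem *)

Section hahn_banach.
Context {R : realType} {s : scalars}.
Local Notation K := (scalar_field R s).
Context (V : lmodType K).
Implicit Types (q : V -> R) (x y : V).

(** Homogeneity for real [r] only, so that one notion serves both fields; the
    inequality for [r^-1] gives the equality for [r], see [sublinearZ]. *)
Record sublinear q : Prop := Sublinear {
  sublinearD : forall x y, q (x + y) <= q x + q y;
  sublinearZ_le : forall (r : R) x, 0 <= r -> q (ofR r *: x) <= r * q x }.

Lemma sublinear0 q : sublinear q -> q 0 = 0.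
Proof.
move=> [qD qZ]; apply/eqP; rewrite eq_le; apply/andP; split.
  by have := qZ 0 0 (lexx _); rewrite scaler0 mul0r.
by have := qD 0 0; rewrite addr0; lra.
Qed.

Lemma sublinearZ q (r : R) x : sublinear q -> 0 <= r -> q (ofR r *: x) = r * q x.
Proof.
move=> qs; rewrite le_eqVlt => /predU1P[<-|r0].
  by rewrite ofR0 scale0r mul0r sublinear0.
apply/eqP; rewrite eq_le; apply/andP; split; first by apply: sublinearZ_le; rewrite ?ltW.
have := sublinearZ_le qs (ofR r *: x) (ltW (eqbRL (invr_gt0 r) r0)).
by rewrite scalerA -ofRM mulVf ?gt_eqF// ofR1 scale1r ler_pdivlMl.
Qed.

(** Lowering [q] along [x]: the term [t = 1] shows that the infimum is at most
    [- q x] at [- x]. A [q] that cannot be lowered is therefore additive. *)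
Definition shear_set q x y := [set q (y + ofR t *: x) - t * q x | t in [set t | 0 <= t]].
Definition shear q x y : R := inf (shear_set q x y).

Lemma shear_has_inf q x y : sublinear q -> has_inf (shear_set q x y).
Proof.
move=> qs; split; first by exists (q (y + ofR 0 *: x) - 0 * q x), 0 => /=.
exists (- q (- y)) => _ [t /= t0 <-].
have := sublinearD qs (y + ofR t *: x) (- y).
by rewrite addrAC addrN add0r (sublinearZ _ qs t0); lra.
Qed.

Lemma shear_le q x y t : sublinear q -> 0 <= t -> shear q x y <= q (y + ofR t *: x) - t * q x.
Proof. by move=> /shear_has_inf-/(_ x y)[_ h] t0; apply: ge_inf => //; exists t. Qed.

Lemma shear_approx q x y e : sublinear q -> 0 < e ->
  exists2 t, 0 <= t & q (y + ofR t *: x) - t * q x < shear q x y + e.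
Proof.
move=> qs e0; have [_ [t /= t0 <-] h] := inf_adherent e0 (shear_has_inf x y qs).
by exists t.
Qed.

Lemma sublinear_shear q x : sublinear q -> sublinear (shear q x).
Proof.
move=> qs; split => [y z|r y].
  apply/ler_addgt0Pr => e e0.
  have [|t t0 yt] := @shear_approx q x y (e / 2) qs; first lra.
  have [|u u0 zu] := @shear_approx q x z (e / 2) qs; first lra.
  have tu0 : 0 <= t + u by rewrite addr_ge0.
  apply: (le_trans (shear_le x (y + z) qs tu0)).
  rewrite ofRD scalerDl addrACA.
  have := sublinearD qs (y + ofR t *: x) (z + ofR u *: x).
  lra.
rewrite le_eqVlt => /predU1P[<-|r0].
  have := shear_le x 0 qs (lexx 0).
  by rewrite !ofR0 !scale0r addr0 !mul0r (sublinear0 qs) subr0.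
rewrite -ler_pdivrMl//; apply: lb_le_inf; first by case: (shear_has_inf x y qs).
move=> _ [t /= t0 <-]; rewrite ler_pdivrMl//.
have rt0 : 0 <= r * t by rewrite mulr_ge0// ltW.
apply: (le_trans (shear_le x _ qs rt0)).
rewrite ofRM -scalerA -scalerDr (sublinearZ _ qs (ltW r0)) mulrBr.
by rewrite mulrA.
Qed.

Lemma shear_le_id q x y : sublinear q -> shear q x y <= q y.
Proof.
by move=> qs; have := shear_le x y qs (lexx 0); rewrite ofR0 scale0r addr0 mul0r subr0.
Qed.

(** Zorn's lemma for the reversed pointwise order. The pointwise infimum of a
    chain is finite because every member satisfies [q x >= - q (- x) >= - p (- x)],
    and it is subadditive because two members can always be compared. *)
Lemma minimal_sublinear (p : V -> R) : sublinear p ->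
  exists q, [/\ sublinear q, (forall x, q x <= p x) &
    forall q', sublinear q' -> (forall x, q' x <= q x) -> forall x, q x <= q' x].
Proof.
move=> ps.
pose T := {q | sublinear q /\ forall x, q x <= p x}.
pose le (q1 q2 : T) := `[< forall x, sval q2 x <= sval q1 x >].
have [| | | |[q [qs qp]] qmin] := @Zorn T le.
- by move=> t; apply/asboolP => x.
- by move=> u v w /asboolP uv /asboolP vw; apply/asboolP => x; apply: (le_trans (vw x)).
- move=> [u up] [v vp] /asboolP /= uv /asboolP /= vu.
  by apply: eq_exist; apply/funext => x; apply/eqP; rewrite eq_le uv vu.
- move=> A tot; have [[q0 Aq0]|A0] := pselect (exists g : T, A g); last first.
    exists (exist _ p (conj ps (fun x => lexx _))) => q Aq; exfalso.
    by apply: A0; exists q.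
  pose S x := [set sval g x | g in A].
  have Sinf x : has_inf (S x).
    split; first by exists (sval q0 x), q0.
    exists (- p (- x)) => _ [[q [qs qp]] _ <-] /=.
    have := sublinearD qs x (- x); rewrite addrN sublinear0//.
    by have := qp (- x); lra.
  have Sle x (g : T) : A g -> inf (S x) <= sval g x.
    by move=> Ag; apply: ge_inf; [case: (Sinf x)|exists g].
  have rs : sublinear (fun x => inf (S x)).
    split => [x y|r x r0].
      apply/ler_addgt0Pr => e e0; have e20 : 0 < e / 2 by lra.
      have [_ [q1 Aq1 <-] h1] := inf_adherent e20 (Sinf x).
      have [_ [q2 Aq2 <-] h2] := inf_adherent e20 (Sinf y).
      have [/asboolP h|/asboolP h] := tot _ _ Aq1 Aq2.
        apply: (le_trans (Sle (x + y) q2 Aq2)).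
        have [[qD _] _] := svalP q2.
        by have := qD x y; have := h x; lra.
      apply: (le_trans (Sle (x + y) q1 Aq1)).
      have [[qD _] _] := svalP q1.
      by have := qD x y; have := h y; lra.
    move: r0; rewrite le_eqVlt => /predU1P[<-|r0].
      have [q0s _] := svalP q0; rewrite ofR0 scale0r mul0r.
      by rewrite (le_trans (Sle 0 q0 Aq0))// sublinear0.
    rewrite -ler_pdivrMl//; apply: lb_le_inf; first by case: (Sinf x).
    move=> _ [q Aq <-]; rewrite ler_pdivrMl// (le_trans (Sle _ q Aq))//.
    by have [qs _] := svalP q; rewrite sublinearZ// ltW.
  have rp x : inf (S x) <= p x.
    by rewrite (le_trans (Sle x q0 Aq0))//; have [_] := svalP q0; apply.
  exists (exist _ (fun x => inf (S x)) (conj rs rp)) => g Ag; apply/asboolP => x /=.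
  exact: Sle.
exists q; split => // q' q's q'q x.
have q'p y : q' y <= p y by rewrite (le_trans (q'q y)).
have := qmin (exist _ q' (conj q's q'p)).
have -> : le (exist _ q (conj qs qp)) (exist _ q' (conj q's q'p)) by apply/asboolP.
by move=> /(_ isT)/(congr1 sval)/= ->.
Qed.

(** A minimal sublinear functional is linear, because its shears do not lie
    below it. Starting below the shear of [p] along [v0] gives [f (- v0) <= - p v0],
    hence the equality at [v0]. *)
Lemma real_hahn_banach (p : V -> R) (v0 : V) : sublinear p ->
  exists f : V -> R, [/\ (forall x y, f (x + y) = f x + f y),
    (forall (r : R) x, f (ofR r *: x) = r * f x), (forall x, f x <= p x) &
    f v0 = p v0].
Proof.
move=> ps; have [q [qs qp qmin]] := minimal_sublinear (sublinear_shear v0 ps).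
have qD x y : q (x + y) = q x + q y.
  apply/eqP; rewrite eq_le sublinearD//=.
  have := qmin _ (sublinear_shear x qs) (fun y => shear_le_id x y qs) y.
  have := shear_le x y qs ler01; rewrite ofR1 scale1r mul1r (addrC y); lra.
have qN x : q (- x) = - q x.
  by apply/eqP; rewrite -subr_eq0 opprK addrC -qD addrN sublinear0.
exists q; split => //.
- move=> r x; have [r0|r0] := leP 0 r; first exact: sublinearZ.
  have nr0 : 0 <= - r by rewrite oppr_ge0 ltW.
  by rewrite -{1}[r]opprK ofRN scaleNr qN sublinearZ// mulNr opprK.
- by move=> x; rewrite (le_trans (qp x))// shear_le_id.
- apply/eqP; rewrite eq_le (le_trans (qp _)) ?shear_le_id//=.
  have := qp (- v0); have := shear_le v0 (- v0) ps ler01.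
  by rewrite ofR1 scale1r mul1r addNr sublinear0// qN; lra.
Qed.

(** Over the complex field, [f] is the real part of [f w - i f (i w)]. *)
Lemma linear_of_re (f : V -> R) :
  (forall x y, f (x + y) = f x + f y) -> (forall (r : R) x, f (ofR r *: x) = r * f x) ->
  exists2 g : V -> K^o, linear g & forall x, re (g x : K) = f x.
Proof.
case: s V f => /= W f fD fZ.
  by exists f => // a x y; rewrite fD fZ.
have fN (w : W) : f (- w) = - f w.
  by rewrite -scaleN1r -(rmorphN1 (real_complex R)) fZ mulN1r.
exists (fun w : W => (f w +i* - f ('i%C *: w))%C : R[i]^o) => // -[a b] v w.
have bE z : ((a +i* b)%C : R[i]) *: z = (a%:C)%C *: z + (b%:C)%C *: ('i%C *: z) :> W.
  rewrite scalerA -scalerDl; congr (_ *: _).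
  by apply/eqP; rewrite eq_complex/=; apply/andP; split; apply/eqP; ring.
have ii (z : W) : 'i%C *: ('i%C *: z) = - z.
  by rewrite scalerA -scaleN1r -expr2 sqr_i.
have c1 c (z : W) : 'i%C *: ((c%:C)%C *: z) = (c%:C)%C *: ('i%C *: z).
  by rewrite !scalerA mulrC.
rewrite !fD bE !scalerDr !c1 ii !fD !fZ fN.
by apply/eqP; rewrite eq_complex /=; apply/andP; split; apply/eqP; ring.
Qed.

(** A seminorm given by its upper bounds: [S x M] means that the seminorm of [x]
    is at most [M]. Seminorms that are infima, or essential suprema over a set,
    enter in this form without having to be computed. *)
Record seminorm_rel (S : V -> R -> Prop) : Prop := SeminormRel {
  seminorm_rel_ge0 : forall x M, S x M -> 0 <= M;
  seminorm_rel_ex : forall x, exists M, S x M;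
  seminorm_relD : forall x y M N, S x M -> S y N -> S (x + y) (M + N);
  seminorm_relZ : forall (a : K) x M, S x M -> S (a *: x) (nrm a * M) }.

(** The real theorem bounds the real part of [f]; multiplying [x] by a scalar of
    modulus 1 turns this into a bound on the modulus. *)
Theorem seminorm_hahn_banach (S : V -> R -> Prop) (v0 : V) (m : R) : seminorm_rel S ->
  (forall M, S v0 M -> m <= M) ->
  exists2 f : V -> K^o, linear f &
    (forall x M, S x M -> nrm (f x) <= M) /\ m <= re (f v0 : K).
Proof.
move=> gS v0m.
have Sinf x : has_inf (S x).
  split; first exact: (seminorm_rel_ex gS).
  by exists 0 => M /(seminorm_rel_ge0 gS).
pose p x := inf (S x).
have pS x M : S x M -> p x <= M by move=> SM; apply: ge_inf => //; case: (Sinf x).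
have ps : sublinear p.
  split => [x y|r x r0].
    apply/ler_addgt0Pr => e e0; have e20 : 0 < e / 2 by lra.
    have [M SM h1] := inf_adherent e20 (Sinf x).
    have [N SN h2] := inf_adherent e20 (Sinf y).
    by have := pS _ _ (seminorm_relD gS SM SN); rewrite /p; lra.
  have pr M : S x M -> p (ofR r *: x) <= r * M.
    by move=> SM; have := pS _ _ (seminorm_relZ gS (ofR r) SM); rewrite nrm_ofR.
  move: r0; rewrite le_eqVlt => /predU1P[r0|r0].
    by have [M SM] := seminorm_rel_ex gS x; have := pr M SM; rewrite -r0 !mul0r.
  rewrite -ler_pdivrMl//; apply: lb_le_inf; first exact: (seminorm_rel_ex gS).
  by move=> M SM; rewrite ler_pdivrMl// pr.
have [f [fD fZ fp fv]] := real_hahn_banach v0 ps.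
have [g lg gf] := linear_of_re fD fZ.
exists g => //; split; last first.
  by rewrite gf fv; apply: lb_le_inf => //; exact: (seminorm_rel_ex gS).
move=> x M SM; have [u u1 uz] := ex_phase (g x : K).
have gux : g (u *: x) = u * g x.
  pose G : {linear V -> K^o} := HB.pack g (GRing.isLinear.Build K V K^o *:%R g lg).
  exact: (linearZ_LR G).
have -> : nrm (g x) = re (g (u *: x) : K) by rewrite gux uz ofRK.
rewrite gf (le_trans (fp _))// -[M]mul1r -u1; apply: pS; exact: (seminorm_relZ gS).
Qed.

End hahn_banach.

(** * Bounded operators and Helly's lemma *)

Section operator_bounds.
Context {R : realType} {s : scalars}.
Local Notation K := (scalar_field R s).

Lemma bopE_sum (V W : normedModType K) I (r : seq I) (P : pred I) (F : I -> bop V W) x :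
  (\sum_(i <- r | P i) F i) x = \sum_(i <- r | P i) F i x.
Proof. by elim/big_ind2 : _ => // _ g _ h <- <-. Qed.

Lemma bop_exists (V W : normedModType K) (f : V -> W) (M : R) : 0 <= M -> linear f ->
  (forall x, nrm (f x) <= M * nrm x) -> exists g : bop V W, (forall x, g x = f x) /\ nrm g <= M.
Proof.
move=> M0 lf fM; exists (Bop (bounded_linearP lf fM)); split=> //.
by rewrite nrm_bopE; apply: opnorm_le.
Qed.

Lemma ler_bop (V W : normedModType K) (f : bop V W) x : nrm (f x) <= nrm f * nrm x.
Proof. by rewrite nrm_bopE; exact: ler_opnorm. Qed.

Lemma ler_dual (V : normedModType K) (f : dual V) x : nrm (f x : K) <= nrm f * nrm x.
Proof. exact: (@ler_bop V K^o f x). Qed.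

(** The vectors at which the [g l] nearly attain their norms can be chosen
    independently of each other. *)
Lemma sum_opnorm_le (V : normedModType K) (L : finType) (g : L -> dual V) (M : R) :
  (forall v : L -> V, (forall l, nrm (v l) <= 1) -> \sum_l nrm (g l (v l) : K) <= M) ->
  \sum_l nrm (g l) <= M.
Proof.
move=> gM; apply/ler_addgt0Pr => e e0.
have c0 : 0 < e / #|L|.+1%:R by rewrite divr_gt0.
have /choice[v vP] : forall l, exists v, nrm v <= 1 /\ nrm (g l) - e / #|L|.+1%:R < nrm (g l v : K).
  move=> l; have [_ [v /= v1 <-] h] := sup_adherent c0 (opnorm_has_sup (g l)).
  by exists v; split => //; rewrite nrm_bopE.
apply: (@le_trans _ _ (\sum_l (nrm (g l (v l) : K) + e / #|L|.+1%:R))).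
  by apply: ler_sum => l _; rewrite -lerBlDr ltW//; case: (vP l).
rewrite big_split/= lerD ?gM//; first by move=> l; case: (vP l).
rewrite sumr_const -[leLHS]mulr_natr mulrAC ler_pdivrMr// ler_wpM2l ?(ltW e0)//.
by rewrite ler_nat; exact: leqnSn.
Qed.

Lemma nrm_bidual (V : normedModType K) (x : V) : nrm (bidual_embedding x) <= nrm x.
Proof.
rewrite nrm_bopE; apply: opnorm_le => [|f]; first exact: nrm_ge0.
by rewrite mulrC; exact: (ler_bop f x).
Qed.

Lemma bidual_bop_subproof (V : normedModType K) :
  (@bidual_embedding R s V) \in @bounded_linear R s V (dual (dual V)).
Proof.
apply: (@bounded_linearP _ _ _ _ _ 1) => [a x y|x].
  by apply/val_inj/funext => f; rewrite /= linearP.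
by rewrite mul1r; exact: nrm_bidual.
Qed.

Definition bidual_bop (V : normedModType K) : bop V (dual (dual V)) :=
  Bop (@bidual_bop_subproof V).

Lemma nrm_bidual_bop (V : normedModType K) : nrm (bidual_bop V) <= 1.
Proof.
by rewrite nrm_bopE; apply: opnorm_le => // x; rewrite mul1r; exact: nrm_bidual.
Qed.

Lemma nrm_comp (U V W : normedModType K) (g : bop V W) (f : bop U V) :
  nrm (bop_comp g f) <= nrm g * nrm f.
Proof.
rewrite nrm_bopE; apply: opnorm_le => [|x]; first by rewrite mulr_ge0 ?nrm_ge0.
by rewrite (le_trans (ler_bop g (f x)))// -mulrA ler_wpM2l ?nrm_ge0// ler_bop.
Qed.

End operator_bounds.

Section helly.
Context {R : realType} {s : scalars}.
Local Notation K := (scalar_field R s).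

(** If no [y] exists, then [c] has distance at least 1 from the range of
    [y |-> (\sum_i t l i *: y i)_l] for the norm [max_l nrm (v l) / rho l].
    Hahn-Banach gives functionals [eta l] on [Y] with
    [\sum_l t l i *: eta l = 0] for all [i], [\sum_l rho l * nrm (eta l) <= 1] and
    [1 <= re (\sum_l eta l (c l))]. Testing the assumption on [y2] against them
    gives [1 <= \sum_l nrm (d l) * nrm (eta l)] with [nrm (d l) < rho l], which is
    absurd. *)
Lemma helly (Y : normedModType K) (I L : finType) (t : L -> I -> K) (c : L -> Y)
    (rho : L -> R) (y2 : I -> dual (dual Y)) : (forall l, 0 < rho l) ->
  (forall l, nrm (\sum_i t l i *: y2 i - bidual_embedding (c l)) < rho l) ->
  exists y : I -> Y, forall l, nrm (\sum_i t l i *: y i - c l) < rho l.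
Proof.
move=> rho0 y2P; apply: contrapT => noy.
pose ty (y : I -> Y) l := \sum_i t l i *: y i.
have tyD y z : ty (y + z) = ty y + ty z.
  apply/funext => l; rewrite /ty !fctE -big_split; apply: eq_bigr => i _.
  exact: scalerDr.
have tyZ a y : ty (a *: y) = a *: ty y.
  apply/funext => l; rewrite /ty !fctE scaler_sumr; apply: eq_bigr => i _.
  by rewrite !scalerA mulrC.
(* The distance to the range of [ty] in the norm max_l nrm (v l) / rho l. *)
pose S (v : L -> Y) (M : R) := 0 <= M /\ exists y, forall l, nrm (v l - ty y l) <= M * rho l.
have gS : seminorm_rel S.
  split => [v M []//|v|v w M N [M0 [y hy]] [N0 [z hz]]|a v M [M0 [y hy]]].
  - exists (\sum_l nrm (v l) / rho l); split.
      by apply: sumr_ge0 => l _; rewrite divr_ge0 ?nrm_ge0// ltW.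
    exists 0 => l; rewrite /ty big1 ?subr0 => [|i _]; last by rewrite scaler0.
    rewrite (bigD1 l)//= mulrDl divfK ?gt_eqF// lerDl mulr_ge0 ?(ltW (rho0 l))//.
    by apply: sumr_ge0 => k _; rewrite divr_ge0 ?nrm_ge0// ltW.
  - split; first by rewrite addr_ge0.
    exists (y + z) => l; rewrite tyD !fctE opprD addrACA mulrDl.
    by rewrite (le_trans (ler_nrmD _ _))// lerD.
  - split; first by rewrite mulr_ge0 ?nrm_ge0.
    exists (a *: y) => l; rewrite tyZ !fctE -scalerBr nrmZ -mulrA.
    by rewrite ler_wpM2l ?nrm_ge0.
have c1 M : S c M -> 1 <= M.
  move=> [M0 [y hy]]; rewrite leNgt; apply/negP => M1; apply: noy; exists y => l.
  by rewrite nrm_distC (le_lt_trans (hy l))// gtr_pMl.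
have [f lf [fS fc]] := seminorm_hahn_banach gS c1.
pose F : {linear (L -> Y) -> K^o} := HB.pack f (GRing.isLinear.Build K (L -> Y) K^o *:%R f lf).
pose single l y : L -> Y := fun k => if k == l then y else 0.
have sB l y k : single l y k = if k == l then y else 0 by [].
have lin_eta l : linear (fun y => f (single l y)).
  move=> a y z; rewrite -lf; congr f; apply/funext => k; rewrite !fctE !sB.
  by case: ifP => // _; rewrite scaler0 addr0.
have eta_bd l y : nrm (f (single l y)) <= (rho l)^-1 * nrm y.
  apply: fS; split; first by rewrite mulr_ge0 ?nrm_ge0// invr_ge0 ltW.
  exists 0 => k; rewrite /ty big1 ?subr0 => [|i _]; last by rewrite scaler0.
  rewrite sB; case: eqP => [->|_]; last first.
    by rewrite nrm0 mulr_ge0 ?(ltW (rho0 k))// mulr_ge0 ?nrm_ge0// invr_ge0 ltW.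
  by rewrite mulrC mulrA divff ?mul1r// gt_eqF.
pose eta l : dual Y := Bop (bounded_linearP (lin_eta l) (eta_bd l)).
have etaE l y : eta l y = f (single l y) by [].
have fE v : f v = \sum_l eta l (v l).
  have vE : v = \sum_l single l (v l).
    apply/funext => k; rewrite fct_sumE (bigD1 k)//= sB eqxx big1 ?addr0// => l lk.
    by rewrite sB eq_sym (negbTE lk).
  have -> : f v = F (\sum_l single l (v l)) by rewrite -vE.
  by rewrite linear_sum.
have fty y : f (ty y) = 0.
  apply/nrm0_eq0/eqP; rewrite eq_le nrm_ge0 andbT; apply: fS; split=> //.
  by exists y => l; rewrite subrr nrm0 mul0r.
have etat i : \sum_l t l i *: eta l = 0.
  apply/val_inj/funext => y /=.
  rewrite bopE_sum -[RHS](fty (fun k => if k == i then y else 0)) fE.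
  apply: eq_bigr => l _; rewrite -[LHS]/(t l i *: eta l y) -linearZ /=; congr (f (single l _)).
  rewrite /ty (bigD1 i)//= eqxx big1 ?addr0// => j /negbTE ->.
  by rewrite scaler0.
pose d l := \sum_i t l i *: y2 i - bidual_embedding (c l).
have fcE : f c = - \sum_l d l (eta l).
  rewrite /d -sumrN fE.
  have -> : \sum_l eta l (c l) = \sum_l eta l (c l) - \sum_i y2 i (\sum_l t l i *: eta l).
    by rewrite [X in _ - X]big1 ?subr0// => i _; rewrite etat linear0.
  under [X in _ - X]eq_bigr do rewrite linear_sum.
  rewrite exchange_big -sumrB/=; apply: eq_bigr => l _.
  rewrite -[RHS]/(- ((\sum_i t l i *: y2 i) (eta l) - eta l (c l))) opprB bopE_sum; congr (_ - _).
  by apply: eq_bigr => i _; rewrite linearZ.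
have eta1 : \sum_l rho l * nrm (eta l) <= 1.
  have -> : \sum_l rho l * nrm (eta l) = \sum_l nrm ((ofR (rho l) : K) *: eta l).
    by apply: eq_bigr => l _; rewrite nrmZ nrm_ofR// ltW.
  apply: sum_opnorm_le => v v1.
  have /choice[u uP] : forall l, exists u : K, nrm u = 1 /\ u * eta l (v l) = ofR (nrm (eta l (v l) : K)).
    by move=> l; have [u u1 uz] := ex_phase (eta l (v l) : K); exists u.
  have <- : re (f (fun l => (ofR (rho l) * u l) *: v l) : K) =
     \sum_l nrm (((ofR (rho l) : K) *: eta l) (v l) : K).
    rewrite fE re_sum; apply: eq_bigr => l _; rewrite linearZ/=.
    rewrite -[X in nrm X]/((ofR (rho l) : K) * eta l (v l)) nrmM nrm_ofR ?ltW//.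
    rewrite -[X in re X]/((ofR (rho l) * u l) * eta l (v l)).
    by rewrite -mulrA; case: (uP l) => _ ->; rewrite -ofRM ofRK.
  rewrite (le_trans (ler_norm _))// (le_trans (ler_re_nrm _))//; apply: fS; split => //.
  exists 0 => l; rewrite /ty big1 ?subr0 => [|i _]; last by rewrite scaler0.
  rewrite nrmZ nrmM nrm_ofR ?(ltW (rho0 l))//; case: (uP l) => -> _.
  by rewrite mulr1 mul1r ler_piMr// ltW.
have d1 : 1 <= \sum_l nrm (d l) * nrm (eta l).
  rewrite (le_trans fc)// fcE reN (le_trans (ler_norm _))// normrN.
  rewrite (le_trans (ler_re_nrm _))// (le_trans (ler_nrm_sum _ _ _))//.
  by apply: ler_sum => l _; exact: ler_dual.
(* Since nrm (d l) < rho l, the bounds d1 and eta1 leave no room for eta l. *)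
have eta0 l : nrm (eta l) = 0.
  have : \sum_l (rho l - nrm (d l)) * nrm (eta l) <= 0.
    under eq_bigr do rewrite mulrBl.
    by rewrite sumrB; lra.
  have pos k : 0 <= (rho k - nrm (d k)) * nrm (eta k).
    by rewrite mulr_ge0 ?nrm_ge0// subr_ge0 ltW// y2P.
  rewrite (bigD1 l)//=; have := sumr_ge0 (index_enum L) (fun k (_ : k != l) => pos k).
  have := pos l => p1 p2 p3.
  have /eqP : (rho l - nrm (d l)) * nrm (eta l) = 0 by lra.
  by rewrite mulf_eq0 subr_eq0 gt_eqF ?y2P//= => /eqP.
by move: d1; rewrite big1 ?ler10// => l _; rewrite eta0 mulr0.
Qed.

End helly.

(** * Local reflexivity *)

Section local_reflexivity.
Context {R : realType} {s : scalars}.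
Local Notation K := (scalar_field R s).

Lemma real_net (r e : R) : 0 < e ->
  exists m (u : 'I_m -> R), forall x, `|x| <= r -> exists i, `|x - u i| <= e.
Proof.
move=> e0; pose m := (Num.truncn ((r + r) / e)).+1.
exists m, (fun i => - r + (val i)%:R * e) => x; rewrite ler_norml => /andP[xr rx].
pose k := Num.truncn ((x + r) / e).
have km : (k < m)%N.
  rewrite ltnS; apply: le_truncn; rewrite ler_pM2r ?invr_gt0//; lra.
exists (Ordinal km) => /=.
have /truncn_itv /andP[k1 k2] : 0 <= (x + r) / e by rewrite divr_ge0 ?(ltW e0)//; lra.
move: k1 k2; rewrite -/k ler_pdivlMr// ltr_pdivrMr// -natr1 mulrDl mul1r => k1 k2.
by rewrite ler_norml; lra.
Qed.

(** For arguments that treat real and imaginary parts separately, over both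
    fields: [mk a b] is [a + i b] in the complex case and [a] in the real one. *)
Lemma scalar_of_reim : exists mk : R -> R -> K,
  forall z a b, nrm (z - mk a b) <= `|re z - a| + `|im z - b|.
Proof.
case: s => /=.
  exists (fun a b => a) => z a b; rewrite (le_trans (@nrm_le_reim R RealScalars (z - a)))//=.
  by rewrite normr0 addr0 lerDl.
exists (fun a b => (a +i* b)%C) => z a b.
rewrite (le_trans (@nrm_le_reim R ComplexScalars (z - (a +i* b)%C)))//.
by case: z.
Qed.

Lemma ler_im_nrm (z : K) : `|im z| <= nrm z.
Proof. by rewrite /nrm re_normE -sqrtr_sqr ler_wsqrtr// lerDr; exact: sqr_ge0. Qed.

Lemma scalar_net (r e : R) : 0 < e ->
  exists m (u : 'I_m -> K), forall z, nrm z <= r -> exists i, nrm (z - u i) <= e.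
Proof.
move=> e0; have e20 : 0 < e / 2 by lra.
have [m [u uP]] := real_net r e20; have [mk mkP] := scalar_of_reim.
exists #|{: 'I_m * 'I_m}|, (fun i => mk (u (enum_val i).1) (u (enum_val i).2)) => z zr.
have [i hi] := uP (re z) (le_trans (ler_re_nrm z) zr).
have [j hj] := uP (im z) (le_trans (ler_im_nrm z) zr).
exists (enum_rank (i, j)); rewrite enum_rankK/=.
by rewrite (le_trans (mkP _ _ _))//; lra.
Qed.

Lemma linear_ball (V W : normedModType K) (f : V -> W) (M : R) : linear f ->
  (forall x, nrm x <= 1 -> nrm (f x) <= M) -> forall x, nrm (f x) <= M * nrm x.
Proof.
move=> lf fM x; pose F : {linear V -> W} := HB.pack f (GRing.isLinear.Build K V W *:%R f lf).
have [->|x0] := eqVneq x 0; first by rewrite -[f 0]/(F 0) linear0 !nrm0 mulr0.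
have nx0 := nrm_gt0 x0.
have h : nrm (ofR (nrm x)^-1 : K) = (nrm x)^-1 by rewrite nrm_ofR// invr_ge0 ltW.
have := fM (ofR (nrm x)^-1 *: x); rewrite -[f (_ *: _)]/(F (_ *: _)) linearZ !nrmZ h mulVf ?gt_eqF//.
by rewrite ler_pdivrMl// [nrm x * M]mulrC; apply.
Qed.

(** The space [F] has finite dimension, with basis [e] and coordinates [cf].
    Helly's lemma is applied to the unknown vectors [w j = B2 (e j)] under three
    kinds of constraints: [B2 (z i)] is close to [y i]; [B2 u] is not much longer
    than [B1 u] for [u] in a finite net of the unit ball; and [B2 (e k)] is not much
    longer than [B1 (e k)]. The last bound is crude, but it suffices to pass from
    the net to the whole ball. *)
Theorem local_reflexivity (F Y : normedModType K) (n N : nat) (e : 'I_n -> F)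
    (cf : 'I_n -> F -> K^o) (C : R) (B1 : bop F (dual (dual Y)))
    (z : 'I_N -> F) (y : 'I_N -> Y) (eps del : R) :
  0 <= C -> (forall j, linear (cf j)) -> (forall j u, nrm (cf j u : K) <= C * nrm u) ->
  (forall u, u = \sum_j (cf j u : K) *: e j) ->
  0 < eps -> 0 < del ->
  (forall i, nrm (B1 (z i) - bidual_embedding (y i)) < eps) ->
  exists B2 : bop F Y, [/\ nrm B2 <= nrm B1 + del,
    (forall i, nrm (B2 (z i) - y i) < eps) &
    forall u, B2 u = \sum_j (cf j u : K) *: B2 (e j)].
Proof.
move=> C0 cfL cfC cfE eps0 del0 B1z.
pose b := nrm B1; pose E := \sum_j nrm (e j).
have b0 : 0 <= b := nrm_ge0 _.
have E0 : 0 <= E by apply: sumr_ge0 => j _; exact: nrm_ge0.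
(* Moving the coefficients of a vector by at most del / 2 / D moves its images
   under B1 and under B2 by at most del / 2 in total. *)
pose D := b * E + (b * E + n%:R) + 1.
have D0 : 0 < D.
  have : 0 <= b * E + n%:R by rewrite addr_ge0// mulr_ge0.
  by have := mulr_ge0 b0 E0; rewrite /D; lra.
have e0 : 0 < del / 2 / D by rewrite !divr_gt0.
have [m [u uP]] := scalar_net C e0.
pose uv (v : {ffun 'I_n -> 'I_m}) := \sum_j u (v j) *: e j.
(* Constraints at the points z i, at the net, and at the basis. *)
pose L := ('I_N + {ffun 'I_n -> 'I_m} + 'I_n)%type.
pose t (l : L) (j : 'I_n) : K := match l with
  | inl (inl i) => cf j (z i) | inl (inr v) => u (v j) | inr k => (j == k)%:R end.
pose c (l : L) : Y := if l is inl (inl i) then y i else 0.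
pose rho (l : L) : R := match l with
  | inl (inl i) => eps | inl (inr v) => b * nrm (uv v) + del / 2 | inr k => b * nrm (e k) + 1 end.
have rho0 l : 0 < rho l.
  case: l => [[i//|v]|k] /=.
    by have := mulr_ge0 b0 (nrm_ge0 (uv v)); lra.
  by have := mulr_ge0 b0 (nrm_ge0 (e k)); lra.
have J0 : bidual_embedding (0 : Y) = 0 by exact: (linear0 (bidual_bop Y)).
have B1E (a : 'I_n -> K) : \sum_j a j *: B1 (e j) = B1 (\sum_j a j *: e j).
  by rewrite linear_sum; apply: eq_bigr => j _; rewrite linearZ.
have one (V : normedModType K) (f : 'I_n -> V) k : \sum_j ((j == k)%:R : K) *: f j = f k.
  rewrite (bigD1 k)//= eqxx scale1r big1 ?addr0// => j /negbTE ->.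
  by rewrite scale0r.
have [l|w wP] := @helly R s Y 'I_n L t c rho (fun j => B1 (e j)) rho0.
  case: l => [[i|v]|k] /=; rewrite ?J0 ?subr0.
  - by rewrite B1E -cfE.
  - rewrite B1E (le_lt_trans (ler_bop _ _))// ltrDl; lra.
  - by rewrite one (le_lt_trans (ler_bop _ _))// ltrDl.
pose g (x : F) := \sum_j (cf j x : K) *: w j.
have gL : linear g.
  move=> a x x'; rewrite /g scaler_sumr -big_split; apply: eq_bigr => j _ /=.
  by rewrite cfL scalerDl scalerA.
have wb k : nrm (w k) <= b * nrm (e k) + 1.
  by have := wP (inr k); rewrite /= one subr0 => /ltW.
have gb x : nrm x <= 1 -> nrm (g x) <= b + del.
  move=> x1; have cfx j : nrm (cf j x : K) <= C.
    by rewrite (le_trans (cfC _ _))// ler_piMr.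
  have /choice[v0 vP] : forall j, exists i, nrm ((cf j x : K) - u i) <= del / 2 / D by move=> j; exact: uP.
  pose v := [ffun j => v0 j].
  have dist (V : normedModType K) (f : 'I_n -> V) :
      nrm (\sum_j (cf j x : K) *: f j - \sum_j u (v j) *: f j) <= del / 2 / D * \sum_j nrm (f j).
    rewrite -sumrB (le_trans (ler_nrm_sum _ _ _))// mulr_sumr; apply: ler_sum => j _.
    by rewrite -scalerBl nrmZ ler_wpM2r ?nrm_ge0// ffunE.
  have := wP (inl (inr v)); rewrite /= subr0 => h1.
  have h2 := dist _ w; have h3 := dist _ e; rewrite -cfE -/(uv v) in h3.
  have h4 : \sum_j nrm (w j) <= b * E + n%:R.
    rewrite /E mulr_sumr -[n in n%:R]card_ord -sumr_const -big_split; apply: ler_sum => j _ /=.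
    exact: wb.
  have h5 : nrm (uv v) <= 1 + del / 2 / D * E.
    have -> : uv v = x - (x - uv v) by rewrite opprB addrC subrK.
    by rewrite (le_trans (ler_nrmD _ _))// nrmN lerD.
  have h6 : nrm (g x) <= nrm (\sum_j u (v j) *: w j) + del / 2 / D * (b * E + n%:R).
    have -> : g x = \sum_j u (v j) *: w j + (g x - \sum_j u (v j) *: w j) by rewrite addrC subrK.
    rewrite (le_trans (ler_nrmD _ _))// lerD// (le_trans h2)// ler_wpM2l//; lra.
  have h7 : b * nrm (uv v) <= b + del / 2 / D * (b * E).
    by rewrite (le_trans (ler_wpM2l b0 h5))// mulrDr mulr1 mulrCA.
  have h8 : del / 2 / D * (b * E) + del / 2 / D * (b * E + n%:R) <= del / 2.
    rewrite -mulrDr -[leRHS](divfK (lt0r_neq0 D0)) ler_wpM2l//; first lra.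
    by rewrite /D lerDl.
  lra.
have bd0 : 0 <= b + del by lra.
have [B2 [B2E B2b]] := bop_exists bd0 gL (linear_ball gL gb).
have gE (a : 'I_N) : g (z a) = \sum_j t (inl (inl a)) j *: w j by [].
have B2e u0 : B2 u0 = \sum_j (cf j u0 : K) *: B2 (e j).
  by rewrite [in LHS](cfE u0) linear_sum; apply: eq_bigr => j _; rewrite linearZ.
exists B2; split => // i.
by rewrite B2E gE; exact: (wP (inl (inl i))).
Qed.

End local_reflexivity.

(** * Classes of functions in L_p *)

Lemma ae_conj d (T : measurableType d) (R : realType) (mu : {measure set T -> \bar R})
    (P Q : T -> Prop) : (\forall x \ae mu, P x) -> (\forall x \ae mu, Q x) ->
  \forall x \ae mu, P x /\ Q x.
Proof. by move=> p q; apply: filterS2 p q. Qed.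

Section Lp_classes.
Context d (T : measurableType d) {R : realType} {s : scalars}.
Local Notation K := (scalar_field R s).
Variables (mu : probability T R) (p : \bar R) (p1 : (1 <= p)%E).
Local Open Scope quotient_scope.
Implicit Types (u v : Lp s mu p1) (f : T -> K).

Definition Lp_class f (Hf : f \in @Lfunction_pred _ T R s mu p) : Lp s mu p1 :=
  \pi_(Lp s mu p1) (MkLfct p1 Hf).

Lemma Lp_class_repr f Hf : \forall x \ae mu, repr (@Lp_class f Hf) x = f x.
Proof. exact: (Lp_reprP (MkLfct p1 Hf)). Qed.

Lemma Lp_ext u v : (\forall x \ae mu, repr u x = repr v x) -> u = v.
Proof. by move=> uv; rewrite -[u]reprK -[v]reprK; apply/Lp_eqP. Qed.

Lemma Lp_reprD u v : \forall x \ae mu, repr (u + v) x = repr u x + repr v x.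
Proof.
have -> : u + v = \pi_(Lp s mu p1) (repr u + repr v) by rewrite -Lp_add_pi !reprK.
exact: Lp_reprP.
Qed.

Lemma Lp_reprZ (a : K) u : \forall x \ae mu, repr (a *: u) x = a * repr u x.
Proof.
have -> : a *: u = \pi_(Lp s mu p1) (a *: repr u) by rewrite -Lp_scale_pi reprK.
exact: Lp_reprP.
Qed.

Lemma Lp_repr_sum I (r : seq I) (F : I -> Lp s mu p1) :
  \forall x \ae mu, repr (\sum_(i <- r) F i) x = \sum_(i <- r) repr (F i) x.
Proof.
elim: r => [|i r IH].
  have -> : \sum_(i <- [::]) F i = 0 *: 0 :> Lp s mu p1 by rewrite big_nil scale0r.
  by have := Lp_reprZ 0 0; apply: filterS => x ->; rewrite big_nil mul0r.
rewrite big_cons; have := Lp_reprD (F i) (\sum_(j <- r) F j).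
by apply: filterS2 IH => x IH ->; rewrite IH big_cons.
Qed.

Lemma Lp_nrmE u : ((nrm u)%:E = 'N[mu]_p[EFin \o (nrm \o repr u)])%E.
Proof. by rewrite -Lfct_normE /nrm [`|u|]/(ofR _) ofRK. Qed.

Lemma Lp_class_nrmE f Hf : ((nrm (@Lp_class f Hf))%:E = 'N[mu]_p[EFin \o (nrm \o f)])%E.
Proof.
rewrite Lp_nrmE; apply/eqP; rewrite eq_le; apply/andP; split; apply: ae_le_Lnorm => //;
  try (by apply: scalar_measurable_nrm; exact: Lfct_measurable);
  try (by move: Hf; rewrite inE => -[]/scalar_measurable_nrm);
  by have := Lp_class_repr Hf; apply: filterS => x /= ->; rewrite nrm_ge0 /=.
Qed.

Lemma Lnorm_cst_probability (M : R) : 0 <= M -> ('N[mu]_p[EFin \o cst M] = M%:E)%E.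
Proof.
case: p p1 => [r r1|_|//] M0; rewrite unlock /=.
- under eq_integral do rewrite ger0_norm//.
  rewrite integral_cst//= probability_setT mule1 poweR_EFin -powRrM divff ?powRr1//.
  by move: r1; rewrite lee_fin => /(lt_le_trans ltr01)/lt0r_neq0.
- have mu0 : (0 < mu [set: T])%E by rewrite probability_setT lte01.
  rewrite mu0 (ess_sup_ae_cst M%:E mu0)//.
  by apply: aeW => x /=; rewrite ger0_norm.
Qed.

Lemma Lnorm_le_bound f (M : R) : 0 <= M -> scalar_measurable f ->
  (\forall x \ae mu, nrm (f x) <= M) -> ('N[mu]_p[EFin \o (nrm \o f)] <= M%:E)%E.
Proof.
move=> M0 mf fM; rewrite -Lnorm_cst_probability//; apply: ae_le_Lnorm => //.
  exact: scalar_measurable_nrm.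
by apply: filterS fM => x /=; rewrite nrm_ge0.
Qed.

Lemma bounded_Lfunction f (M : R) : 0 <= M -> scalar_measurable f ->
  (\forall x \ae mu, nrm (f x) <= M) -> f \in @Lfunction_pred _ T R s mu p.
Proof.
move=> M0 mf fM; rewrite inE; split=> //.
exact: (le_lt_trans (Lnorm_le_bound M0 mf fM) (ltry _)).
Qed.

Lemma Lp_nrm_le_bound u (M : R) : 0 <= M ->
  (\forall x \ae mu, nrm (repr u x) <= M) -> nrm u <= M.
Proof.
move=> M0 uM; rewrite -lee_fin Lp_nrmE; apply: Lnorm_le_bound => //.
exact: Lfct_measurable.
Qed.

End Lp_classes.

Section canonical.
Context d (T : measurableType d) {R : realType} {s : scalars}.
Local Notation K := (scalar_field R s).
Variables (mu : probability T R).
Local Notation Linfty := (Lp s mu (leey 1)).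

Lemma Linfty_ae (u : Linfty) : \forall x \ae mu, nrm (repr u x) <= nrm u.
Proof.
have h : (ess_sup mu (abse \o (EFin \o (nrm \o repr u))) <= (nrm u)%:E)%E.
  have mu0 : (0 < mu [set: T])%E by rewrite probability_setT lte01.
  by rewrite Lp_nrmE Lnorm.unlock mu0.
move/ess_supP: h; apply: filterS => x /=.
by rewrite lee_fin ger0_norm ?nrm_ge0.
Qed.

Variables (p : \bar R) (p1 : (1 <= p)%E).

Lemma Linfty_to_Lp_repr (u : Linfty) :
  \forall x \ae mu, repr (Linfty_to_Lp p1 u) x = repr u x.
Proof. exact: (Lp_reprP (MkLfct p1 (Linfty_Lfct_subproof p1 (repr u)))). Qed.

Lemma Linfty_to_Lp_linear : linear (@Linfty_to_Lp _ T R s mu p p1).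
Proof.
move=> a u v; apply: Lp_ext.
have h1 := ae_conj (Linfty_to_Lp_repr (a *: u + v)) (ae_conj (Lp_reprD (a *: u) v) (Lp_reprZ a u)).
have h2 := ae_conj (Lp_reprD (a *: Linfty_to_Lp p1 u) (Linfty_to_Lp p1 v))
  (Lp_reprZ a (Linfty_to_Lp p1 u)).
have h3 := ae_conj (Linfty_to_Lp_repr u) (Linfty_to_Lp_repr v).
apply: filterS (ae_conj h1 (ae_conj h2 h3)) => x.
by move=> [[-> [-> ->]] [[-> ->] [-> ->]]].
Qed.

Lemma Linfty_to_Lp_le (u : Linfty) : nrm (Linfty_to_Lp p1 u) <= 1 * nrm u.
Proof.
rewrite mul1r; apply: Lp_nrm_le_bound; first exact: nrm_ge0.
by apply: filterS2 (Linfty_to_Lp_repr u) (Linfty_ae u) => x ->.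
Qed.

Definition canonical_bop : bop Linfty (Lp s mu p1) :=
  Bop (bounded_linearP Linfty_to_Lp_linear Linfty_to_Lp_le).

End canonical.

(** * Discretization of measurable functions *)

Section discretization.
Context d (T : measurableType d) {R : realType}.

Lemma measurable_nat_fun (q : T -> nat) :
  (forall n, measurable [set x | (q x <= n)%N]) -> measurable_fun setT q.
Proof.
move=> mq _ A _; rewrite setTI.
have -> : q @^-1` A = \bigcup_(n in A) ([set x | (q x <= n)%N] `\` [set x | (q x < n)%N]).
  apply/seteqP; split => [x Aqx|x [n An [/= qn /negP]]].
    by exists (q x) => //; split => /=; rewrite ?leqnn// ltnn.
  by rewrite -leqNgt => nq; rewrite (_ : q x = n)//; apply/eqP; rewrite eqn_leq qn.
apply: bigcup_measurable => n _; apply: measurableD; first exact: mq.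
case: n => [|n]; last exact: mq.
by rewrite (_ : [set _ | _] = set0)//; apply/seteqP; split.
Qed.

Lemma measurable_nat_op (f g : T -> nat) (op : nat -> nat -> nat) :
  measurable_fun setT f -> measurable_fun setT g ->
  measurable_fun setT (fun x => op (f x) (g x)).
Proof.
move=> mf mg _ A _; rewrite setTI.
have -> : (fun x => op (f x) (g x)) @^-1` A =
    \bigcup_i (f @^-1` [set i] `&` g @^-1` [set j | A (op i j)]).
  apply/seteqP; split => [x Ax|x [i _ [/= <- //]]].
  by exists (f x).
apply: bigcupT_measurable => i; apply: measurableI.
  by rewrite -[X in measurable X]setTI; exact: mf.
by rewrite -[X in measurable X]setTI; exact: mg.
Qed.

(** [h] is rounded down to the grid [- M + e Z], and the codes are cut off at [n],
    which changes nothing where [h] is at most [M] in absolute value. *)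
Lemma discretize1 (h : T -> R) (M e : R) : measurable_fun setT h -> 0 < e ->
  exists (q : T -> nat) (n : nat) (c : nat -> R),
    [/\ measurable_fun setT q, (forall x, (q x < n)%N) &
        forall x, `|h x| <= M -> `|h x - c (q x)| <= e].
Proof.
move=> mh e0; pose n := (Num.truncn ((M + M) / e)).
exists (fun x => minn (Num.truncn ((h x + M) / e)) n), n.+1, (fun k => - M + k%:R * e).
split => [|x|x]; last 2 first.
- by rewrite ltnS geq_minr.
- rewrite ler_norml => /andP[xr rx].
  set k := Num.truncn _; have kn : (k <= n)%N.
    by apply: le_truncn; rewrite ler_pM2r ?invr_gt0//; lra.
  have /truncn_itv /andP[k1 k2] : 0 <= (h x + M) / e by rewrite divr_ge0 ?(ltW e0)//; lra.
  rewrite (minn_idPl kn).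
  move: k1 k2; rewrite -/k ler_pdivlMr// ltr_pdivrMr// -natr1 mulrDl mul1r => k1 k2.
  by rewrite ler_norml; lra.
apply: (@measurable_nat_op _ (cst n) (fun a b => minn a b)); last exact: measurable_cst.
apply: measurable_nat_fun => k.
have -> : [set x | (Num.truncn ((h x + M) / e) <= k)%N] = h @^-1` [set y | y < k.+1%:R * e - M].
  apply/seteqP; split => x /=; rewrite truncn_le_nat ltr_pdivrMr//; lra.
rewrite -[X in measurable X]setTI; apply: mh => //.
have -> : [set y | y < k.+1%:R * e - M] = `]-oo, (k.+1%:R * e - M)[%classic.
  by apply/seteqP; split => y /=; rewrite in_itv.
exact: measurable_itv.
Qed.

(** The codes of several functions are combined as the digits of one number. *)
Lemma discretize (N : nat) (h : nat -> T -> R) (M e : R) :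
  (forall i, measurable_fun setT (h i)) -> 0 < e ->
  exists (q : T -> nat) (n : nat) (c : nat -> nat -> R),
    [/\ measurable_fun setT q, (forall x, (q x < n)%N) &
        forall i x, (i < N)%N -> `|h i x| <= M -> `|h i x - c i (q x)| <= e].
Proof.
move=> mh e0; elim: N => [|N [q [n [c [mq qn qc]]]]].
  by exists (cst 0%N), 1%N, (fun _ _ => 0); split => //; exact: measurable_cst.
have [q' [n' [c' [mq' qn' qc']]]] := discretize1 M (mh N) e0.
exists (fun x => q x * n' + q' x)%N, (n * n')%N,
  (fun i k => if (i < N)%N then c i (k %/ n')%N else c' (k %% n')%N).
have n'0 (x : T) : (0 < n')%N by rewrite (leq_ltn_trans _ (qn' x)).
split => [|x|i x iN hM].
- exact: (@measurable_nat_op q q' (fun a b => a * n' + b)%N).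
- rewrite (@leq_trans ((q x).+1 * n')%N)// ?leq_mul2r ?qn ?orbT//.
  by rewrite mulSn addnC ltn_add2r.
- rewrite divnMDl ?(n'0 x)// divn_small// addn0 modnMDl modn_small//.
  case: ltnP => [iN'|Ni]; first exact: qc.
  have -> : i = N by apply/eqP; rewrite eqn_leq Ni andbT -ltnS.
  apply: qc'; rewrite -(_ : i = N)//.
  by apply/eqP; rewrite eqn_leq Ni andbT -ltnS.
Qed.

End discretization.

Section nat_probability.
Context {R : realType} {s : scalars}.
Local Notation K := (scalar_field R s).
Variable nu : probability nat R.

Lemma measurable_from_nat d' (T' : measurableType d') (f : nat -> T') : measurable_fun setT f.
Proof. by move=> _ A _; rewrite setTI. Qed.

Lemma scalar_measurable_nat (f : nat -> K) : scalar_measurable f.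
Proof. by split; exact: measurable_from_nat. Qed.

Lemma ae_natP (P : nat -> Prop) :
  (\forall k \ae nu, P k) <-> (forall k, nu [set k] != 0%E -> P k).
Proof.
split => [[N [_ N0 PN]] k nuk|Pnu].
  apply: contrapT => Pk; move/negP : nuk; apply.
  rewrite -measure_le0 -N0; apply: le_measure; rewrite ?inE//.
  by move=> _ ->; exact: PN.
apply: (@negligibleS _ _ _ nu (\bigcup_k (if nu [set k] == 0%E then [set k] else set0))).
  move=> k /= Pk; exists k => //; case: ifPn => // h; exfalso; exact/Pk/Pnu.
apply: negligible_bigcup => k; case: ifPn => [/eqP h|_]; last exact: negligible_set0.
by exists [set k]; split.
Qed.

End nat_probability.

(** * L_p of a probability on the natural numbers *)

Section atoms.
Context {R : realType} {s : scalars}.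
Local Notation K := (scalar_field R s).
Variables (nu : probability nat R) (p : \bar R) (p1 : (1 <= p)%E).
Local Notation L := (Lp s nu p1).

Lemma indicator_Lfunction j :
  (fun k : nat => (k == j)%:R : K) \in @Lfunction_pred _ nat R s nu p.
Proof.
apply: (@bounded_Lfunction _ _ _ _ _ _ p1 _ 1) => //.
by apply: aeW => k; case: (k == j); rewrite ?nrm1 ?nrm0.
Qed.

Definition atom j : L := Lp_class p1 (indicator_Lfunction j).

Lemma nrm_atom_gt0 j : nu [set j] != 0%E -> 0 < nrm (atom j).
Proof.
move=> nuj; apply: nrm_gt0; apply/eqP => a0.
have h0 := Lp_reprZ 0 (0 : L); rewrite scale0r in h0.
have := ae_conj h0 (Lp_class_repr p1 (indicator_Lfunction j)); rewrite -/(atom j) a0.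
move=> /ae_natP/(_ j nuj)[-> /eqP]; rewrite mul0r eqxx eq_sym.
by rewrite oner_eq0.
Qed.

Lemma ler_repr_atom (u : L) j : nu [set j] != 0%E ->
  nrm (repr u j) <= (nrm (atom j))^-1 * nrm u.
Proof.
move=> nuj; rewrite ler_pdivlMl ?nrm_atom_gt0// mulrC -nrmZ -lee_fin !Lp_nrmE.
apply: ae_le_Lnorm => //; try (by apply: scalar_measurable_nrm; exact: Lfct_measurable).
have h := Lp_reprZ (repr u j) (atom j).
have := ae_conj h (Lp_class_repr p1 (indicator_Lfunction j)); apply: filterS => k /= [-> ->].
rewrite nrm_ge0/=; case: eqP => [->|_]; first by rewrite mulr1.
by rewrite mulr0 nrm0 nrm_ge0.
Qed.

(** The coefficient is set to 0 at a null point, where the value of a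
    representative is not determined by the class; this makes the coefficients
    linear functions of [u]. *)
Lemma sum_atoms n (u : L) : (forall k, nu [set k] != 0%E -> (k < n)%N) ->
  u = \sum_(j < n) (if nu [set (j : nat)] == 0%E then 0 else repr u j) *: atom j.
Proof.
move=> nun; apply: Lp_ext; apply/ae_natP => k nuk.
have H1 := Lp_repr_sum (index_enum 'I_n)
  (fun j : 'I_n => (if nu [set (j : nat)] == 0%E then 0 else repr u j) *: atom j).
have H2 : \forall k \ae nu, forall j : 'I_n,
    repr ((if nu [set (j : nat)] == 0%E then 0 else repr u j) *: atom j) k =
    (if nu [set (j : nat)] == 0%E then 0 else repr u j) * (k == j)%:R.
  apply/ae_natP => i nui j.
  have h := Lp_reprZ (if nu [set (j : nat)] == 0%E then 0 else repr u j) (atom j).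
  have := ae_conj h (Lp_class_repr p1 (indicator_Lfunction j)).
  by move=> /ae_natP/(_ i nui)[-> ->].
move/ae_natP: H1 => /(_ k nuk) ->; move/ae_natP: H2 => /(_ k nuk) H2.
under eq_bigr do rewrite H2.
rewrite (bigD1 (Ordinal (nun k nuk)))//= eqxx mulr1 (negbTE nuk) big1 ?addr0// => j jk.
by rewrite (_ : (k == j) = false) ?mulr0//; apply: contraNF jk => /eqP kj; apply/eqP/val_inj.
Qed.

End atoms.

Section composition_operator.
Context d (T : measurableType d) {R : realType} {s : scalars}.
Local Notation K := (scalar_field R s).
Variables (mu : probability T R) (p : R) (p1 : (1 <= p%:E)%E) (q : {mfun T >-> nat}).
Local Notation nu := (distribution mu q).

Lemma Lnorm_distribution (f : nat -> R) :
  ('N[nu]_p%:E[EFin \o f] = 'N[mu]_p%:E[EFin \o (f \o q)])%E.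
Proof.
rewrite Lnorm.unlock; congr (_ `^ _)%E.
rewrite ge0_integral_distribution// => k; exact: poweR_ge0.
Qed.

Lemma ae_distribution (P : nat -> Prop) :
  (\forall k \ae nu, P k) -> \forall x \ae mu, P (q x).
Proof.
move=> [N [mN N0 PN]]; exists (q @^-1` N); split => //.
  by rewrite -[X in measurable X]setTI; apply: measurable_funP.
by move=> x /= Px; apply: PN.
Qed.

Lemma pullback_Lfunction (f : nat -> K) : f \in @Lfunction_pred _ nat R s nu p%:E ->
  f \o q \in @Lfunction_pred _ T R s mu p%:E.
Proof.
rewrite !inE => -[_ ff]; split.
  by split; apply: (@measurableT_comp _ _ _ _ _ _ (_ \o f)) => //; exact: measurable_from_nat.
by rewrite /finite_norm -[nrm \o _]/((nrm \o f) \o q) -Lnorm_distribution.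
Qed.

(** Composition with [q] carries [L_p] of the law of [q] isometrically
    into [L_p mu]: it identifies functions on the code set with functions that are
    constant on the cells of [q]. *)
Definition pullback_Lp (u : Lp s nu p1) : Lp s mu p1 :=
  Lp_class p1 (pullback_Lfunction (Lfct_valP (repr u))).

Lemma pullback_Lp_repr u : \forall x \ae mu, repr (pullback_Lp u) x = repr u (q x).
Proof. exact: Lp_class_repr. Qed.

Lemma pullback_Lp_linear : linear pullback_Lp.
Proof.
move=> a u v; apply: Lp_ext.
have h1 := ae_conj (pullback_Lp_repr (a *: u + v)) (ae_conj (pullback_Lp_repr u) (pullback_Lp_repr v)).
have h2 := ae_conj (Lp_reprD (a *: pullback_Lp u) (pullback_Lp v)) (Lp_reprZ a (pullback_Lp u)).
have h3 := ae_distribution (ae_conj (Lp_reprD (a *: u) v) (Lp_reprZ a u)).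
apply: filterS (ae_conj h1 (ae_conj h2 h3)) => x.
by move=> [[-> [hu hv]] [[-> ->] [-> ->]]]; rewrite hu hv.
Qed.

Lemma pullback_Lp_le u : nrm (pullback_Lp u) <= 1 * nrm u.
Proof. by rewrite mul1r -lee_fin Lp_class_nrmE Lp_nrmE Lnorm_distribution. Qed.

Definition pullback_bop : bop (Lp s nu p1) (Lp s mu p1) :=
  Bop (bounded_linearP pullback_Lp_linear pullback_Lp_le).

End composition_operator.

(** * Functionals carried by a cell *)

Section local_functionals.
Context d (T : measurableType d) {R : realType} {s : scalars}.
Local Notation K := (scalar_field R s).
Variables (mu : probability T R) (q : {mfun T >-> nat}).
Local Notation Linfty := (Lp s mu (leey 1)).

Lemma scalar_eq1 (z : K) : nrm z <= 1 -> 1 <= re z -> z = 1.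
Proof.
move=> z1 rz; have h : re z ^+ 2 + im z ^+ 2 <= 1.
  rewrite -[leLHS]sqr_sqrtr ?addr_ge0 ?sqr_ge0// -re_normE expr_le1 ?nrm_ge0//.
have r0 := sqr_ge0 (im z); have r1 : re z = 1.
  by apply/eqP; rewrite eq_le rz andbT (le_trans (ler_norm _))// (le_trans (ler_re_nrm z)).
have : im z ^+ 2 == 0 by rewrite r1 expr1n in h; rewrite eq_le r0 andbT; lra.
rewrite sqrf_eq0; move: z r1 {z1 rz h r0}; case: s => [z /= -> //|[a b] /= -> /eqP ->].
by [].
Qed.

(** A stand-in for the mean over the cell [q = j]: a functional of norm 1 for the
    essential supremum over the cell that takes the value 1 at the constant 1.
    The latter property makes it stay within [M] of [c] when [u] does on the
    cell. On a null cell the essential supremum vanishes, and so does [a]. *)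
Lemma cell_functional j : exists a : Linfty -> K^o, [/\ linear a,
  (forall (u : Linfty) M, 0 <= M -> (\forall x \ae mu, q x = j -> nrm (repr u x) <= M) ->
     nrm (a u : K) <= M) &
  distribution mu q [set j] != 0%E -> forall (u : Linfty) c M, 0 <= M ->
     (\forall x \ae mu, q x = j -> nrm (repr u x - c) <= M) -> nrm (a u - c : K) <= M].
Proof.
pose S (u : Linfty) M := 0 <= M /\ \forall x \ae mu, q x = j -> nrm (repr u x) <= M.
have gS : seminorm_rel S.
  split => [u M []//|u|u v M N [M0 hM] [N0 hN]|a u M [M0 hM]].
  - exists (nrm u); split; first exact: nrm_ge0.
    by apply: filterS (Linfty_ae u) => x + _.
  - split; first by rewrite addr_ge0.
    apply: filterS (ae_conj (Lp_reprD u v) (ae_conj hM hN)) => x [-> [h1 h2]] qj.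
    by rewrite (le_trans (ler_nrmD _ _))// lerD ?h1 ?h2.
  - split; first by rewrite mulr_ge0 ?nrm_ge0.
    apply: filterS (ae_conj (Lp_reprZ a u) hM) => x [-> h] qj.
    by rewrite nrmM ler_wpM2l ?nrm_ge0 ?h.
have one_ae : \forall x \ae mu, nrm ((fun=> 1 : K) x) <= 1 by apply: aeW => x; rewrite nrm1.
have one_meas : @scalar_measurable _ T R s (fun=> 1).
  by split; exact: measurable_cst.
pose one : Linfty := Lp_class (leey 1) (bounded_Lfunction (leey 1) ler01 one_meas one_ae).
have one_repr : \forall x \ae mu, repr one x = 1 := Lp_class_repr _ _.
have [nuj|nuj] := boolP (distribution mu q [set j] == 0%E).
  exists (fun=> 0); split => [a u v|u M M0 _|/negP h]; first by rewrite scaler0 addr0.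
    by rewrite nrm0.
  by exfalso; exact: h.
have S1 M : S one M -> 1 <= M.
  move=> [M0 hM]; rewrite leNgt; apply/negP => M1.
  have [N [mN N0 h]] : \forall x \ae mu, q x <> j.
    apply: filterS (ae_conj one_repr hM) => x [-> h] /h.
    by rewrite nrm1 leNgt M1.
  move/negP: nuj; apply.
  rewrite -measure_le0 -N0 -[leLHS]/(mu (q @^-1` [set j])); apply: le_measure; rewrite ?inE//.
    by rewrite -[X in measurable X]setTI; apply: measurable_funP.
  by move=> x /= qx; apply: h => /=; apply: contrapT => nq; apply: nq => nq; exact: nq.
have [a la [aS a1]] := seminorm_hahn_banach gS S1.
pose A : {linear Linfty -> K^o} := HB.pack a (GRing.isLinear.Build K Linfty K^o *:%R a la).
have a1E : a one = 1.
  have aone : nrm (a one : K) <= 1.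
    by apply: aS; split => //; apply: filterS one_repr => x -> _; rewrite nrm1.
  exact: scalar_eq1.
exists a; split => //.
  by move=> u M M0 h; apply: aS.
move=> _ u c M M0 h.
have -> : (a u - c : K) = A (u - c *: one).
  by rewrite linearB linearZ /= a1E; congr (_ - _); rewrite -[RHS]/(c * 1) mulr1.
apply: aS; split => //.
have h1 := Lp_reprD u (- c *: one); have h2 := Lp_reprZ (- c) one.
rewrite -scaleNr; apply: filterS (ae_conj h (ae_conj h1 (ae_conj h2 one_repr))) => x [hx [-> [-> ->]]] /hx.
by rewrite mulr1.
Qed.

End local_functionals.

(** * Local approximation of p-integral operators *)

Section integral_local_approximation.
Context {R : realType} {s : scalars}.
Local Notation K := (scalar_field R s).
Variables (p : R) (p1 : (1 <= p%:E)%E).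

Lemma p_integral_norm_le (X Y : normedModType K) (S : bop X Y)
    d (T : measurableType d) (mu : probability T R)
    (A : bop X (Lp s mu (leey 1))) (B : bop (Lp s mu p1) (dual (dual Y))) :
  integral_factorization S A B -> (p_integral_norm p1 S <= (nrm A * nrm B)%:E)%E.
Proof. by move=> h; apply: ereal_inf_lbound; exists d, T, mu, A, B. Qed.

(** Partition the measure space into the cells of [q], on which the functions
    [A (x i)] are nearly constant. The cell functionals turn [A] into a map [A1] to
    [L_oo nu], where [nu] is the law of [q]; on the points [x i], inclusion into
    [L_p nu] followed by composition with [q] nearly gives back [A]. Since [nu] has
    finitely many atoms, [L_p nu] has finite dimension and local reflexivity
    replaces [B] composed with the pull-back by a map into [Y]. *)
Lemma integral_local_approximation (X Y : normedModType K) (S : bop X Y)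
    d (T : measurableType d) (mu : probability T R)
    (A : bop X (Lp s mu (leey 1))) (B : bop (Lp s mu p1) (dual (dual Y)))
    (N : nat) (x : 'I_N -> X) (eps del : R) :
  integral_factorization S A B -> 0 < eps -> 0 < del ->
  exists S' : bop X Y, [/\ finite_rank S', (forall i, nrm (S' (x i) - S (x i)) < eps) &
    (p_integral_norm p1 S' <= (nrm A * (nrm B + del))%:E)%E].
Proof.
move=> SAB eps0 del0.
(* The values of A (x i) are known up to 2 e, and B stretches this by nrm B. *)
pose e := eps / (4 * (nrm B + 1)).
have nB0 : 0 <= nrm B := nrm_ge0 B.
have e0 : 0 < e by rewrite divr_gt0// mulr_gt0//; lra.
have e20 : 0 < e / 2 by lra.
pose M := \sum_i nrm (A (x i)).
(* Numbers 2 i and 2 i + 1 are the real and imaginary parts of A (x i). *)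
pose h (i : nat) (w : T) : R := if insub i./2 is Some k then
  (if odd i then im (repr (A (x k)) w) else re (repr (A (x k)) w)) else 0.
have mh i : measurable_fun setT (h i).
  rewrite /h; case: insubP => [k _ _|_]; last exact: measurable_cst.
  by case: (Lfct_measurable (repr (A (x k)))); case: (odd i).
have [q0 [n [c [mq qn qc]]]] := discretize N.*2 M mh e20.
pose q : {mfun T >-> nat} := HB.pack q0 (isMeasurableFun.Build _ _ _ _ q0 mq).
pose nu : probability nat R := distribution mu q.
have nun k : nu [set k] != 0%E -> (k < n)%N.
  move=> nuk; rewrite ltnNge; apply/negP => nk; move/negP: nuk; apply.
  rewrite -[X in X == _]/(mu (q0 @^-1` [set k])) (_ : _ @^-1` _ = set0) ?measure0//.
  by apply/seteqP; split => // w /= qw; have := qn w; rewrite qw ltnNge nk.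
have [mk mkP] := @scalar_of_reim R s.
pose cc (i : 'I_N) (k : nat) : K := mk (c (val i).*2 k) (c (val i).*2.+1 k).
have AM (i : 'I_N) : nrm (A (x i)) <= M.
  by rewrite /M (bigD1 i)//= lerDl sumr_ge0// => j _; exact: nrm_ge0.
have ccP (i : 'I_N) : \forall w \ae mu, nrm (repr (A (x i)) w - cc i (q w)) <= e.
  apply: filterS (Linfty_ae (A (x i))) => w hw.
  have hM := le_trans hw (AM i).
  have insE : insub (val i) = Some i :> option 'I_N by exact: valK.
  have h0 : h (val i).*2 w = re (repr (A (x i)) w) by rewrite /h doubleK insE odd_double.
  have h1 : h (val i).*2.+1 w = im (repr (A (x i)) w).
    by rewrite /h /= uphalf_double insE odd_double.
  have c0 : `|h (val i).*2 w - c (val i).*2 (q w)| <= e / 2.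
    apply: qc; first by rewrite ltn_double ltn_ord.
    by rewrite h0 (le_trans (ler_re_nrm _)).
  have c1 : `|h (val i).*2.+1 w - c (val i).*2.+1 (q w)| <= e / 2.
    apply: qc; first by rewrite ltn_Sdouble ltn_ord.
    by rewrite h1 (le_trans (ler_im_nrm _)).
  by rewrite (le_trans (mkP _ _ _))//; rewrite h0 in c0; rewrite h1 in c1; lra.
have /choice[a aP] := cell_functional (s := s) mu q.
pose A1f (y : X) (k : nat) : K := a k (A y).
have A1b y k : nrm (A1f y k) <= nrm (A y).
  have [_ ab _] := aP k; apply: ab; first exact: nrm_ge0.
  by apply: filterS (Linfty_ae (A y)) => w ? _.
have A1L y : A1f y \in @Lfunction_pred _ nat R s nu +oo%E.
  apply: (bounded_Lfunction (leey 1) (nrm_ge0 (A y)) (scalar_measurable_nat _)).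
  by apply: aeW => k; exact: A1b.
pose A1 (y : X) : Lp s nu (leey 1) := Lp_class (leey 1) (A1L y).
have A1E y : \forall k \ae nu, repr (A1 y) k = A1f y k := Lp_class_repr _ _.
have A1l : linear A1.
  move=> b y z; apply: Lp_ext.
  have h1 := ae_conj (A1E (b *: y + z)) (ae_conj (A1E y) (A1E z)).
  apply: filterS (ae_conj h1 (ae_conj (Lp_reprD (b *: A1 y) (A1 z)) (Lp_reprZ b (A1 y)))) => k.
  move=> [[-> [hy hz]] [-> ->]]; rewrite hy hz /A1f.
  by have [al _ _] := aP k; rewrite linearP; exact: al.
have A1le y : nrm (A1 y) <= nrm A * nrm y.
  rewrite (le_trans _ (ler_bop A y))//; apply: Lp_nrm_le_bound; first exact: nrm_ge0.
  by apply: filterS (A1E y) => k ->; exact: A1b.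
have [A1' [A1'E A1'b]] := bop_exists (nrm_ge0 A) A1l A1le.
pose ip := @canonical_bop _ nat R s nu p%:E p1.
pose z (i : 'I_N) : Lp s nu p1 := ip (A1' (x i)).
pose B1 := bop_comp B (pullback_bop mu p1 q).
have B1z i : nrm (B1 (z i) - bidual_embedding (S (x i))) < eps.
  rewrite SAB -[Linfty_to_Lp _ _]/(@canonical_bop _ T R s mu p%:E p1 (A (x i))).
  rewrite -[B1 (z i)]/(B (pullback_bop mu p1 q (z i))) -linearB (le_lt_trans (ler_bop _ _))//.
  have hC : nrm (pullback_bop mu p1 q (z i) - canonical_bop mu p1 (A (x i))) <= e + e.
    apply: Lp_nrm_le_bound; first lra.
    set u := pullback_bop mu p1 q (z i); set v := canonical_bop mu p1 (A (x i)).
    have h1 := ae_conj (Lp_reprD u (- v)) (Lp_reprZ (-1) v); rewrite scaleN1r in h1.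
    have h2 : \forall k \ae nu, nrm (repr (z i) k - cc i k) <= e.
      apply/ae_natP => k nuk.
      have h3 : \forall k \ae nu, repr (z i) k = A1f (x i) k.
        rewrite /z A1'E.
        by apply: filterS2 (Linfty_to_Lp_repr p1 (A1 (x i))) (A1E (x i)) => j ->.
      move/ae_natP: h3 => /(_ k nuk) ->; have [_ _ aq] := aP k; apply: aq => //; first exact: ltW.
      by apply: filterS (ccP i) => w + <-.
    have h4 := ae_conj (@pullback_Lp_repr _ T R s mu p p1 q (z i)) (ae_distribution h2).
    have h5 := ae_conj (Linfty_to_Lp_repr p1 (A (x i))) (ccP i).
    apply: filterS (ae_conj h1 (ae_conj h4 h5)) => w [[-> ->] [[-> k1] [-> k2]]].
    rewrite mulN1r (_ : _ - _ = (repr (z i) (q w) - cc i (q w)) - (repr (A (x i)) w - cc i (q w))); last first.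
      by rewrite opprB addrA subrK.
    by rewrite (le_trans (ler_nrmD _ _))// nrmN lerD.
  rewrite (le_lt_trans (ler_wpM2l nB0 hC))//.
  rewrite /e; set b := nrm B in nB0 *.
  have : b * (eps / (4 * (b + 1)) + eps / (4 * (b + 1))) = eps * (b / (b + 1)) / 2.
    by field; rewrite ?gt_eqF//; lra.
  have b1 : b / (b + 1) <= 1 by rewrite ler_pdivrMr; lra.
  have := ler_wpM2l (ltW eps0) b1; lra.
pose cf (j : 'I_n) (u : Lp s nu p1) : K^o := if nu [set (j : nat)] == 0%E then 0 else repr u j.
have cfL j : linear (cf j).
  move=> b u v; rewrite /cf; case: ifPn => nuj; first by rewrite scaler0 addr0.
  have := ae_conj (Lp_reprD (b *: u) v) (Lp_reprZ b u).
  by move=> /ae_natP/(_ (j : nat) nuj)[-> ->].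
pose C := \sum_(j < n) (nrm (atom (s := s) nu p1 j))^-1.
have C0 : 0 <= C by apply: sumr_ge0 => j _; rewrite invr_ge0 nrm_ge0.
have cfC j u : nrm (cf j u : K) <= C * nrm u.
  rewrite /cf; case: ifPn => nuj; first by rewrite nrm0 mulr_ge0 ?nrm_ge0.
  rewrite (le_trans (ler_repr_atom u nuj))// ler_wpM2r ?nrm_ge0//.
  by rewrite /C (bigD1 j)//= lerDl sumr_ge0// => i _; rewrite invr_ge0 nrm_ge0.
have cfE u : u = \sum_j (cf j u : K) *: atom nu p1 j by exact: sum_atoms.
have [B2 [B2b B2z B2E]] := local_reflexivity C0 cfL cfC cfE eps0 del0 B1z.
exists (bop_comp B2 (bop_comp ip A1')); split.
- exists n, (fun j : 'I_n => B2 (atom nu p1 j)) => y.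
  by exists (fun j => cf j (ip (A1' y))); exact: B2E.
- by move=> i; exact: B2z.
- have := @p_integral_norm_le X Y (bop_comp B2 (bop_comp ip A1')) _ _ nu A1' (bop_comp (bidual_bop Y) B2).
  move=> /(_ (fun=> erefl)) /le_trans; apply; rewrite lee_fin ler_pM ?nrm_ge0//.
  rewrite (le_trans (nrm_comp _ _))// (@le_trans _ _ (1 * nrm B2))//.
    by rewrite ler_wpM2r ?nrm_ge0// nrm_bidual_bop.
  rewrite mul1r (le_trans B2b)// lerD2r (le_trans (nrm_comp _ _))// ler_piMr//.
  by rewrite nrm_bopE; apply: opnorm_le => // u; exact: pullback_Lp_le.
Qed.

End integral_local_approximation.

(** * The local metric approximation properties *)

Lemma addr1_gt0 (R : realDomainType) (x : R) : 0 <= x -> 0 < x + 1.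
Proof. by move=> x0; rewrite ltr_wpDl. Qed.

Section local_MAP_everywhere.
Context {R : realType} {s : scalars}.
Local Notation K := (scalar_field R s).

Lemma ex_invS_le (e : R) : 0 < e -> exists m : nat, m.+1%:R^-1 <= e.
Proof.
move=> e0; exists (Num.truncn e^-1); rewrite invf_ple ?posrE// ltW//.
exact: truncnS_gt.
Qed.

Lemma ltr_ofR (a b : R) : (ofR a < ofR b :> K) = (a < b).
Proof. by rewrite !lt_neqAle ler_ofR (can_eq (@ofRK R s)). Qed.

Lemma cvg_nrm (V : normedModType K) (I : Type) (le : I -> I -> Prop) (u : I -> V) (l : V) :
  (forall e : R, 0 < e -> exists i, forall j, le i j -> nrm (u j - l) < e) ->
  u a @[a --> tails le] --> l.
Proof.
move=> h A /nbhs_ballP[e /= e0 eA].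
have re0 : 0 < re e by rewrite -ltr_ofR ofR0 ofR_re// ltW.
have [i hi] := h _ re0; exists i => j ij; apply: eA.
rewrite -ball_normE /ball_ /= nrmE nrm_distC -(ofR_re (ltW e0)) ltr_ofR.
exact: hi.
Qed.

(** The net is indexed by a finite list of points and a precision. *)
Lemma local_MAP_of_local (A : operator_ideal R s) (X : completeNormedModType K) :
  (forall (Y : completeNormedModType K) (T : bop X Y), in_ideal A T ->
     forall (N : nat) (x : 'I_N -> X) (eps : R), 0 < eps ->
     exists S : bop X Y, [/\ finite_rank S, (forall i, nrm (S (x i) - T (x i)) < eps) &
       (ideal_norm A S <= ideal_norm A T + eps%:E)%E]) ->
  local_MAP A X.
Proof.
move=> H Y T AT.
have /choice[S SP] : forall a : seq X * nat, exists S : bop X Y, [/\ finite_rank S,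
    (forall x, x \in a.1 -> nrm (S x - T x) < a.2.+1%:R^-1) &
    (ideal_norm A S <= ideal_norm A T + (a.2.+1%:R^-1)%:E)%E].
  move=> [F m]; have m0 : 0 < m.+1%:R^-1 :> R by rewrite invr_gt0.
  have [S [Sf Sx SN]] := H Y T AT (size F) (fun i => nth 0 F i) _ m0.
  exists S; split => // x xF; have xF' : (index x F < size F)%N by rewrite index_mem.
  have := Sx (Ordinal xF').
  by rewrite /= nth_index.
exists (seq X * nat)%type, (fun a b => {subset a.1 <= b.1} /\ (a.2 <= b.2)%N), S; split.
- split.
  + by exists ([::], 0%N).
  + by move=> a; split.
  + move=> a b c [ab1 ab2] [bc1 bc2]; split; last exact: leq_trans bc2.
    by move=> x /ab1/bc1.
  + move=> a b; exists (a.1 ++ b.1, maxn a.2 b.2); split; rewrite ?leq_maxl ?leq_maxr//=.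
      by move=> x xa; rewrite mem_cat xa.
    by move=> x xb; rewrite mem_cat xb orbT.
- by move=> a; case: (SP a).
- move=> x; apply: cvg_nrm => e e0.
  have [m me] := ex_invS_le e0.
  exists ([:: x], m) => -[F k] /= [xF mk]; have [_ h _] := SP (F, k).
  rewrite (lt_le_trans (h x _))//; first by apply: xF; rewrite inE.
  by rewrite (le_trans _ me)// lef_pV2 ?posrE// ler_nat ltnS.
- apply/lee_addgt0Pr => e e0.
  have [m me] := ex_invS_le e0.
  apply: le_trans; first by apply: ereal_inf_lbound; exists ([::], m).
  apply: ge_ereal_sup => _ [[F k] /= [_ mk] <-]; have [_ _ h] := SP (F, k).
  rewrite (le_trans h)// leeD2l// lee_fin (le_trans _ me)//=.
  by rewrite lef_pV2 ?posrE// ler_nat ltnS.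
Qed.

(** A factorization that nearly attains the norm is approximated at finitely
    many points; [del] is small enough for the increase of [nrm B] to cost at most
    [eps / 2] in the product with [nrm A]. *)
Theorem local_MAP_p_integral (p : R) (p1 : (1 <= p%:E)%E) (X : completeNormedModType K) :
  local_MAP (p_integral_ideal s p1) X.
Proof.
apply: local_MAP_of_local => Y T [d [Om [mu [A0 [B0 AB0]]]]] N x eps eps0 /=.
have e20 : 0 < eps / 2 by lra.
have Nfin : p_integral_norm p1 T \is a fin_num.
  rewrite ge0_fin_numE; first exact: (le_lt_trans (p_integral_norm_le AB0) (ltry _)).
  apply: le_ereal_inf_tmp => _ [d' [Om' [mu' [A' [B' [_ ->]]]]]].
  by rewrite lee_fin mulr_ge0 ?nrm_ge0.
have [_ [d' [Om' [mu' [A [B [AB ->]]]]]] hAB] := lb_ereal_inf_adherent e20 Nfin.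
pose del := eps / 2 / (nrm A + 1).
have nA1 : 0 < nrm A + 1 by rewrite addr1_gt0 ?nrm_ge0.
have del0 : 0 < del by rewrite divr_gt0.
have [S [Sf Sx SN]] := integral_local_approximation x AB eps0 del0.
exists S; split => //; apply: (le_trans SN).
rewrite mulrDr EFinD [X in (_ <= _ + X%:E)%E]splitr EFinD addeA leeD//; first exact: ltW.
by rewrite lee_fin /del mulrA ler_pdivrMr// mulrC ler_wpM2l ?(ltW e20)// lerDl.
Qed.

Lemma lp_norm_le (q : \bar R) (u v : nat -> R) : (1 <= q)%E ->
  (forall n, 0 <= u n <= v n) -> (lp_norm q u <= lp_norm q v)%E.
Proof.
move=> q1 uv; apply: ae_le_Lnorm => //.
by apply: aeW => n; exact: uv.
Qed.

Lemma lp_norm_ge0 (q : \bar R) (u : nat -> R) : (0 <= lp_norm q u)%E.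
Proof. exact: Lnorm_ge0. Qed.

Lemma weak_lp_norm_ge0 (Y : normedModType K) q (y : nat -> Y) : (0 <= weak_lp_norm q y)%E.
Proof.
apply: (le_trans (lp_norm_ge0 q (fun n => nrm ((0 : dual Y) (y n) : K)))).
by apply: ereal_sup_ubound; exists 0 => //=; rewrite nrm0.
Qed.

Lemma rank_one0 (X Y : normedModType K) (y : Y) : rank_one (0 : dual X) y = 0.
Proof. by apply/val_inj/funext => x /=; rewrite scale0r. Qed.

Lemma bop_series (X Y : normedModType K) (u : nat -> bop X Y) m x :
  series u m x = \sum_(0 <= n < m) u n x.
Proof. exact: bopE_sum. Qed.

(** Truncating a representation does not increase its norm, and its partial
    sums converge in operator norm. If the nuclear norm were infinite, any
    representation would do. *)
Theorem local_MAP_p_nuclear (p : R) (p1 : (1 <= p%:E)%E) (X : completeNormedModType K) :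
  local_MAP (p_nuclear_ideal s p) X.
Proof.
apply: local_MAP_of_local => Y T AT N x eps eps0 /=.
have [f [y [[flp yw fyT] fyN]]] : exists f y, nuclear_representation p T f y /\
    (lp_norm p%:E (fun n => nrm (f n)) * weak_lp_norm (hoelder_conjugate p%:E) y <=
     p_nuclear_norm p T + eps%:E)%E.
  have N0 : (0 <= p_nuclear_norm p T)%E.
    apply: le_ereal_inf_tmp => _ [f [y [_ ->]]].
    by rewrite mule_ge0 ?lp_norm_ge0 ?weak_lp_norm_ge0.
  have [Nfin|] := boolP (p_nuclear_norm p T \is a fin_num); last first.
    rewrite ge0_fin_numE// -leNgt leye_eq => /eqP ->.
    by have [f [y fy]] := AT; exists f, y; split => //; rewrite addye// leey.
  have [_ [f [y [fy ->]]] h] := lb_ereal_inf_adherent eps0 Nfin.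
  by exists f, y; split => //; exact: ltW.
pose M := \sum_i nrm (x i) + 1.
have M0 : 0 < M.
  have : 0 <= \sum_i nrm (x i) by apply: sumr_ge0 => i _; exact: nrm_ge0.
  by rewrite /M; lra.
have [m hm] : exists m, nrm (T - series (fun n => rank_one (f n) (y n)) m) < eps / M.
  have eM : 0 < ofR (eps / M) :> K by rewrite -(@ofR0 R s) ltr_ofR divr_gt0.
  have /cvgrPdist_lt/(_ _ eM)[m _ h] := fyT.
  by exists m; have := h m (leqnn m); rewrite nrmE ltr_ofR.
set S := series _ m in hm; pose f' n := if (n < m)%N then f n else 0.
have S'E k : (m <= k)%N -> series (fun n => rank_one (f' n) (y n)) k = S.
  move=> mk; have tail0 : \sum_(m <= n < k) rank_one (f' n) (y n) = 0.
    rewrite big_nat_cond big1// => n /andP[/andP[mn _] _].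
    by rewrite /f' ltnNge mn /=; exact: rank_one0.
  rewrite /S /series /= (@big_cat_nat _ _ _ m)//= tail0 addr0.
  by apply: eq_big_nat => n /andP[_ nm]; rewrite /f' nm.
have f'f : (lp_norm p%:E (fun n => nrm (f' n)) <= lp_norm p%:E (fun n => nrm (f n)))%E.
  apply: lp_norm_le => // n; rewrite nrm_ge0 /f'; case: ifP => // _.
    by rewrite lexx.
  by rewrite nrm0 nrm_ge0.
have Srep : nuclear_representation p S f' y.
  split => //; first exact: le_lt_trans flp.
  apply: (@cvg_near_cst _ _ _ _ _) => //.
  by exists m => // k /= mk; exact: S'E.
exists S; split.
- exists m, (fun i : 'I_m => y i) => z; exists (fun i : 'I_m => f i z).
  by rewrite /S bop_series big_mkord.
- move=> i; rewrite nrm_distC (_ : T (x i) - S (x i) = (T - S) (x i))//.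
  rewrite (le_lt_trans (ler_bop _ _))// (@le_lt_trans _ _ (nrm (T - S) * M))//; last first.
    by rewrite -ltr_pdivlMr.
  rewrite ler_wpM2l ?nrm_ge0// /M (bigD1 i)//= -addrA lerDl addr_ge0// sumr_ge0// => j _.
  exact: nrm_ge0.
- apply: (le_trans _ fyN); apply: (@le_trans _ _ (lp_norm p%:E (fun n => nrm (f' n)) *
     weak_lp_norm (hoelder_conjugate p%:E) y)%E).
    by apply: ereal_inf_lbound; exists f', y.
  by rewrite lee_wpmul2r// weak_lp_norm_ge0.
Qed.

End local_MAP_everywhere.

(** * Bounded sequences annihilated by a matrix *)

Section annihilator.
Context {R : realType} (s : scalars).
Local Notation K := (scalar_field R s).
Variables (c : nat -> nat) (a : nat -> nat -> R).

(** The equation [f A = 0] for a matrix [a] with finitely supported columns: only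
    the first [c m] entries of column [m] count, so all sums are finite. The null
    matrix gives the space of all bounded sequences. *)
Definition annihilator_pred : {pred nat -> K} :=
  mem [set f : nat -> K | (exists M : R, forall n, nrm (f n) <= M) /\
    forall m, \sum_(n < c m) f n * ofR (a n m) = 0].

Record annihilator := Annihilator {
  annihilator_val :> nat -> K; annihilator_valP : annihilator_val \in annihilator_pred }.

HB.instance Definition _ := [isSub for annihilator_val].
HB.instance Definition _ := [Choice of annihilator by <:].

Lemma annihilator_submod : submod_closed annihilator_pred.
Proof.
split.
  rewrite inE; split; first by exists 0 => n; rewrite nrm0.
  by move=> m; rewrite big1// => n _; rewrite mul0r.
move=> b f g; rewrite !inE => -[[M fM] fa] [[N gN] ga]; split.
  exists (nrm b * M + N) => n; rewrite (le_trans (ler_nrmD _ _))// lerD//.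
  by rewrite nrmM ler_wpM2l ?nrm_ge0.
move=> m; have -> : \sum_(n < c m) (b *: f + g) n * ofR (a n m) =
    b * \sum_(n < c m) f n * ofR (a n m) + \sum_(n < c m) g n * ofR (a n m).
  rewrite mulr_sumr -big_split/=; apply: eq_bigr => n _.
  by rewrite -[(b *: f + g) n]/(b * f n + g n) mulrDl mulrA.
by rewrite fa ga mulr0 addr0.
Qed.

HB.instance Definition _ :=
  GRing.isSubmodClosed.Build _ _ annihilator_pred annihilator_submod.
HB.instance Definition _ := [SubChoice_isSubLmodule of annihilator by <:].

Implicit Types f g : annihilator.

Lemma annihilator_sum0 f m : \sum_(n < c m) f n * ofR (a n m) = 0.
Proof. by have := annihilator_valP f; rewrite inE => -[_]; apply. Qed.

Definition sup_norm f : R := sup [set nrm (f n) | n in [set: nat]].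

Lemma sup_norm_has_sup f : has_sup [set nrm (f n) | n in [set: nat]].
Proof.
split; first by exists (nrm (f 0%N)), 0%N.
by have := annihilator_valP f; rewrite inE => -[[M fM] _]; exists M => _ [n _ <-].
Qed.

Lemma ler_sup_norm f n : nrm (f n) <= sup_norm f.
Proof. by apply: (sup_upper_bound (sup_norm_has_sup f)); exists n. Qed.

Lemma sup_norm_le f (M : R) : (forall n, nrm (f n) <= M) -> sup_norm f <= M.
Proof.
by move=> fM; apply: ge_sup; [case: (sup_norm_has_sup f)|move=> _ [n _ <-]].
Qed.

Let ann_norm f : K := ofR (sup_norm f).

Let ann_normD f g : ann_norm (f + g) <= ann_norm f + ann_norm g.
Proof.
rewrite /ann_norm -ofRD ler_ofR; apply: sup_norm_le => n.
by rewrite (le_trans (ler_nrmD _ _))// lerD// ler_sup_norm.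
Qed.

Let ann_normZ (b : K) f : ann_norm (b *: f) = `|b| * ann_norm f.
Proof.
rewrite /ann_norm nrmE -ofRM; congr ofR.
have h (e : K) g : sup_norm (e *: g) <= nrm e * sup_norm g.
  by apply: sup_norm_le => n; rewrite nrmM ler_wpM2l ?nrm_ge0// ler_sup_norm.
apply/eqP; rewrite eq_le h/=.
have [->|b0] := eqVneq b 0.
  by rewrite nrm0 mul0r (le_trans (nrm_ge0 ((0 *: f : annihilator) 0%N)))// ler_sup_norm.
rewrite -{1}[f](scalerK b0) (le_trans (ler_wpM2l (nrm_ge0 _) (h _ _)))//.
by rewrite mulrA -nrmM mulfV// nrm1 mul1r.
Qed.

Let ann_norm0_eq0 f : ann_norm f = 0 -> f = 0.
Proof.
rewrite /ann_norm -(@ofR0 R s) => /(can_inj (@ofRK R s)) f0.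
apply/val_inj/funext => n; apply/nrm0_eq0/eqP.
by rewrite eq_le nrm_ge0 andbT -f0 ler_sup_norm.
Qed.

HB.instance Definition _ := Lmodule_isNormed.Build K annihilator
  ann_normD ann_normZ ann_norm0_eq0.

Lemma nrm_annihilator f : nrm f = sup_norm f.
Proof. exact: ofRK. Qed.

Lemma imN (z : K) : im (- z) = - im z.
Proof. by case: s z => [z|[]] //=; rewrite oppr0. Qed.

(** The intervals of radius [e k] about [u k] meet pairwise, hence all have a
    point in common. Unlike a limit this comes with the rate [e]. *)
Lemma nested_limit (u e : nat -> R) : (forall k l, `|u k - u l| <= e k + e l) ->
  exists x, forall k, `|u k - x| <= e k.
Proof.
move=> ue; pose S := [set u k - e k | k in [set: nat]].
have Sb k : ubound S (u k + e k).
  by move=> _ [l _ <-]; have := ue l k; rewrite ler_norml => /andP[]; lra.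
have Ssup : has_sup S by split; [exists (u 0%N - e 0%N), 0%N|exists (u 0%N + e 0%N)].
exists (sup S) => k; rewrite ler_norml.
have h1 : u k - e k <= sup S by apply: (sup_upper_bound Ssup); exists k.
have h2 : sup S <= u k + e k by apply: ge_sup; [case: Ssup|].
by apply/andP; split; lra.
Qed.

(** Coordinatewise limits, with the rate [e k + e k] uniform in the coordinate;
    each equation of [f A = 0] is a finite sum and passes to the limit. *)
Lemma annihilator_complete (F : set_system annihilator) :
  ProperFilter F -> cauchy F -> cvg F.
Proof.
move=> PF /cauchyP FC.
pose e (k : nat) : R := k.+1%:R^-1.
have e0 k : 0 < e k by rewrite invr_gt0.
have /choice[x xP] : forall k, exists x : annihilator, F [set y | nrm (x - y) < e k].
  move=> k; have ek : 0 < ofR (e k) :> K by rewrite -(@ofR0 R s) ltr_ofR.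
  have [x Fx] := FC _ ek; exists x; apply: filterS Fx => y.
  by rewrite -ball_normE /ball_ /= nrmE ltr_ofR.
have xx k l n : nrm (x k n - x l n) <= e k + e l.
  have [y [/= yk yl]] := filter_ex (filterI (xP k) (xP l)).
  have -> : x k n - x l n = (x k - y) n - (x l - y) n.
    by rewrite -[(x k - y) n]/(x k n - y n) -[(x l - y) n]/(x l n - y n); ring.
  rewrite (le_trans (ler_nrmD _ _))// nrmN lerD// (le_trans (ler_sup_norm _ n))//.
    by rewrite -nrm_annihilator ltW.
  by rewrite -nrm_annihilator ltW.
have [mk mkP] := @scalar_of_reim R s.
have /choice[f fP] : forall n, exists z : K, forall k, nrm (x k n - z) <= e k + e k.
  move=> n; have [|a1 h1] := @nested_limit (fun k => re (x k n)) e.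
    by move=> k l; rewrite -reN -reD (le_trans (ler_re_nrm _)).
  have [|a2 h2] := @nested_limit (fun k => im (x k n)) e.
    move=> k l; rewrite (le_trans _ (xx k l n))// -imN -imD; exact: ler_im_nrm.
  by exists (mk a1 a2) => k; rewrite (le_trans (mkP _ _ _))// lerD.
have small (r : R) : (forall k, r <= e k) -> r <= 0.
  move=> re; rewrite leNgt; apply/negP => r0.
  have := re (Num.truncn r^-1); rewrite /e leNgt => /negP; apply.
  by rewrite invf_plt ?posrE//; exact: truncnS_gt.
have fann : (f : nat -> K) \in annihilator_pred.
  rewrite inE; split.
    exists (nrm (x 0%N) + (e 0%N + e 0%N)) => n.
    have -> : f n = x 0%N n - (x 0%N n - f n) by rewrite opprB addrC subrK.
    by rewrite (le_trans (ler_nrmD _ _))// nrmN lerD// nrm_annihilator ler_sup_norm.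
  move=> m; apply/nrm0_eq0/eqP; rewrite eq_le nrm_ge0 andbT.
  pose A := 2 * \sum_(n < c m) `|a n m| + 1.
  have A0 : 0 < A by rewrite /A addr1_gt0// mulr_ge0// sumr_ge0.
  rewrite -(pmulr_rle0 _ (eqbRL (invr_gt0 A) A0)); apply: small => k.
  rewrite ler_pdivrMl//.
  have -> : \sum_(n < c m) f n * ofR (a n m) = - \sum_(n < c m) (x k n - f n) * ofR (a n m).
    under [in RHS]eq_bigr do rewrite mulrBl.
    by rewrite sumrB annihilator_sum0 sub0r opprK.
  rewrite nrmN (le_trans (ler_nrm_sum _ _ _))//.
  rewrite (@le_trans _ _ (\sum_(n < c m) (e k + e k) * `|a n m|))//.
    by apply: ler_sum => n _; rewrite nrmM nrm_normr ler_wpM2r.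
  by rewrite -mulr_sumr /A mulrDl; have := e0 k; lra.
pose g := Annihilator fann.
apply/cvg_ex; exists g => B /nbhs_ballP[r /= r0 rB].
have re0 : 0 < re r by rewrite -(@ltr_ofR R s) ofR0 ofR_re// ltW.
have [k hk] : exists k, 3 * e k < re r.
  exists (Num.truncn (3 / re r)); rewrite /e ltr_pdivrMr// mulrC -ltr_pdivrMr//.
  exact: truncnS_gt.
apply: filterS (xP k) => y /= hy; apply: rB.
rewrite -ball_normE /ball_ /= nrmE -(ofR_re (ltW r0)) ltr_ofR.
have -> : g - y = (x k - y) - (x k - g) by rewrite opprB [RHS]addrC addrA subrK.
rewrite (le_lt_trans (ler_nrmD _ _))// nrmN.
have : nrm (x k - g) <= e k + e k by rewrite nrm_annihilator; apply: sup_norm_le => n; exact: fP.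
lra.
Qed.

HB.instance Definition _ := Uniform_isComplete.Build annihilator annihilator_complete.

Definition annihilator_space : completeNormedModType K := annihilator.

End annihilator.

(** * A trace obstruction to the weak approximation property *)

(** By [tsz_sq] the rows of the matrix satisfy [f A = 0]; [tsz_le] bounds their
    sup norms by [b]. The trace 1 of [tsz_trace] contradicts approximation by
    finite rank operators once [tsz_tail] makes the tails of the trace uniformly
    small, while [tsz_wp] and [tsz_lim] put the multiplication by [w] into the
    ideals. *)
Record traceful_square_zero (R : realType) (a : nat -> nat -> R) (c : nat -> nat)
    (b w : nat -> R) (p : R) : Prop := TracefulSquareZero {
  tsz_col : forall n m, (c m <= n)%N -> a n m = 0;
  tsz_sq : forall n m, \sum_(l < c m) a n l * a l m = 0;
  tsz_le : forall n m, `|a n m| <= b n;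
  tsz_w : forall n, 0 < w n <= 1;
  tsz_lim : forall e, 0 < e -> exists m, forall n, (m <= n)%N -> w n <= e;
  tsz_wp : exists W : R, forall N, \sum_(n < N) w n `^ p <= W;
  tsz_tail : forall e, 0 < e -> exists m, forall N, \sum_(m <= n < N) b n / w n <= e;
  tsz_trace : forall m, exists2 N, (m <= N)%N & \sum_(n < N) a n n = 1 }.

Section criterion.
Context {R : realType} (s : scalars).
Local Notation K := (scalar_field R s).
Variables (a : nat -> nat -> R) (c : nat -> nat) (b w : nat -> R) (p : R).
Hypothesis H : traceful_square_zero a c b w p.

Let X : completeNormedModType K := annihilator_space s c a.
Definition ellinfty : completeNormedModType K :=
  annihilator_space s (fun=> 0%N) (fun _ _ => 0 : R).

(** An element of [annihilator_space] is seen as a vector of a normed module;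
    this names its underlying function. *)
Definition coords c' a' (x : annihilator_space s c' a') : nat -> K :=
  annihilator_val (x : annihilator s c' a').

Lemma ler_coord c' a' (x : annihilator_space s c' a') n : nrm (coords x n) <= nrm x.
Proof. by rewrite nrm_annihilator ler_sup_norm. Qed.

Lemma nrm_coord_le c' a' (x : annihilator_space s c' a') (M : R) :
  (forall n, nrm (coords x n) <= M) -> nrm x <= M.
Proof. by rewrite nrm_annihilator; exact: sup_norm_le. Qed.

Lemma coord_sum c' a' I (r : seq I) (F : I -> annihilator_space s c' a') n :
  coords (\sum_(i <- r) F i) n = \sum_(i <- r) coords (F i) n.
Proof. by elim/big_ind2 : _ => // _ g _ h <- <-. Qed.

Lemma ellinfty_subproof (f : nat -> K) (M : R) : (forall n, nrm (f n) <= M) ->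
  f \in @annihilator_pred R s (fun=> 0%N) (fun _ _ => 0 : R).
Proof.
move=> fM; rewrite inE; split; first by exists M.
by move=> m; rewrite big_ord0.
Qed.

Definition to_ellinfty f M (fM : forall n, nrm (f n : K) <= M) : ellinfty :=
  Annihilator (ellinfty_subproof fM).

Lemma row_subproof n : (fun m => ofR (a n m) : K) \in @annihilator_pred R s c a.
Proof.
rewrite inE; split.
  by exists (b n) => m; rewrite nrm_normr (tsz_le H).
move=> m; under eq_bigr do rewrite -ofRM.
by rewrite -ofR_sum (tsz_sq H) ofR0.
Qed.

Definition matrix_row n : X := Annihilator (row_subproof n).

Lemma nrm_row n : nrm (matrix_row n) <= b n.
Proof. by apply: nrm_coord_le => m; rewrite nrm_normr (tsz_le H). Qed.

Lemma b_ge0 n : 0 <= b n.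
Proof. by rewrite (le_trans _ (tsz_le H n 0)). Qed.

Lemma w_gt0 n : 0 < w n. Proof. by have /andP[] := tsz_w H n. Qed.
Lemma w_le1 n : w n <= 1. Proof. by have /andP[] := tsz_w H n. Qed.

Lemma weight_bound (x : X) n : nrm (ofR (w n) * coords x n : K) <= nrm x.
Proof.
rewrite nrmM nrm_ofR ?(ltW (w_gt0 n))// (le_trans _ (ler_coord x n))//.
by rewrite ler_piMl ?nrm_ge0// w_le1.
Qed.

Definition weight_fun (x : X) : ellinfty := to_ellinfty (weight_bound x).

Lemma weight_linear : linear weight_fun.
Proof.
move=> e x y; apply/val_inj/funext => n.
rewrite -[LHS]/(ofR (w n) * (e * coords x n + coords y n)).
rewrite -[RHS]/(e * (ofR (w n) * coords x n) + ofR (w n) * coords y n).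
ring.
Qed.

Lemma weight_le (x : X) : nrm (weight_fun x) <= 1 * nrm x.
Proof. by rewrite mul1r; apply: nrm_coord_le => n; exact: weight_bound. Qed.

Definition weight_bop : bop X ellinfty := Bop (bounded_linearP weight_linear weight_le).

(** At column [m] the full sum over [n < c m] vanishes because [v A = 0]. A
    shorter sum is minus the missing terms, which are small by [tsz_tail], because
    [b n <= b n / w n]. *)
Lemma row_sum_lim (v : X) (e : R) : 0 < e ->
  exists N0, forall N, (N0 <= N)%N -> nrm (\sum_(n < N) coords v n *: matrix_row n) <= e.
Proof.
move=> e0; have d0 : 0 < e / (nrm v + 1) by rewrite divr_gt0// addr1_gt0 ?nrm_ge0.
have [N0 hN0] := tsz_tail H d0; exists N0 => N NN.
apply: nrm_coord_le => m; rewrite coord_sum.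
have -> : \sum_(n < N) coords (coords v n *: matrix_row n) m =
    \sum_(0 <= n < N) coords v n * ofR (a n m) by rewrite big_mkord.
have [cN|Nc] := leqP (c m) N.
  rewrite (@big_cat_nat _ _ _ (c m))//= big_mkord annihilator_sum0 add0r.
  rewrite big_nat_cond big1 ?nrm0 ?ltW// => n /andP[/andP[cn _] _].
  by rewrite (tsz_col H cn) ofR0 mulr0.
have : \sum_(0 <= n < c m) coords v n * ofR (a n m) = 0 by rewrite big_mkord annihilator_sum0.
rewrite (@big_cat_nat _ _ _ N)//=; last exact: ltnW.
move/eqP; rewrite addr_eq0 => /eqP ->; rewrite nrmN (le_trans (ler_nrm_sum _ _ _))//.
have h1 : \sum_(N <= n < c m) b n / w n <= e / (nrm v + 1).
  apply: (le_trans _ (hN0 (c m))); rewrite (@big_cat_nat _ _ _ N N0)//=; last exact: ltnW.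
  by rewrite lerDr sumr_ge0// => n _; rewrite divr_ge0 ?b_ge0 ?ltW ?w_gt0.
rewrite (@le_trans _ _ (nrm v * \sum_(N <= n < c m) b n / w n))//.
  rewrite mulr_sumr; apply: ler_sum => n _.
  rewrite nrmM nrm_normr ler_pM ?nrm_ge0 ?ler_coord// (le_trans (tsz_le H _ _))//.
  by rewrite ler_pdivlMr ?w_gt0// ler_piMr ?b_ge0 ?w_le1.
rewrite (le_trans (ler_wpM2l (nrm_ge0 _) h1))// mulrA ler_pdivrMr ?addr1_gt0 ?nrm_ge0//.
by rewrite mulrC ler_wpM2l ?(ltW e0)// lerDl.
Qed.

(** Elimination: vectors of a finite-dimensional space of sequences are
    recovered from finitely many coordinates. The definition of finite rank gives
    vectors but no functionals; this writes an operator with range in the space as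
    a sum of terms [x |-> coords (S x) m *: v], whose functionals are explicit. *)
Lemma coordinate_interpolation k (e : 'I_k -> X) : exists l : seq (nat * X), forall d : 'I_k -> K,
  \sum_i d i *: e i = \sum_(mv <- l) coords (\sum_i d i *: e i) mv.1 *: mv.2.
Proof.
elim: k e => [|k IH] e.
  exists [::] => d; by rewrite big_ord0 big_nil.
have [l hl] := IH (fun i => e (lift ord0 i)).
pose P (y : X) : X := \sum_(mv <- l) coords y mv.1 *: mv.2.
have PD (y z : X) : P (y + z) = P y + P z.
  rewrite /P -big_split; apply: eq_bigr => mv _ /=.
  by rewrite -scalerDl.
have PZ d (y : X) : P (d *: y) = d *: P y.
  by rewrite /P scaler_sumr; apply: eq_bigr => mv _; rewrite scalerA.
(* The part of the new vector that the old coordinates do not see; a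
   coordinate [m] with [u m != 0] is added, and [u] is removed from the old
   vectors so that they no longer contribute to it. *)
pose u : X := e ord0 - P (e ord0).
have Pe d : P (\sum_i d i *: e (lift ord0 i)) = \sum_i d i *: e (lift ord0 i) by rewrite [RHS]hl.
have yP (d : 'I_k.+1 -> K) : \sum_i d i *: e i = P (\sum_i d i *: e i) + d ord0 *: u.
  rewrite big_ord_recl PD PZ Pe /u scalerBr addrAC [_ *: P _ + _]addrC subrK.
  by [].
have [u0|/existsNP[m um]] := pselect (forall m, coords u m = 0).
  exists l => d; rewrite [LHS]yP (_ : u = 0) ?scaler0 ?addr0//.
  by apply/val_inj/funext => m; exact: u0.
have /eqP um0 := um.
exists ((m, (coords u m)^-1 *: u) ::
  [seq (mv.1, mv.2 - (coords mv.2 m / coords u m) *: u) | mv <- l]) => d.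
have := yP d; set y := \sum_i d i *: e i => yE.
rewrite big_cons big_map /=.
have PE : coords (P y) m = \sum_(mv <- l) coords y mv.1 * coords mv.2 m.
  by rewrite /P coord_sum.
have -> : \sum_(mv <- l) coords y mv.1 *: (mv.2 - (coords mv.2 m / coords u m) *: u) =
    P y - (coords (P y) m / coords u m) *: u.
  under eq_bigr do rewrite scalerBr scalerA mulrA.
  rewrite sumrB; congr (_ - _).
  by rewrite PE mulr_suml scaler_suml.
have ym : coords y m = coords (P y) m + d ord0 * coords u m by rewrite {1}yE.
rewrite scalerA ym mulrDl mulfK// scalerDl [Z in Z + _]addrC -addrA [_ + (P y - _)]addrC subrK.
by rewrite addrC -yE.
Qed.

(** For [S = phi (x) v] the sum is [phi (\sum_n v n *: row n)], and the sums
    inside tend to 0. *)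
Lemma finite_rank_trace (S : bop X X) (e : R) : finite_rank S -> 0 < e ->
  exists N0, forall N, (N0 <= N)%N ->
    nrm (\sum_(n < N) coords (S (matrix_row n)) n) <= e.
Proof.
move=> [k [f Sf]] e0; have [l hl] := coordinate_interpolation f.
have Sl (x : X) : S x = \sum_(mv <- l) coords (S x) mv.1 *: mv.2.
  by have [d ->] := Sf x; exact: hl.
have key (l' : seq (nat * X)) : exists N0, forall N, (N0 <= N)%N -> nrm (\sum_(n < N)
    coords (\sum_(mv <- l') coords (S (matrix_row n)) mv.1 *: mv.2) n)
    <= (size l')%:R * (e / (size l).+1%:R).
  elim: l' => [|[m v] l' [N1 h1]].
    by exists 0%N => N _; rewrite big1 ?nrm0 ?mul0r// => n _; rewrite big_nil.
  have d0 : 0 < e / (size l).+1%:R / (nrm S + 1) by rewrite !divr_gt0// addr1_gt0 ?nrm_ge0.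
  have [N2 h2] := row_sum_lim v d0.
  exists (maxn N1 N2) => N; rewrite geq_max => /andP[n1 n2].
  under eq_bigr do rewrite big_cons.
  rewrite -[Z in nrm Z]/(\sum_(n < N) (coords (S (matrix_row n)) m * coords v n +
    coords (\sum_(mv <- l') coords (S (matrix_row n)) mv.1 *: mv.2) n)).
  rewrite big_split/= (le_trans (ler_nrmD _ _))// -natr1 mulrDl mul1r addrC lerD ?h1//.
  have -> : \sum_(n < N) coords (S (matrix_row n)) m * coords v n =
      coords (S (\sum_(n < N) coords v n *: matrix_row n)) m.
    rewrite linear_sum coord_sum; apply: eq_bigr => n _.
    by rewrite linearZ mulrC.
  rewrite (le_trans (ler_coord _ _))// (le_trans (ler_bop _ _))//.
  rewrite (le_trans (ler_wpM2l (nrm_ge0 _) (h2 N n2)))// mulrA ler_pdivrMr ?addr1_gt0 ?nrm_ge0//.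
  by rewrite mulrC ler_wpM2l ?divr_ge0 ?(ltW e0)// lerDl.
have [N0 h0] := key l; exists N0 => N NN.
have -> : \sum_(n < N) coords (S (matrix_row n)) n = \sum_(n < N)
    coords (\sum_(mv <- l) coords (S (matrix_row n)) mv.1 *: mv.2) n.
  by apply: eq_bigr => n _; rewrite {1}Sl.
rewrite (le_trans (h0 N NN))// mulrA ler_pdivrMr// mulrC ler_wpM2l ?(ltW e0)// ler_nat.
exact: leqnSn.
Qed.

Lemma tails_lt (I : Type) (le : I -> I -> Prop) (P : nat -> I -> Prop) : directed le ->
  (forall n, exists i, forall j, le i j -> P n j) ->
  forall N i0, exists2 i, le i0 i & forall n, (n < N)%N -> P n i.
Proof.
move=> [_ refl trans dir] h N i0.
have [i i0i hi] : exists2 i, le i0 i & forall j, le i j -> forall n, (n < N)%N -> P n j.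
  elim: N => [|N [i i0i IH]]; first by exists i0.
  have [j hj] := h N; have [k ik jk] := dir i j.
  exists k; first exact: trans i0i ik.
  move=> l kl n; rewrite ltnS leq_eqVlt => /predU1P[->|nN].
    by apply: hj; exact: trans jk kl.
  by apply: IH nN; exact: trans ik kl.
by exists i => //; exact: hi.
Qed.

(** Along a net [S] with [ideal_norm (T S)] at most [D] the terms
    [(S (row n)) n] are at most [D * (b n / w n)], so that the tails of their sum
    are small uniformly along the net. The head tends to the trace 1 and the whole
    sum is nearly 0: with errors 1/4 for each of the three, [1 <= 3/4]. *)
Theorem not_weak_BAP (A : operator_ideal R s) :
  in_ideal A weight_bop -> (ideal_norm A weight_bop < +oo)%E ->
  (forall (U : bop X ellinfty) (D : R), (ideal_norm A U <= D%:E)%E ->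
     forall x n, nrm (coords (U x) n) <= D * nrm x) ->
  ~ weak_BAP A X.
Proof.
move=> TA TN coordA [lambda lambda1 /(_ _ _ TA)[I [le [S [dir Sf Scvg Slim]]]]].
have [D [i0 D0' hD]] : exists D : R, exists2 i0, 0 < D & forall j, le i0 j ->
    (ideal_norm A (bop_comp weight_bop (S j)) <= D%:E)%E.
  have : (net_limsup le (fun j => ideal_norm A (bop_comp weight_bop (S j))) < +oo)%E.
    apply: (le_lt_trans Slim); apply: lte_mul_pinfty => //.
    by rewrite lee_fin (le_trans _ lambda1).
  move=> /ereal_inf_lt[_ [i0 _ <-]] h.
  set M := ereal_sup _ in h.
  exists (Num.max (fine M) 1), i0; first by rewrite lt_max ltr01 orbT.
  move=> j ij; have jM : (ideal_norm A (bop_comp weight_bop (S j)) <= M)%E.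
    by apply: ereal_sup_ubound; exists j.
  apply: (le_trans jM); case: (M) h => [r _|//|_]; first by rewrite lee_fin le_max lexx.
  by rewrite leNye.
have q0 : 0 < 4^-1 / D by rewrite divr_gt0.
have [m hm] := tsz_tail H q0.
have [N1 mN1 tr1] := tsz_trace H m.
have [|i i0i hi] := @tails_lt I le (fun n j => nrm (S j (matrix_row n) - matrix_row n) <= 4^-1 / N1.+1%:R) dir _ N1 i0.
  move=> n; have d0 : 0 < 4^-1 / N1.+1%:R :> R by rewrite divr_gt0.
  have d0' : 0 < ofR (4^-1 / N1.+1%:R) :> K by rewrite -(@ofR0 R s) ltr_ofR.
  have [i hi] := Scvg (matrix_row n) _ (nbhsx_ballx (matrix_row n) _ d0').
  exists i => j /hi; rewrite -ball_normE /ball_ /= nrm_distC nrmE ltr_ofR.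
  exact: ltW.
have q4 : 0 < 4^-1 :> R by rewrite invr_gt0.
have [N0 hN0] := finite_rank_trace (Sf i) q4.
pose N := maxn N0 N1.
have diag n : nrm (coords (S i (matrix_row n)) n) <= D * (b n / w n).
  have := coordA _ _ (hD i i0i) (matrix_row n) n.
  rewrite -[coords _ n]/(ofR (w n) * coords (S i (matrix_row n)) n).
  rewrite nrmM nrm_ofR ?(ltW (w_gt0 n))// -ler_pdivlMl ?w_gt0// => h.
  rewrite (le_trans h)// mulrC -mulrA ler_wpM2l ?(ltW D0')//.
  by rewrite ler_wpM2r ?nrm_row// invr_ge0 ltW ?w_gt0.
have hN : nrm (\sum_(n < N) coords (S i (matrix_row n)) n) <= 4^-1 by apply: hN0; rewrite leq_maxl.
have tail : nrm (\sum_(N1 <= n < N) coords (S i (matrix_row n)) n) <= 4^-1.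
  rewrite (le_trans (ler_nrm_sum _ _ _))// (@le_trans _ _ (\sum_(N1 <= n < N) D * (b n / w n)))//.
    by apply: ler_sum => n _.
  rewrite -mulr_sumr mulrC -ler_pdivlMr//; apply: (le_trans _ (hm N)).
  rewrite (@big_cat_nat _ _ _ N1 m)//= ?leq_maxr// lerDr sumr_ge0// => n _.
  by rewrite divr_ge0 ?b_ge0 ?ltW ?w_gt0.
have head : nrm (\sum_(n < N1) coords (S i (matrix_row n)) n - 1) <= 4^-1.
  have -> : (1 : K) = \sum_(n < N1) coords (matrix_row n) n by rewrite -ofR_sum tr1 ofR1.
  rewrite -sumrB (le_trans (ler_nrm_sum _ _ _))//.
  rewrite (@le_trans _ _ (\sum_(n < N1) 4^-1 / N1.+1%:R))//.
    apply: ler_sum => n _; rewrite (le_trans _ (hi n (ltn_ord n)))//.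
    exact: (ler_coord (S i (matrix_row n) - matrix_row n)).
  rewrite sumr_const card_ord -[leLHS]mulr_natr mulrAC -mulrA ler_piMr//.
  by rewrite ler_pdivrMr// mul1r ler_nat.
have split : \sum_(n < N) coords (S i (matrix_row n)) n =
    \sum_(n < N1) coords (S i (matrix_row n)) n + \sum_(N1 <= n < N) coords (S i (matrix_row n)) n.
  by rewrite -!(big_mkord xpredT (fun n => coords (S i (matrix_row n)) n)) (@big_cat_nat _ _ _ N1)//= leq_maxr.
have : nrm (1 : K) <= 4^-1 + (4^-1 + 4^-1).
  have -> : (1 : K) = - (\sum_(n < N1) coords (S i (matrix_row n)) n - 1) +
      (\sum_(n < N) coords (S i (matrix_row n)) n - \sum_(N1 <= n < N) coords (S i (matrix_row n)) n).
    by rewrite split addrK opprB subrK.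
  rewrite (le_trans (ler_nrmD _ _))// nrmN lerD// (le_trans (ler_nrmD _ _))// nrmN.
  exact: lerD.
by rewrite nrm1; lra.
Qed.

End criterion.

(** * The weighted inclusion is p-nuclear *)

Section evaluation.
Context {R : realType} (s : scalars).
Local Notation K := (scalar_field R s).
Variables (c' : nat -> nat) (a' : nat -> nat -> R).

Lemma eval_linear n : linear (fun x : annihilator_space s c' a' => coords x n : K^o).
Proof. by []. Qed.

Lemma coordsB (x y : annihilator_space s c' a') n :
  coords (x - y) n = coords x n - coords y n.
Proof. by []. Qed.

Lemma eval_le n (x : annihilator_space s c' a') : nrm (coords x n) <= 1 * nrm x.
Proof. by rewrite mul1r ler_coord. Qed.

Definition eval_bop n : dual (annihilator_space s c' a') :=
  Bop (bounded_linearP (eval_linear n) (eval_le n)).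

Lemma nrm_eval n : nrm (eval_bop n) <= 1.
Proof. by rewrite nrm_bopE; apply: opnorm_le => // x; exact: eval_le. Qed.

End evaluation.
Arguments eval_bop {R s c' a'} n.

Section nuclear_membership.
Context {R : realType} (s : scalars).
Local Notation K := (scalar_field R s).
Variables (p : R) (p_gt1 : 1 < p).
Let p0 : 0 < p := lt_trans ltr01 p_gt1.

Lemma lp_norm_lim (r : R) (u : nat -> R) (M : R) : 0 < r -> 0 <= M -> (forall n, 0 <= u n) ->
  (forall N, \sum_(n < N) u n `^ r <= M) -> (lp_norm r%:E u <= (M `^ r^-1)%:E)%E.
Proof.
move=> r0 M0 u0 uM; rewrite /lp_norm Lnorm_counting// -poweR_EFin.
rewrite gt0_ler_poweR ?invr_ge0 ?(ltW r0)//.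
- by rewrite in_itv/= leey andbT; apply: nneseries_ge0 => n _ _; rewrite lee_fin powR_ge0.
- by rewrite in_itv/= leey andbT lee_fin.
apply: lime_le; first by apply: is_cvg_nneseries => n _ _; exact: poweR_ge0.
apply: nearW => N; rewrite big_mkord.
under eq_bigr do rewrite /= ger0_norm//.
by rewrite sumEFin lee_fin.
Qed.

Lemma partial_hoelder (u v : nat -> R) N : (forall n, 0 <= u n) -> (forall n, 0 <= v n) ->
  ((\sum_(n < N) u n * v n)%:E <=
   lp_norm p%:E u * lp_norm (hoelder_conjugate p%:E) v)%E.
Proof.
move=> u0 v0; pose q := p / (p - 1).
have p10 : 0 < p - 1 by rewrite subr_gt0.
have pq : p^-1 + q^-1 = 1 by rewrite /q; field; rewrite !gt_eqF.
have <- : q%:E = hoelder_conjugate p%:E.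
  apply/hoelder_conjugateP; rewrite ?ltNyr// ?eqe ?gt_eqF//.
  by rewrite !inver !gt_eqF ?divr_gt0// -EFinD pq.
have q0 : 0 < q by rewrite divr_gt0.
apply: le_trans (hoelder counting (measurable_from_nat u) (measurable_from_nat v) p0 q0 pq).
rewrite Lnorm_counting// invr1 poweRe1; last first.
  by apply: nneseries_ge0 => n _ _; exact: poweR_ge0.
rewrite -sumEFin -(big_mkord xpredT (fun n => (u n * v n)%:E)).
apply: le_trans (nneseries_lim_ge N _) => /=; last first.
  by move=> n _ _; rewrite lee_fin powR_ge0.
apply: lee_sum => n _; rewrite lee_fin powRr1//.
by rewrite /= ger0_norm// mulr_ge0.
Qed.

(** Evaluation at [n] is a functional of norm at most 1; Hoelder's inequality
    bounds the partial sums of the nuclear representation against it. *)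
Lemma nuclear_coord (X : completeNormedModType K) (U : bop X (ellinfty s)) (D : R) :
  (p_nuclear_norm p U <= D%:E)%E -> forall x n, nrm (coords (U x) n) <= D * nrm x.
Proof.
move=> UD x n; have [->|x0] := eqVneq x 0.
  by rewrite linear0 !nrm0 mulr0.
have nx0 := nrm_gt0 x0.
rewrite -ler_pdivrMr// -lee_fin; apply: (le_trans _ UD).
apply: le_ereal_inf_tmp => _ [f [y [[_ _ fyU] ->]]].
set u := fun k => nrm (f k); pose g : dual (ellinfty s) := @eval_bop R s (fun=> 0%N) (fun _ _ => 0) n.
pose v := fun k => nrm (g (y k) : K).
have vy : (lp_norm (hoelder_conjugate p%:E) v <= weak_lp_norm (hoelder_conjugate p%:E) y)%E.
  by apply: ereal_sup_ubound; exists g => //; exact: nrm_eval.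
apply: (@le_trans _ _ (lp_norm p%:E u * lp_norm (hoelder_conjugate p%:E) v)%E); last first.
  by rewrite lee_wpmul2l// lp_norm_ge0.
have step m : nrm (coords (series (fun k => rank_one (f k) (y k)) m x) n) <=
    (\sum_(k < m) u k * v k) * nrm x.
  rewrite bop_series coord_sum big_mkord (le_trans (ler_nrm_sum _ _ _))// mulr_suml.
  apply: ler_sum => k _; rewrite -[coords _ n]/((f k x : K) * coords (y k) n) nrmM.
  by rewrite mulrAC ler_wpM2r ?nrm_ge0// ler_dual.
have hoel m := partial_hoelder (u := u) (v := v) m (fun k => nrm_ge0 _) (fun k => nrm_ge0 _).
have C0 : (0 <= lp_norm p%:E u * lp_norm (hoelder_conjugate p%:E) v)%E.
  by rewrite mule_ge0 ?lp_norm_ge0.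
move: hoel C0; case: (_ * _)%E => [C|_ _|//]; last exact: leey.
move=> hoel C0; rewrite lee_fin ler_pdivrMr//; apply/ler_addgt0Pr => e e0.
have ex : 0 < e / nrm x by rewrite divr_gt0.
have eK : 0 < ofR (e / nrm x) :> K by rewrite -(@ofR0 R s) ltr_ofR.
have /cvgrPdist_lt/(_ _ eK)[m _ /(_ m (leqnn m))] := fyU.
set S := series _ m; rewrite nrmE ltr_ofR => hm.
have -> : coords (U x) n = coords (S x) n + coords ((U - S) x) n.
  by rewrite (_ : (U - S) x = U x - S x)// coordsB addrC subrK.
rewrite (le_trans (ler_nrmD _ _))// lerD//.
  by rewrite (le_trans (step m))// ler_wpM2r ?nrm_ge0// -lee_fin.
rewrite (le_trans (ler_coord _ _))// (le_trans (ler_bop _ _))//.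
by rewrite -ler_pdivlMr// ltW.
Qed.

Variables (a : nat -> nat -> R) (c : nat -> nat) (b w : nat -> R).
Hypothesis H : traceful_square_zero a c b w p.
Local Notation X := (annihilator_space s c a).

Let f (n : nat) : dual X := (ofR (w n) : K) *: @eval_bop R s c a n.

Lemma nrm_weighted_eval n : nrm (f n) <= w n.
Proof.
rewrite nrmZ nrm_ofR; last by rewrite ltW ?(w_gt0 H).
by rewrite ler_piMr ?nrm_eval// ltW ?(w_gt0 H).
Qed.

Lemma unit_bound (k n : nat) : nrm ((n == k)%:R : K) <= 1.
Proof. by case: (n == k); rewrite ?nrm1 ?nrm0. Qed.

Definition unit_seq k : ellinfty s := to_ellinfty (unit_bound k).

(** With suitable phases the sum is the value of [g] at a combination of unit
    vectors, and that combination has sup norm at most 1. *)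
Lemma unit_seq_sum (g : dual (ellinfty s)) N : \sum_(n < N) nrm (g (unit_seq n) : K) <= nrm g.
Proof.
have /choice[u uP] : forall n : nat, exists u : K, nrm u = 1 /\ u * g (unit_seq n) = ofR (nrm (g (unit_seq n) : K)).
  by move=> n; have [u u1 uz] := ex_phase (g (unit_seq n) : K); exists u.
have -> : \sum_(n < N) nrm (g (unit_seq n) : K) = re (g (\sum_(n < N) u n *: unit_seq n) : K).
  rewrite linear_sum re_sum; apply: eq_bigr => n _.
  have gZ : u n * g (unit_seq n) = g (u n *: unit_seq n) :> K by rewrite linearZ.
  by apply: etrans (congr1 re gZ); case: (uP n) => _ ->; rewrite ofRK.
rewrite (le_trans (ler_norm _))// (le_trans (ler_re_nrm _))// (le_trans (ler_dual _ _))//.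
rewrite ler_piMr ?nrm_ge0//; apply: nrm_coord_le => m; rewrite coord_sum.
rewrite (le_trans (ler_nrm_sum _ _ _))//.
have -> : \sum_(i < N) nrm (coords (u i *: unit_seq i) m) = \sum_(i < N) (m == i)%:R.
  apply: eq_bigr => i _; rewrite -[coords _ m]/(u i * (m == i)%:R) nrmM; case: (uP i) => -> _.
  by rewrite mul1r; case: (m == i); rewrite ?nrm1 ?nrm0.
have [mN|Nm] := ltnP m N; last first.
  rewrite big1// => i _; rewrite (_ : (m == i) = false)//.
  by apply/negbTE; rewrite neq_ltn orbC (leq_trans (ltn_ord i)).
rewrite (bigD1 (Ordinal mN))//= eqxx big1 ?addr0// => i im.
by rewrite (_ : (m == i) = false)//; apply/negbTE; apply: contra im => /eqP mi; apply/eqP/val_inj.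
Qed.

(** For terms between 0 and 1, raising to the power [q >= 1] does not increase them, so
    [l_1] sits in [l_q]. Dividing by [nrm g + 1] rather than [nrm g] avoids the
    case [g = 0]. *)
Lemma unit_seq_weak (g : dual (ellinfty s)) :
  (lp_norm (hoelder_conjugate p%:E) (fun n => nrm (g (unit_seq n) : K)) <= (nrm g + 1)%:E)%E.
Proof.
have [q [-> q1]] : exists q : R, hoelder_conjugate p%:E = q%:E /\ 1 <= q.
  have := hoelder_conj_ge1 (ltW p_gt1 : (1 <= p%:E)%E).
  case E : (hoelder_conjugate _) => [q| |]; rewrite ?lee_fin//; first by exists q.
  by have := hoelder_conjugate_eqy E => -[] p1; move: p_gt1; rewrite p1 ltxx.
have q0 : 0 < q by rewrite (lt_le_trans ltr01).
set M := nrm g + 1; have M0 : 0 < M by rewrite addr1_gt0 ?nrm_ge0.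
have Mq : 0 <= M `^ q by exact: powR_ge0.
have -> : M%:E = ((M `^ q) `^ q^-1)%:E by rewrite -powRrM divff ?gt_eqF// powRr1// ltW.
apply: lp_norm_lim => // [n|N]; first exact: nrm_ge0.
apply: (@le_trans _ _ (\sum_(n < N) M `^ q * (nrm (g (unit_seq n) : K) / M))).
  apply: ler_sum => n _; set t := nrm _.
  have t0 : 0 <= t by exact: nrm_ge0.
  have tM : t <= M.
    apply: (@le_trans _ _ (nrm g)); last by rewrite lerDl.
    apply: (le_trans _ (unit_seq_sum g n.+1)); rewrite big_ord_recr/= lerDr.
    by apply: sumr_ge0 => k _; exact: nrm_ge0.
  rewrite -{1}[t](divfK (lt0r_neq0 M0)) mulrC powRM ?divr_ge0 ?(ltW M0)//.
  rewrite ler_wpM2l// -[leRHS]powRr1 ?divr_ge0 ?(ltW M0)//.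
  have [->|t0'] := eqVneq t 0; first by rewrite mul0r !powR0// ?gt_eqF.
  apply: ger_powR => //; rewrite ler_pdivrMr// mul1r tM andbT divr_gt0//.
  by rewrite lt0r t0' t0.
rewrite -mulr_sumr ler_piMr// -mulr_suml ler_pdivrMr// mul1r.
by rewrite (le_trans (unit_seq_sum g N))// lerDl.
Qed.

(** The multiplication by [w] is the sum of [w n] times the [n]-th coordinate
    times the [n]-th unit vector. The functionals have norms in [l_p], the unit
    vectors are weakly summable, and the partial sums converge in norm because
    [w] tends to 0. *)
Lemma weight_nuclear_representation :
  nuclear_representation p (weight_bop s H) f (fun n => unit_seq n).
Proof.
split.
- have [W hW] := tsz_wp H.
  have W0 : 0 <= W by have := hW 0%N; rewrite big_ord0.
  apply: (le_lt_trans _ (ltry (W `^ p^-1))); apply: lp_norm_lim => // [n|N]; first exact: nrm_ge0.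
  apply: (le_trans _ (hW N)); apply: ler_sum => n _.
  apply: ge0_ler_powR; rewrite ?nnegrE ?nrm_ge0 ?(ltW p0)// ?nrm_weighted_eval//.
  by rewrite ltW ?(w_gt0 H).
- by move=> g; exact: (le_lt_trans (unit_seq_weak g) (ltry _)).
- apply/cvgrPdist_le => e e0.
  have re0 : 0 < re e by rewrite -(@ltr_ofR R s) ofR0 ofR_re// ltW.
  have [m hm] := tsz_lim H re0; exists m => // N /= mN.
  rewrite -(ofR_re (ltW e0)) nrmE ler_ofR nrm_bopE; apply: opnorm_le; first exact: ltW.
  move=> x; apply: nrm_coord_le => n.
  set S := series _ N.
  have Sn : coords (S x) n = if (n < N)%N then ofR (w n) * coords x n else 0.
    rewrite bop_series coord_sum big_mkord.
    have E (k : 'I_N) : coords (rank_one (f k) (unit_seq k) x) n =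
        (ofR (w k) * coords x k) * (n == k)%:R by [].
    rewrite (eq_bigr _ (fun k _ => E k)); case: ltnP => nN.
      rewrite (bigD1 (Ordinal nN))//= eqxx mulr1 big1 ?addr0// => i im.
      rewrite (_ : (n == i) = false) ?mulr0//; apply/negbTE; apply: contra im => /eqP mi.
      exact/eqP/val_inj.
    rewrite big1// => i _; rewrite (_ : (n == i) = false) ?mulr0//.
    by apply/negbTE; rewrite neq_ltn orbC (leq_trans (ltn_ord i)).
  rewrite -[coords _ n]/(ofR (w n) * coords x n - coords (S x) n) Sn.
  case: ltnP => nN; first by rewrite subrr nrm0 mulr_ge0 ?nrm_ge0// ltW.
  rewrite subr0 nrmM nrm_ofR; last by rewrite ltW ?(w_gt0 H).
  rewrite ler_pM ?nrm_ge0 ?ler_coord//; first by rewrite ltW ?(w_gt0 H).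
  by apply: hm; exact: leq_trans nN.
Qed.

Lemma weight_nuclear_norm : (p_nuclear_norm p (weight_bop s H) < +oo)%E.
Proof.
have [h1 _ _] := weight_nuclear_representation.
apply: (@le_lt_trans _ _ (lp_norm p%:E (fun n => nrm (f n)) *
  weak_lp_norm (hoelder_conjugate p%:E) (fun n => unit_seq n))%E).
  by apply: ereal_inf_lbound; exists f, (fun n => unit_seq n); split => //; exact: weight_nuclear_representation.
apply: lte_mul_pinfty; rewrite ?lp_norm_ge0//.
  by rewrite ge0_fin_numE ?lp_norm_ge0.
apply: (le_lt_trans _ (ltry 2)); apply: ge_ereal_sup => _ [g /= g1 <-].
by apply: (le_trans (unit_seq_weak g)); rewrite lee_fin -[2]/(1 + 1) lerD2r.
Qed.

End nuclear_membership.

(** * The weighted inclusion is p-integral *)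

Section integral_membership.
Context {R : realType} (s : scalars).
Local Notation K := (scalar_field R s).
Variables (p : R) (p1 : (1 <= p%:E)%E).
Let p0 : 0 < p.
Proof. by rewrite (lt_le_trans ltr01)// -lee_fin. Qed.

(** Evaluation at [n] is a functional of norm at most 1, and the bidual
    embedding turns it into an evaluation of [B (Linfty_to_Lp (A x))]. *)
Lemma integral_coord (X : completeNormedModType K) (U : bop X (ellinfty s)) (D : R) :
  (p_integral_norm p1 U <= D%:E)%E -> forall x n, nrm (coords (U x) n) <= D * nrm x.
Proof.
move=> UD x n; have [->|x0] := eqVneq x 0.
  by rewrite linear0 !nrm0 mulr0.
have nx0 := nrm_gt0 x0.
rewrite -ler_pdivrMr// -lee_fin; apply: (le_trans _ UD).
apply: le_ereal_inf_tmp => _ [d [Om [mu [A [B [AB ->]]]]]].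
rewrite lee_fin ler_pdivrMr//.
pose g : dual (ellinfty s) := @eval_bop R s (fun=> 0%N) (fun _ _ => 0) n.
have -> : coords (U x) n = B (Linfty_to_Lp p1 (A x)) g :> K by rewrite -AB.
rewrite (le_trans (ler_dual _ _))// (@le_trans _ _ (nrm (B (Linfty_to_Lp p1 (A x))) * 1))//.
  by rewrite ler_wpM2l ?nrm_ge0// nrm_eval.
rewrite mulr1 (le_trans (ler_bop _ _))// (@le_trans _ _ (nrm B * (nrm A * nrm x)))//.
  rewrite ler_wpM2l ?nrm_ge0// (le_trans (Linfty_to_Lp_le _ _))// mul1r.
  exact: ler_bop.
by rewrite mulrCA mulrA.
Qed.

Variables (a : nat -> nat -> R) (c : nat -> nat) (b w : nat -> R).
Hypothesis H : traceful_square_zero a c b w p.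
Local Notation X := (annihilator_space s c a).

Let wp_ge0 n : 0 <= w n `^ p. Proof. exact: powR_ge0. Qed.

Let weighted : {measure set nat -> \bar R} :=
  mseries (fun n => mscale (NngNum (wp_ge0 n)) (\d_n : {measure set nat -> \bar R})) 0.

Let weighted_set1 n : ((w n `^ p)%:E <= weighted [set n])%E.
Proof.
apply: (@le_trans _ _ (\sum_(0 <= k < n.+1) (w k `^ p)%:E * \d_k [set n])%E).
  rewrite big_nat_recr//= diracE mem_set// mule1 leeDr// sume_ge0// => k _.
  by rewrite mule_ge0// lee_fin.
by apply: nneseries_lim_ge => k _ _; rewrite mule_ge0// lee_fin.
Qed.

Let weighted_setT : exists2 W : R, 0 < W & weighted [set: nat] = W%:E.
Proof.
have [W hW] := tsz_wp H.
have le1 : (weighted [set: nat] <= W%:E)%E.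
  apply: lime_le; first by apply: is_cvg_nneseries => k _ _; rewrite mule_ge0// lee_fin.
  apply: nearW => N; rewrite big_mkord.
  rewrite (eq_bigr (fun k : 'I_N => (w k `^ p)%:E)); last first.
    by move=> k _; rewrite -[LHS]/((w k `^ p)%:E * \d_(k : nat) [set: nat])%E diracT mule1.
  by rewrite sumEFin lee_fin; exact: hW.
have le2 : ((w 0 `^ p)%:E <= weighted [set: nat])%E.
  by apply: (le_trans (weighted_set1 0%N)); apply: le_measure; rewrite ?inE.
have w0 : 0 < w 0 `^ p by rewrite powR_gt0// (w_gt0 H).
have fin : weighted [set: nat] \is a fin_num.
  by rewrite ge0_fin_numE// (le_lt_trans le1)// ltry.
exists (fine (weighted [set: nat])); last by rewrite fineK.
by rewrite -lte_fin fineK// (lt_le_trans _ le2)// lte_fin.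
Qed.

(** The mass at [n] is proportional to [w n `^ p]. The total mass is positive
    and finite, so that the Dirac measure given as default does not occur. *)
Definition weight_probability : probability nat R :=
  mnormalize weighted (\d_(0%N) : probability nat R).

Lemma weight_probability_atom : exists2 W : R, 0 < W &
  forall n, ((w n `^ p / W)%:E <= weight_probability [set n])%E.
Proof.
have [W W0 hW] := weighted_setT; exists W => // n.
rewrite /weight_probability /= /mnormalize hW /=.
rewrite eqe (gt_eqF W0) /= EFinM; apply: lee_pmul => //; rewrite ?lee_fin ?invr_ge0 ?(ltW W0)//.
Qed.

Local Notation mu := weight_probability.

Lemma weight_atom_neq0 n : mu [set n] != 0%E.
Proof.
have [W W0 hW] := weight_probability_atom.
by rewrite gt_eqF// (lt_le_trans _ (hW n))// lte_fin divr_gt0// powR_gt0 ?(w_gt0 H).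
Qed.

Lemma nrm_atom_ge : exists2 C : R, 0 < C & forall n, w n <= C * nrm (atom (s := s) mu p1 n).
Proof.
have [W W0 hW] := weight_probability_atom.
exists (W `^ p^-1); first by rewrite powR_gt0.
move=> n; rewrite -ler_pdivrMl ?powR_gt0//.
rewrite -lee_fin Lp_class_nrmE Lnorm.unlock.
under eq_integral => k _.
  have -> : ((`|(EFin \o (nrm \o (fun k : nat => (k == n)%:R : K))) k| `^ p) = (\1_[set n] k)%:E)%E.
    rewrite /= indicE; case: eqP => [->|kn].
      by rewrite mem_set// nrm1 normr1 powR1.
    by rewrite memNset// nrm0 normr0 powR0// gt_eqF.
  over.
rewrite integral_indic// setIT.
have -> : (((W `^ p^-1)^-1 * w n)%:E = ((w n `^ p / W)%:E `^ p^-1))%E.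
  rewrite poweR_EFin powRM ?invr_ge0 ?(ltW W0)// -powRrM divff ?gt_eqF// powRr1 ?ltW ?(w_gt0 H)//.
  by rewrite mulrC -powRN -[W^-1]powR_inv1 ?(ltW W0)// -powRrM mulN1r.
rewrite gt0_ler_poweR ?invr_ge0 ?(ltW p0) ?hW//.
  by rewrite in_itv/= leey andbT lee_fin divr_ge0// ltW.
by rewrite in_itv/= leey andbT.
Qed.

(** The inclusion of [X] into [L_oo mu], followed by [u |-> (w n * u n)_n]. The
    latter is bounded on [L_p mu] because the value of [u] at [n] is at most
    [nrm u / nrm (atom n)] and the norm of the atom, [mu {n} `^ p^-1], is at least
    a multiple of [w n]. *)
Lemma weight_p_integral : p_integral p1 (weight_bop s H).
Proof.
have A0 (x : X) : \forall n \ae mu, nrm (coords x n) <= nrm x by apply: aeW => n; exact: ler_coord.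
have A0L (x : X) : coords x \in @Lfunction_pred _ nat R s mu +oo%E.
  exact: (bounded_Lfunction (leey 1) (nrm_ge0 x) (scalar_measurable_nat _) (A0 x)).
pose A1 (x : X) : Lp s mu (leey 1) := Lp_class (leey 1) (A0L x).
have A1E x : \forall n \ae mu, repr (A1 x) n = coords x n := Lp_class_repr _ _.
have A1l : linear A1.
  move=> d x y; apply: Lp_ext.
  have h1 := ae_conj (A1E (d *: x + y)) (ae_conj (A1E x) (A1E y)).
  apply: filterS (ae_conj h1 (ae_conj (Lp_reprD (d *: A1 x) (A1 y)) (Lp_reprZ d (A1 x)))) => k.
  by move=> [[-> [hx hy]] [-> ->]]; rewrite hx hy.
have A1le x : nrm (A1 x) <= 1 * nrm x.
  rewrite mul1r; apply: Lp_nrm_le_bound; first exact: nrm_ge0.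
  by apply: filterS (A1E x) => k ->; exact: ler_coord.
have [A [AE _]] := bop_exists ler01 A1l A1le.
have [C C0 hC] := nrm_atom_ge.
have Bb (u : Lp s mu p1) n : nrm (ofR (w n) * repr u n) <= C * nrm u.
  rewrite nrmM nrm_ofR; last by rewrite ltW ?(w_gt0 H).
  apply: (@le_trans _ _ (C * nrm (atom (s := s) mu p1 n) * ((nrm (atom (s := s) mu p1 n))^-1 * nrm u))).
    rewrite ler_pM ?nrm_ge0 ?hC//; first by rewrite ltW ?(w_gt0 H).
    exact: (ler_repr_atom u (weight_atom_neq0 n)).
  by rewrite mulrA mulfK// gt_eqF// (nrm_atom_gt0 _ (weight_atom_neq0 n)).
pose B1 (u : Lp s mu p1) : ellinfty s := to_ellinfty (Bb u).
have B1l : linear B1.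
  move=> d u v; apply/val_inj/funext => n.
  rewrite -[LHS]/(ofR (w n) * repr (d *: u + v) n).
  have /ae_natP/(_ n (weight_atom_neq0 n)) [-> ->] := ae_conj (Lp_reprD (d *: u) v) (Lp_reprZ d u).
  rewrite -[RHS]/(d * (ofR (w n) * repr u n) + ofR (w n) * repr v n).
  by rewrite mulrDr mulrCA.
have B1le u : nrm (B1 u) <= C * nrm u by apply: nrm_coord_le => n; exact: Bb.
have [B [BE _]] := bop_exists (ltW C0) B1l B1le.
exists _, nat, mu, A, (bop_comp (bidual_bop (ellinfty s)) B) => x.
rewrite -[RHS]/(bidual_embedding (B (Linfty_to_Lp p1 (A x)))); congr bidual_embedding.
rewrite BE; apply/val_inj/funext => n; rewrite -[LHS]/(ofR (w n) * coords x n).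
rewrite -[RHS]/(ofR (w n) * repr (Linfty_to_Lp p1 (A x)) n) AE.
by have /ae_natP/(_ n (weight_atom_neq0 n)) [-> ->] := ae_conj (Linfty_to_Lp_repr p1 (A1 x)) (A1E x).
Qed.

Lemma weight_integral_norm : (p_integral_norm p1 (weight_bop s H) < +oo)%E.
Proof.
have [d [Om [mu [A [B AB]]]]] := weight_p_integral.
exact: (le_lt_trans (p_integral_norm_le AB) (ltry _)).
Qed.

End integral_membership.

(** * Flat signs *)

Section signs.
Context {R : realType}.

Lemma expR_le_1Dx (y : R) : `|y| <= 2^-1 -> expR (y - 2 * y ^+ 2) <= 1 + y.
Proof.
move=> y2; have [yl yu] : - 2^-1 <= y /\ y <= 2^-1 by move: y2; rewrite ler_norml => /andP.
have h := expR_ge1Dx (- (y - 2 * y ^+ 2)).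
have y1 : 0 < 1 + y by lra.
rewrite -[leLHS]invrK -expRN invf_ple ?posrE ?expR_gt0//.
apply: le_trans h; rewrite -[leLHS]mul1r ler_pdivrMr//.
have : 0 <= y ^+ 2 * (1 + 2 * y) by rewrite mulr_ge0 ?sqr_ge0//; lra.
by rewrite !exprS expr0; nra.
Qed.

(** Averaged over all signs, each product is 1, since the average of a factor is
    1 and the signs are independent. So for some signs the sum over [l] is at most
    [#|L|]; the products being nonnegative, each of them is. *)
Lemma small_products (L J : finType) (x : L -> J -> R) :
  (forall l j, `|x l j| <= 2^-1) ->
  exists eps : {ffun J -> bool}, forall l, \prod_j (1 + (-1) ^+ eps j * x l j) <= #|L|%:R.
Proof.
move=> x2.
pose P (eps : {ffun J -> bool}) l : R := \prod_j (1 + (-1) ^+ eps j * x l j).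
have P0 eps l : 0 <= P eps l.
  apply: prodr_ge0 => j _; have := x2 l j; rewrite ler_norml => /andP[h1 h2].
  by case: (eps j); rewrite ?expr1 ?expr0; lra.
have avg : \sum_(eps : {ffun J -> bool}) \sum_l P eps l = \sum_(eps : {ffun J -> bool}) #|L|%:R.
  rewrite exchange_big /=.
  transitivity (\sum_(l : L) (2 ^+ #|J| : R)).
    apply: eq_bigr => l _.
    rewrite -(bigA_distr_bigA (fun j b => 1 + (-1) ^+ (b : bool) * x l j)).
    rewrite -prodr_const; apply: eq_bigr => j _.
    by rewrite big_bool /= expr1 expr0; ring.
  by rewrite !sumr_const card_ffun card_bool -[LHS]mulr_natr -[RHS]mulr_natr natrX mulrC.
have [eps heps] : exists eps, \sum_l P eps l <= #|L|%:R.
  apply: contrapT => /forallNP h.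
  have : \sum_(eps : {ffun J -> bool}) (#|L|%:R : R) < \sum_(eps : {ffun J -> bool}) \sum_l P eps l.
    apply: ltr_sum; last by move=> eps _; rewrite ltNge; apply/negP; exact: h.
    by apply/hasP; exists [ffun=> true]; rewrite ?mem_index_enum.
  by rewrite avg ltxx.
exists eps => l; apply: le_trans heps; rewrite (bigD1 l)//= lerDl.
by apply: sumr_ge0 => k _; exact: P0.
Qed.

(** [expR (y - 2 y^2) <= 1 + y] turns the bound on the products into a bound on
    sums; doubling the index set by a sign bounds them from both sides. The
    factor [r / 2] makes the numbers at most 1/2 in absolute value with sum of
    squares at most 1/4. *)
Lemma flat_signs (L J : finType) (v : L -> J -> R) (r : R) : 0 < r ->
  (forall l, \sum_j v l j ^+ 2 <= r ^- 2) ->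
  exists eps : {ffun J -> bool}, forall l,
    `|\sum_j (-1) ^+ eps j * v l j| <= 2 / r * (ln (2 * #|L|)%:R + 1).
Proof.
move=> r0 vr.
pose x (l : L * bool) j := (-1) ^+ l.2 * (r / 2 * v l.1 j).
have x2 l : \sum_j x l j ^+ 2 <= 4^-1.
  have -> : \sum_j x l j ^+ 2 = (r / 2) ^+ 2 * \sum_j v l.1 j ^+ 2.
    by rewrite mulr_sumr; apply: eq_bigr => j _; rewrite /x exprMn sqrr_sign mul1r exprMn.
  have rr : 0 <= (r / 2) ^+ 2 by exact: sqr_ge0.
  rewrite (le_trans (ler_wpM2l rr (vr _)))// expr_div_n mulrAC divff ?expf_neq0 ?gt_eqF//.
  by rewrite mul1r -natrX.
have xh l j : `|x l j| <= 2^-1.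
  rewrite -ler_sqr ?nnegrE// real_normK ?num_real// (le_trans _ (le_trans (x2 l) _))//.
    by rewrite (bigD1 j)//= lerDl sumr_ge0// => k _; exact: sqr_ge0.
  by rewrite exprVn -natrX.
have [eps heps] := small_products xh; exists eps => l.
have L0 : (0 < 2 * #|L|)%N by rewrite muln_gt0/=; apply/card_gt0P; exists l.
have key (s0 : bool) : (-1) ^+ s0 * \sum_j (-1) ^+ eps j * (r / 2 * v l j) <= ln (2 * #|L|)%:R + 1.
  have h : expR (\sum_j ((-1) ^+ eps j * x (l, s0) j - 2 * ((-1) ^+ eps j * x (l, s0) j) ^+ 2)) <= (2 * #|L|)%:R.
    rewrite expR_sum (le_trans _ (le_trans (heps (l, s0)) _))//.
      apply: ler_prod => j _; rewrite expR_ge0/= expR_le_1Dx//.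
      by rewrite normrM normr_sign mul1r.
    by rewrite card_prod card_bool mulnC.
  have h2 : \sum_j ((-1) ^+ eps j * x (l, s0) j - 2 * ((-1) ^+ eps j * x (l, s0) j) ^+ 2) <= ln (2 * #|L|)%:R.
    by rewrite -ler_expR lnK// posrE ltr0n.
  move: h2; rewrite sumrB -mulr_sumr.
  have -> : \sum_j ((-1) ^+ eps j * x (l, s0) j) ^+ 2 = \sum_j x (l, s0) j ^+ 2.
    by apply: eq_bigr => j _; rewrite exprMn sqrr_sign mul1r.
  have -> : \sum_j (-1) ^+ eps j * x (l, s0) j = (-1) ^+ s0 * \sum_j (-1) ^+ eps j * (r / 2 * v l j).
    by rewrite mulr_sumr; apply: eq_bigr => j _; rewrite /x mulrCA.
  by have := x2 (l, s0); lra.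
have sE : \sum_j (-1) ^+ eps j * (r / 2 * v l j) = r / 2 * \sum_j (-1) ^+ eps j * v l j.
  by rewrite mulr_sumr; apply: eq_bigr => j _; rewrite mulrCA.
rewrite -ler_pdivrMl ?divr_gt0// invf_div.
rewrite -[X in X * `|_|]ger0_norm ?divr_ge0 ?(ltW r0)// -normrM -sE ler_norml.
by have := key true; have := key false; rewrite expr0 expr1 => k1 k2; apply/andP; split; lra.
Qed.

End signs.

(** * Flat orthonormal bases *)

(** [2 ^ k], with the doubling visible to the types of block matrices. *)
Fixpoint dim (k : nat) : nat := if k is k'.+1 then dim k' + dim k' else 1.

Lemma dimE k : dim k = (2 ^ k)%N.
Proof. by elim: k => //= k ->; rewrite expnS mul2n addnn. Qed.

Lemma dim_gt0 k : (0 < dim k)%N.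
Proof. by rewrite dimE expn_gt0. Qed.

Section flat_bases.
Context {R : realType}.

Fixpoint hadamard k : 'M[R]_(dim k) :=
  match k with
  | 0 => 1%:M
  | k'.+1 => (Num.sqrt 2)^-1 *:
      block_mx (hadamard k') (hadamard k') (hadamard k') (- hadamard k')
  end.

Lemma sqrt2_neq0 : Num.sqrt 2 != 0 :> R.
Proof. by rewrite sqrtr_eq0 -ltNge ltr0n. Qed.

Lemma hadamard_orth k : (hadamard k)^T *m hadamard k = 1%:M.
Proof.
elim: k => [|k IH] /=; first by rewrite trmx1 mul1mx.
rewrite [X in X *m _]linearZ /= -scalemxAl -scalemxAr scalerA tr_block_mx mulmx_block [(- hadamard k)^T]linearN /=.
rewrite !mulmxN !mulNmx IH opprK subrr.
rewrite -invfM -expr2 sqr_sqrtr// -(raddfD (@scalar_mx R _)) /= -scalar_mx_block.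
by rewrite scale_scalar_mx mulVf.
Qed.

Lemma hadamard_entry k i j : `|hadamard k i j| <= (Num.sqrt 2 ^+ k)^-1.
Proof.
elim: k i j => [|k IH] i j /=; first by rewrite expr0 invr1 mxE ord1 [j]ord1 normr1.
rewrite mxE normrM exprS invfM ger0_norm ?invr_ge0 ?sqrtr_ge0// ler_wpM2l ?invr_ge0 ?sqrtr_ge0//.
case: (split_ordP i) => i' ->; case: (split_ordP j) => j' ->;
  by rewrite ?block_mxEul ?block_mxEur ?block_mxEdl ?block_mxEdr ?mxE ?normrN.
Qed.

(** The bound of [flat_signs] for at most [5 * dim k * dim k] sums. *)
Definition flatness k : R := 2 / Num.sqrt 2 ^+ k * (ln (10 * dim k * dim k)%:R + 1).

Lemma row_sqr k i : \sum_j hadamard k i j ^+ 2 = 1.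
Proof.
have /mulmx1C/matrixP/(_ i i) := hadamard_orth k.
rewrite !mxE eqxx => h; apply: (etrans _ h).
by apply: eq_bigr => j _; rewrite mxE expr2.
Qed.

(** The entries of [hadamard k] are at most [r^-1] in absolute value with
    [r = sqrt 2 ^ k], and this is what [flat_signs] asks for: the sums below are
    indexed by a row of [hadamard k] and either a row of [C] or one more row of
    [hadamard k] twisted by one of two given sign vectors. *)
Lemma next_signs k N (C : 'M[R]_(N, dim k)) (pv : bool -> 'I_(dim k) -> R) :
  (N <= 3 * dim k)%N -> (forall i, \sum_j C i j ^+ 2 <= 1) -> (forall b j, pv b j ^+ 2 = 1) ->
  exists e : 'I_(dim k) -> R, [/\ (forall j, e j ^+ 2 = 1),
    (forall i j, `|\sum_l hadamard k i l * e l * C j l| <= flatness k) &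
    (forall b i j, `|\sum_l hadamard k i l * e l * (hadamard k j l * pv b l)| <= flatness k)].
Proof.
move=> N3 C1 pv1; set n := dim k; pose r : R := Num.sqrt 2 ^+ k.
have r0 : 0 < r by rewrite exprn_gt0// sqrtr_gt0.
pose L := ('I_n * ('I_N + bool * 'I_n))%type.
pose v (l : L) (j : 'I_n) : R := hadamard k l.1 j *
  match l.2 with inl i => C i j | inr (b, i) => hadamard k i j * pv b j end.
have vr l : \sum_j v l j ^+ 2 <= r ^- 2.
  apply: (@le_trans _ _ (\sum_j r ^- 2 * (match l.2 with inl i => C i j | inr (b, i) => hadamard k i j * pv b j end) ^+ 2)).
    apply: ler_sum => j _; rewrite exprMn ler_wpM2r ?sqr_ge0//.
    rewrite -real_normK ?num_real// -exprVn ler_sqr ?nnegrE ?invr_ge0 ?(ltW r0)//.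
    exact: hadamard_entry.
  rewrite -mulr_sumr ler_piMr ?invr_ge0 ?sqr_ge0//; case: l => i [j|[b j]] /=; first exact: C1.
  by rewrite -(row_sqr j); apply: ler_sum => l _; rewrite exprMn pv1 mulr1.
have [eps heps] := flat_signs r0 vr.
have Lcard : (#|{: L}| <= 5 * n * n)%N.
  rewrite card_prod card_sum card_prod card_bool !card_ord mulnC leq_mul2r; apply/orP; right.
  by rewrite (_ : 5 = 3 + 2)%N// mulnDl leq_add2r.
have bound l : `|\sum_j (-1) ^+ eps j * v l j| <= flatness k.
  apply: (le_trans (heps l)); rewrite ler_wpM2l ?divr_ge0 ?(ltW r0)// lerD2r.
  have L1 : (0 < #|{: L}|)%N by apply/card_gt0P; exists l.
  rewrite ler_ln ?posrE ?ltr0n ?muln_gt0 ?dim_gt0 ?L1// ler_nat.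
  by rewrite -[10%N]/(2 * 5)%N -!mulnA leq_mul2l/= mulnA.
exists (fun j => (-1) ^+ eps j); split => [j|i j|b i j].
- by rewrite sqrr_sign.
- rewrite (eq_bigr (fun l => (-1) ^+ eps l * v (i, inl j) l)) ?bound// => l _.
  by rewrite /v /=; ring.
- rewrite (eq_bigr (fun l => (-1) ^+ eps l * v (i, inr (b, j)) l)) ?bound// => l _.
  by rewrite /v /=; ring.
Qed.

(** [Q a] is the Hadamard matrix with columns multiplied by signs. Each entry of
    [Q a *m (Q b)^T] is a signed sum in the signs of [Q b], so the three sign
    vectors are chosen one after the other, each flat against those before it. *)
Lemma flat_bases k N (C : 'M[R]_(N, dim k)) : (N <= 3 * dim k)%N ->
  (forall i, \sum_j C i j ^+ 2 <= 1) ->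
  exists Q : nat -> 'M[R]_(dim k), [/\ (forall a, (Q a)^T *m Q a = 1%:M),
    (forall a b i j, (a < b < 3)%N -> `|(Q a *m (Q b)^T) i j| <= flatness k) &
    (forall a i j, (a < 3)%N -> `|(Q a *m C^T) i j| <= flatness k)].
Proof.
move=> N3 C1.
have one1 (b : bool) (j : 'I_(dim k)) : (1 : R) ^+ 2 = 1 by rewrite expr1n.
have [e0 [e01 e0C _]] := next_signs N3 C1 one1.
have [e1 [e11 e1C e1H]] := @next_signs k N C (fun b => e0) N3 C1 (fun b => e01).
have [e2 [e21 e2C e2H]] := @next_signs k N C (fun b => if b then e0 else e1) N3 C1
  (fun b => if b as b' return forall j, (if b' then e0 else e1) j ^+ 2 = 1 then e01 else e11).
pose e a := if a is 0 then e0 else if a is 1 then e1 else e2.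
have esq a j : e a j ^+ 2 = 1 by case: a => [|[|a]].
exists (fun a => \matrix_(i, l) (hadamard k i l * e a l)); split => [a|a b i j ab|a i j a3].
- apply/matrixP => i j; rewrite !mxE.
  have /matrixP/(_ i j) := hadamard_orth k; rewrite !mxE => hE.
  transitivity (e a i * e a j * \sum_l (hadamard k)^T i l * hadamard k l j).
    by rewrite mulr_sumr; apply: eq_bigr => l _; rewrite !mxE; ring.
  by rewrite hE; case: eqP => [->|_]; rewrite ?mulr0// mulr1 -expr2.
- rewrite mxE (eq_bigr (fun l => hadamard k j l * e b l * (hadamard k i l * e a l))); last first.
    by move=> l _; rewrite !mxE mulrC.
  case: a b ab => [|[|[|a]]] [|[|[|b]]]; rewrite ?andbF//= => _; first exact: (e1H true).
    exact: (e2H true).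
  exact: (e2H false).
- rewrite mxE (eq_bigr (fun l => hadamard k i l * e a l * C j l)); last first.
    by move=> l _; rewrite !mxE.
  by case: a a3 => [|[|[|a]]].
Qed.

Lemma flatness_le : exists2 c0 : R, 0 < c0 & forall k, flatness k <= c0 * k.+1%:R / Num.sqrt 2 ^+ k.
Proof.
have l0 : 0 <= ln (10 : R) by rewrite ln_ge0// ler1n.
exists (2 * (ln 10 + 1)); first by rewrite mulr_gt0// ltr_wpDl.
move=> k; have r0 : 0 < Num.sqrt 2 ^+ k :> R by rewrite exprn_gt0// sqrtr_gt0.
have h : ln (10 * dim k * dim k)%:R <= ln (10 : R) *+ k.+1.
  rewrite -lnXn// ler_ln ?posrE ?exprn_gt0 ?ltr0n ?muln_gt0 ?dim_gt0//.
  rewrite -natrX ler_nat !dimE -mulnA -expnMn expnS leq_mul2l/=.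
  by elim: (k) => [//|m IH]; rewrite !expnS leq_mul.
rewrite /flatness mulrAC ler_pM2r ?invr_gt0// -mulrA ler_pM2l//.
by rewrite (le_trans (lerD h (lexx 1)))// [leRHS]mulrDl mul1r mulr_natr lerD2l ler1n.
Qed.

End flat_bases.

(** * A splitting of three copies of a space *)

Section blocks.
Context {R : realType} (n : nat) (Q : nat -> 'M[R]_n).
Hypothesis QQ : forall a, (Q a)^T *m Q a = 1%:M.

Let QQt a : Q a *m (Q a)^T = 1%:M. Proof. exact/mulmx1C. Qed.

(** Up to the orthogonal maps [Q a], the images of [Umx] and [Vmx] are the triples
    [(x, x, x)] and the triples [(x, y, - x - y)] of sum 0; [Uinv] and [Vinv] are
    the coordinates for this splitting. *)
Definition Umx : 'M[R]_(n + (n + n), n) := col_mx (Q 0) (col_mx (Q 1) (Q 2)).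
Definition Uinv : 'M[R]_(n, n + (n + n)) :=
  3^-1 *: row_mx (Q 0)^T (row_mx (Q 1)^T (Q 2)^T).
Definition Vmx : 'M[R]_(n + (n + n), n + n) :=
  col_mx (row_mx (Q 0) 0) (col_mx (row_mx 0 (Q 1)) (row_mx (- Q 2) (- Q 2))).
Definition Vinv : 'M[R]_(n + n, n + (n + n)) := 3^-1 *:
  col_mx (row_mx (2 *: (Q 0)^T) (row_mx (- (Q 1)^T) (- (Q 2)^T)))
         (row_mx (- (Q 0)^T) (row_mx (2 *: (Q 1)^T) (- (Q 2)^T))).

Lemma UinvU : Uinv *m Umx = 1%:M.
Proof.
rewrite -scalemxAl !mul_row_col !QQ -!(raddfD (@scalar_mx R _)) /= scale_scalar_mx.
by congr (_%:M); lra.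
Qed.

Lemma UinvV : Uinv *m Vmx = 0.
Proof.
rewrite -scalemxAl !mul_row_col !mul_mx_row !mulmxN !mulmx0 !QQ !add_row_mx.
by rewrite !add0r subrr row_mx0 scaler0.
Qed.

Lemma VinvU : Vinv *m Umx = 0.
Proof.
rewrite -scalemxAl mul_col_mx !mul_row_col -!scalemxAl !mulNmx !QQ.
rewrite scaler_nat mulr2n.
have -> : (1%:M + 1%:M + (- 1%:M - 1%:M) : 'M[R]_n) = 0 by rewrite -opprD subrr.
have -> : (- 1%:M + (1%:M + 1%:M - 1%:M) : 'M[R]_n) = 0 by rewrite addrK addNr.
by rewrite col_mx0 scaler0.
Qed.

Lemma VinvV : Vinv *m Vmx = 1%:M.
Proof.
rewrite -scalemxAl mul_col_mx !mul_row_col !mul_mx_row -!scalemxAl !mulNmx !mulmxN !mulmx0 !QQ.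
rewrite !add_row_mx ?oppr0 ?opprK ?scaler0 !add0r addNr scale_scalar_mx mulr1.
have -> : (2%:M + 1%:M : 'M[R]_n) = 3%:M.
  by rewrite -(raddfD (@scalar_mx R _)) /=; congr (_%:M); ring.
by rewrite -block_mxEv -scalar_mx_block scale_scalar_mx mulVf.
Qed.

Lemma VVinv_UUinv : Vmx *m Vinv + Umx *m Uinv = 1%:M.
Proof.
have /mulmx1C : col_mx Uinv Vinv *m row_mx Umx Vmx = 1%:M.
  by rewrite mul_col_row VinvV VinvU UinvV UinvU -scalar_mx_block.
by rewrite mul_row_col addrC.
Qed.

(** The blocks of [3 *: (Umx *m Uinv)] are the [Q a *m (Q b)^T]. Those on the
    diagonal are identities, which the subtraction removes. *)
Lemma UUinv_entry (F : R) : 0 <= F ->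
  (forall a b i j, (a < b < 3)%N -> `|(Q a *m (Q b)^T) i j| <= F) ->
  forall i j, `|(1%:M - 3 *: (Umx *m Uinv)) i j| <= F.
Proof.
move=> F0 QF.
have QF' a b i j : (a < b < 3)%N -> `|(Q b *m (Q a)^T) i j| <= F.
  move=> ab; have -> : Q b *m (Q a)^T = (Q a *m (Q b)^T)^T by rewrite trmx_mul trmxK.
  by rewrite mxE; exact: QF.
have -> : 3 *: (Umx *m Uinv) = Umx *m row_mx (Q 0)^T (row_mx (Q 1)^T (Q 2)^T).
  by rewrite -scalemxAr scalerA divff// scale1r.
rewrite /Umx !mul_col_mx !mul_mx_row !QQt.
have entry (M : 'M[R]_(n + (n + n))) i j : (1%:M - M) i j = (i == j)%:R - M i j by rewrite !mxE.
have diag (x y : 'I_n) : (x == y)%:R - (1%:M : 'M[R]_n) x y = 0 by rewrite mxE subrr.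
have f0 : (false%:R : R) = 0 by [].
move=> i j; rewrite entry.
case: (split_ordP i) => i1 ->; case: (split_ordP j) => j1 ->;
  rewrite ?col_mxEu ?col_mxEd ?row_mxEl ?row_mxEr
    ?(inj_eq (@lshift_inj _ _)) ?(inj_eq (@rshift_inj _ _)) ?eq_lrshift ?eq_rlshift.
- by rewrite diag normr0.
- case: (split_ordP j1) => j2 ->; rewrite ?row_mxEl ?row_mxEr ?f0 sub0r normrN; exact: QF.
- case: (split_ordP i1) => i2 ->; rewrite ?col_mxEu ?col_mxEd ?row_mxEl ?f0 sub0r normrN; exact: QF'.
case: (split_ordP i1) => i2 ->; case: (split_ordP j1) => j2 ->;
  rewrite ?col_mxEu ?col_mxEd row_mxEr ?row_mxEl ?row_mxEr
    ?(inj_eq (@lshift_inj _ _)) ?(inj_eq (@rshift_inj _ _)) ?eq_lrshift ?eq_rlshift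
    ?diag ?normr0// f0 sub0r normrN; [exact: QF|exact: QF'].
Qed.

Lemma row_sqr1 a i : \sum_j Q a i j ^+ 2 = 1.
Proof.
have /matrixP/(_ i i) := QQt a; rewrite !mxE eqxx => h; apply: (etrans _ h).
by apply: eq_bigr => j _; rewrite mxE expr2.
Qed.

(** The rows against which the bases of the next level have to be flat. Rows of
    [Vmx] have norm up to [sqrt 2]; the factor [2^-1] makes them at most 1. *)
Definition next_rows : 'M[R]_(n + (n + n) + (n + (n + n)), n + n) :=
  col_mx (2^-1 *: Vmx) Vinv^T.

Lemma next_rows_sqr i : \sum_j next_rows i j ^+ 2 <= 1.
Proof.
have half (f : 'I_(n + n) -> R) : \sum_j f j = \sum_j f (lshift n j) + \sum_j f (rshift n j).
  exact: big_split_ord.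
rewrite half /next_rows.
have V3 j k : Vinv j k = 3^-1 * (col_mx (row_mx (2 *: (Q 0)^T) (row_mx (- (Q 1)^T) (- (Q 2)^T)))
         (row_mx (- (Q 0)^T) (row_mx (2 *: (Q 1)^T) (- (Q 2)^T)))) j k by rewrite mxE.
have S (c : R) a k : \sum_j (c * Q a k j) ^+ 2 = c ^+ 2.
  by under eq_bigr do rewrite exprMn; rewrite -mulr_sumr row_sqr1 mulr1.
have two (c e : R) a k f g : c ^+ 2 + e ^+ 2 <= 1 ->
    (forall j : 'I_n, f j = c * Q a k j) -> (forall j, g j = e * Q a k j) ->
    \sum_j f j ^+ 2 + \sum_j g j ^+ 2 <= 1.
  move=> ce fE gE; rewrite (eq_bigr (fun j => (c * Q a k j) ^+ 2)); last by move=> j _; rewrite fE.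
  by rewrite [X in _ + X](eq_bigr (fun j => (e * Q a k j) ^+ 2)) ?S// => j _; rewrite gE.
case: (split_ordP i) => i1 ->.
  case: (split_ordP i1) => i2 ->; [|case: (split_ordP i2) => i3 ->].
  - apply: (@two 2^-1 0 0%N i2); first lra.
      by move=> j; rewrite col_mxEu mxE col_mxEu row_mxEl.
    by move=> j; rewrite col_mxEu mxE col_mxEu row_mxEr mxE mulr0 mul0r.
  - apply: (@two 0 2^-1 1%N i3); first lra.
      by move=> j; rewrite col_mxEu mxE col_mxEd col_mxEu row_mxEl mxE mulr0 mul0r.
    by move=> j; rewrite col_mxEu mxE col_mxEd col_mxEu row_mxEr.
  - apply: (@two (- 2^-1) (- 2^-1) 2%N i3); first lra.
      by move=> j; rewrite col_mxEu mxE col_mxEd col_mxEd row_mxEl mxE mulrN mulNr.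
    by move=> j; rewrite col_mxEu mxE col_mxEd col_mxEd row_mxEr mxE mulrN mulNr.
case: (split_ordP i1) => i2 ->; [|case: (split_ordP i2) => i3 ->].
- apply: (@two (3^-1 * 2) (- 3^-1) 0%N i2); first lra.
    by move=> j; rewrite col_mxEd mxE V3 col_mxEu row_mxEl !mxE mulrA.
  by move=> j; rewrite col_mxEd mxE V3 col_mxEd row_mxEl !mxE mulrN mulNr.
- apply: (@two (- 3^-1) (3^-1 * 2) 1%N i3); first lra.
    by move=> j; rewrite col_mxEd mxE V3 col_mxEu row_mxEr row_mxEl !mxE mulrN mulNr.
  by move=> j; rewrite col_mxEd mxE V3 col_mxEd row_mxEr row_mxEl !mxE mulrA.
- apply: (@two (- 3^-1) (- 3^-1) 2%N i3); first lra.
    by move=> j; rewrite col_mxEd mxE V3 col_mxEu row_mxEr row_mxEr !mxE mulrN mulNr.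
  by move=> j; rewrite col_mxEd mxE V3 col_mxEd row_mxEr row_mxEr !mxE mulrN mulNr.
Qed.

End blocks.

(** * The sequence of bases *)

Section bases_sequence.
Context {R : realType}.

(** A sigma type, since the bases of a level are chosen in terms of those of the
    preceding one. *)
Definition orth_bases k := {Q : nat -> 'M[R]_(dim k) | forall a, (Q a)^T *m Q a = 1%:M}.

Lemma next_bases k (Q : orth_bases k) : {Q' : orth_bases k.+1 |
  (forall a b i j, (a < b < 3)%N -> `|(sval Q' a *m (sval Q' b)^T) i j| <= flatness k.+1) /\
  (forall a i j, (a < 3)%N ->
     `|(sval Q' a *m (next_rows (sval Q))^T) i j| <= flatness k.+1)}.
Proof.
apply: cid; have N3 : (dim k + (dim k + dim k) + (dim k + (dim k + dim k)) <= 3 * dim k.+1)%N.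
  by rewrite /=; lia.
have [Q' [Q'1 Q'2 Q'3]] := @flat_bases R k.+1 _ (next_rows (sval Q)) N3 (next_rows_sqr (svalP Q)).
by exists (exist _ Q' Q'1).
Qed.

Lemma id_orth : forall a : nat, (1%:M : 'M[R]_(dim 0))^T *m 1%:M = 1%:M.
Proof. by move=> _; rewrite trmx1 mul1mx. Qed.

Fixpoint bases k : orth_bases k :=
  match k with
  | 0 => exist _ (fun=> 1%:M) id_orth
  | k'.+1 => sval (next_bases (bases k'))
  end.

Definition lsize k := (dim k + (dim k + dim k))%N.
Definition Ulev k : 'M[R]_(lsize k, dim k) := Umx (sval (bases k)).
Definition Ulev_inv k : 'M[R]_(dim k, lsize k) := Uinv (sval (bases k)).
Definition Vlev k : 'M[R]_(lsize k, dim k.+1) := Vmx (sval (bases k)).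
Definition Vlev_inv k : 'M[R]_(dim k.+1, lsize k) := Vinv (sval (bases k)).

Lemma flatness_gt0 k : 0 < flatness k :> R.
Proof.
have r0 : 0 < Num.sqrt 2 ^+ k :> R by rewrite exprn_gt0// sqrtr_gt0.
rewrite mulr_gt0 ?divr_gt0// ltr_wpDl// ln_ge0// ler1n !muln_gt0 !dim_gt0//.
Qed.

Lemma flat_UU k i j : `|(1%:M - 3 *: (Ulev k *m Ulev_inv k)) i j| <= flatness k.
Proof.
apply: (UUinv_entry (svalP (bases k)) (ltW (flatness_gt0 k))) => a b {i j} i j ab.
case: k i j => [|k] i j; last by have [h _] := svalP (next_bases (bases k)); exact: h.
(* On level 0 all bases are trivial, and the flatness exceeds 1. *)
rewrite /= trmx1 mul1mx mxE (@le_trans _ _ 1)//; first by case: (i == j); rewrite ?normr1 ?normr0.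
rewrite /flatness expr0 divr1 mulrDr mulr1 /=.
have : 0 <= ln (10 * 1 * 1)%:R :> R by rewrite ln_ge0// ler1n.
lra.
Qed.

Lemma flat_rows k a i j : (a < 3)%N ->
  `|(sval (bases k.+1) a *m (next_rows (sval (bases k)))^T) i j| <= flatness k.+1.
Proof. by have [_ h] := svalP (next_bases (bases k)); exact: h. Qed.

Lemma flat_QV k a i j : (a < 3)%N -> `|(sval (bases k.+1) a *m (Vlev k)^T) i j| <= 2 * flatness k.+1.
Proof.
move=> a3; have := flat_rows i (lshift _ j) a3.
rewrite /next_rows tr_col_mx mul_mx_row row_mxEl linearZ /= -scalemxAr mxE normrM.
by rewrite ger0_norm ?invr_ge0// ler_pdivrMl.
Qed.

Lemma flat_QV' k a i j : (a < 3)%N -> `|(sval (bases k.+1) a *m Vlev_inv k) i j| <= flatness k.+1.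
Proof.
move=> a3; have := flat_rows i (rshift _ j) a3.
by rewrite /next_rows tr_col_mx mul_mx_row row_mxEr trmxK.
Qed.

Lemma flat_VU' k i j : `|(Vlev k *m Ulev_inv k.+1) i j| <= flatness k.+1.
Proof.
have F0 := flatness_gt0 k.+1.
have h a x y : (a < 3)%N -> `|3^-1 * (Vlev k *m (sval (bases k.+1) a)^T) x y| <= flatness k.+1.
  move=> a3.
  have -> : Vlev k *m (sval (bases k.+1) a)^T = (sval (bases k.+1) a *m (Vlev k)^T)^T.
    by rewrite trmx_mul trmxK.
  rewrite mxE normrM (ger0_norm (x := 3^-1))//.
  rewrite ler_pdivrMl//; apply: le_trans (flat_QV y x a3) _.
  by rewrite ler_wpM2r ?(ltW F0)// ler_nat.
rewrite -scalemxAr mxE !mul_mx_row.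
case: (split_ordP j) => j1 ->; rewrite ?row_mxEl ?row_mxEr ?h//.
by case: (split_ordP j1) => j2 ->; rewrite ?row_mxEl ?row_mxEr ?h.
Qed.

Lemma flat_UV' k i j : `|(Ulev k.+1 *m Vlev_inv k) i j| <= flatness k.+1.
Proof.
rewrite /Ulev /Umx !mul_col_mx.
case: (split_ordP i) => i1 ->; rewrite ?col_mxEu ?col_mxEd ?flat_QV'//.
by case: (split_ordP i1) => i2 ->; rewrite ?col_mxEu ?col_mxEd ?flat_QV'.
Qed.

End bases_sequence.

(** * The traceful matrix of square zero *)

Section flattening.
Context {R : realType}.

Definition offset k := (\sum_(j < k) lsize j)%N.

Lemma offsetS k : offset k.+1 = (offset k + lsize k)%N. Proof. exact: big_ord_recr. Qed.

Lemma leq_offset k l : (k <= l)%N -> (offset k <= offset l)%N.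
Proof.
elim: l => [|l IH]; first by rewrite leqn0 => /eqP ->.
by rewrite leq_eqVlt => /predU1P[->//|/IH h]; rewrite offsetS (leq_trans h)// leq_addr.
Qed.

Lemma lsize_gt0 k : (0 < lsize k)%N. Proof. by rewrite addn_gt0 dim_gt0. Qed.

Lemma leq_id_offset k : (k <= offset k)%N.
Proof. by elim: k => // k IH; rewrite offsetS -addn1 leq_add ?lsize_gt0. Qed.

Lemma ex_level g : exists k, (g < offset k.+1)%N.
Proof. by exists g; exact: leq_id_offset. Qed.

Definition level g := ex_minn (ex_level g).

Lemma levelP g : (offset (level g) <= g < offset (level g).+1)%N.
Proof.
rewrite /level; case: ex_minnP => -[h _|k h min]; rewrite h andbT.
  by rewrite /offset big_ord0.
by rewrite leqNgt; apply/negP => /min; rewrite ltnn.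
Qed.

Lemma level_le g : (level g <= g)%N.
Proof. by have /andP[h _] := levelP g; exact: leq_trans (leq_id_offset _) h. Qed.

Lemma level_eq g k : (offset k <= g < offset k.+1)%N -> level g = k.
Proof.
move=> /andP[kg gk]; have /andP[lg gl] := levelP g.
apply/eqP; rewrite eqn_leq; apply/andP; split; rewrite leqNgt; apply/negP => h.
  by have := leq_trans gk (leq_trans (leq_offset h) lg); rewrite ltnn.
by have := leq_trans gl (leq_trans (leq_offset h) kg); rewrite ltnn.
Qed.

Lemma level_add k (r : 'I_(lsize k)) : level (offset k + r) = k.
Proof. by apply: level_eq; rewrite leq_addr offsetS ltn_add2l ltn_ord. Qed.

Lemma level_decomp g : exists r : 'I_(lsize (level g)), g = (offset (level g) + r)%N.
Proof.
have /andP[h1 h2] := levelP g.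
have h : (g - offset (level g) < lsize (level g))%N by rewrite ltn_subLR// -offsetS.
by exists (Ordinal h); rewrite /= subnKC.
Qed.

(** Lets the rows of a block be indexed by natural numbers, so that blocks of
    different levels can be added. *)
Definition lrows k n (P : 'M[R]_(lsize k, n)) (g : nat) (i : 'I_n) : R :=
  if (offset k <= g)%N then (if insub (g - offset k)%N is Some r then P r i else 0) else 0.

Lemma lrows_in k n (P : 'M[R]_(lsize k, n)) (r : 'I_(lsize k)) i : lrows P (offset k + r) i = P r i.
Proof. by rewrite /lrows leq_addr addKn valK. Qed.

Lemma lrows_out k n (P : 'M[R]_(lsize k, n)) g i : level g != k -> lrows P g i = 0.
Proof.
move=> gk; rewrite /lrows; case: leqP => // kg; case: insubP => // r rD rE.
move/negP: gk; case; apply/eqP/level_eq; rewrite kg offsetS.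
by rewrite -(subnKC kg) ltn_add2l.
Qed.

Lemma lrows_le k n (P : 'M[R]_(lsize k, n)) g i (F : R) : 0 <= F ->
  (forall r, `|P r i| <= F) -> `|lrows P g i| <= F.
Proof.
move=> F0 PF; rewrite /lrows; case: ifP => _; rewrite ?normr0//.
by case: insubP => [r _ _|_]; rewrite ?normr0.
Qed.

Lemma lrows_disj k k' n n' (P : 'M[R]_(lsize k, n)) (P' : 'M[R]_(lsize k', n')) g i j :
  k != k' -> lrows P g i * lrows P' g j = 0.
Proof.
move=> kk'; have [gk|gk] := eqVneq (level g) k; last by rewrite lrows_out// mul0r.
by rewrite [X in _ * X]lrows_out ?mulr0// gk.
Qed.

Lemma sum_level k (F : nat -> R) N : (forall g, level g != k -> F g = 0) ->
  (offset k.+1 <= N)%N -> \sum_(g < N) F g = \sum_(r < lsize k) F (offset k + r)%N.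
Proof.
move=> F0 kN.
rewrite -(big_mkord xpredT F) (@big_cat_nat _ _ _ (offset k.+1))//=.
rewrite [X in _ + X]big_nat_cond [X in _ + X]big1 ?addr0; last first.
  move=> g /andP[/andP[kg _] _]; apply: F0; apply/eqP => gk.
  by have /andP[_] := levelP g; rewrite gk ltnNge kg.
rewrite (@big_cat_nat _ _ _ (offset k))//=; last by rewrite leq_offset.
rewrite big_nat_cond big1 ?add0r; last first.
  move=> g /andP[/andP[_ kg] _]; apply: F0; apply/eqP => gk.
  by have /andP[] := levelP g; rewrite gk leqNgt kg.
rewrite -{1}[offset k]add0n big_addn offsetS addKn big_mkord.
by apply: eq_bigr => r _; rewrite addnC.
Qed.

Lemma lrows_sum k n n' (P : 'M[R]_(lsize k, n)) (P' : 'M[R]_(lsize k, n')) N i j :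
  (offset k.+1 <= N)%N -> \sum_(g < N) lrows P g i * lrows P' g j = (P^T *m P') i j.
Proof.
move=> kN; rewrite (@sum_level k (fun g => lrows P g i * lrows P' g j))//; last first.
  by move=> g gk; rewrite lrows_out// mul0r.
by rewrite mxE; apply: eq_bigr => r _; rewrite !lrows_in mxE.
Qed.

Lemma lrows_sum0 k k' n n' (P : 'M[R]_(lsize k, n)) (P' : 'M[R]_(lsize k', n')) N i j :
  k != k' -> \sum_(g < N) lrows P g i * lrows P' g j = 0.
Proof. by move=> kk'; rewrite big1// => g _; exact: lrows_disj. Qed.

Lemma lrows_sum_low k n n' (P : 'M[R]_(lsize k, n)) (P' : 'M[R]_(lsize k, n')) N i j :
  (N <= offset k)%N -> \sum_(g < N) lrows P g i * lrows P' g j = 0.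
Proof.
move=> Nk; rewrite big1// => g _; rewrite [X in X * _]lrows_out ?mul0r//.
apply/eqP => gk; have /andP[h _] := levelP g.
by have := leq_trans (ltn_ord g) (leq_trans Nk _); rewrite -gk => /(_ _ h); rewrite ltnn.
Qed.

Lemma lrows_mul k n n' (P : 'M[R]_(n', n)) (P' : 'M[R]_(n, lsize k)) r h :
  \sum_i P r i * lrows P'^T h i = lrows (P *m P')^T h r.
Proof.
rewrite /lrows; case: ifP => _; last by rewrite big1// => i _; rewrite mulr0.
case: insubP => [q _ _|_]; last by rewrite big1// => i _; rewrite mulr0.
by rewrite !mxE; apply: eq_bigr => i _; rewrite mxE.
Qed.

(** The factors Z_k and W_k of the k-th term of the matrix. Each lives on the
    levels [k] and [k.+1]; the sign in Z_k is what makes W_k Z_k vanish. *)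
Definition zcol k g i : R := lrows (Vlev k) g i - lrows (Ulev k.+1) g i.
Definition wrow k g i : R := lrows (Vlev_inv k)^T g i + lrows (Ulev_inv k.+1)^T g i.

Arguments zcol : clear implicits.
Arguments wrow : clear implicits.

Lemma zcol0 k g i : (g < k)%N -> zcol k g i = 0.
Proof.
move=> gk; have lk := leq_ltn_trans (level_le g) gk.
by rewrite /zcol !lrows_out ?subrr// neq_ltn ?lk// (ltn_trans lk).
Qed.

Lemma wrow0 k g i : (g < k)%N -> wrow k g i = 0.
Proof.
move=> gk; have lk := leq_ltn_trans (level_le g) gk.
by rewrite /wrow !lrows_out ?addr0// neq_ltn ?lk// (ltn_trans lk).
Qed.

Lemma zcol_high k g i : (offset k.+2 <= g)%N -> zcol k g i = 0.
Proof.
move=> kg; have lk : (k.+1 < level g)%N.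
  rewrite ltnNge; apply/negP => h; have /andP[_ gl] := levelP g.
  by have := leq_trans gl (leq_offset (leq_ltn_trans h (ltnSn _))); rewrite ltnNge kg.
by rewrite /zcol !lrows_out ?subrr// neq_ltn ?lk ?orbT// (ltnW lk) orbT.
Qed.

(** W_k Z_k is 1 on level [k] and -1 on level [k.+1]. For neighbouring indices
    the one common level contributes [UinvV] or [VinvU], and other pairs of
    indices have no common level. *)
Lemma wz_orth k k' i j N : (offset k'.+2 <= N)%N -> \sum_(g < N) wrow k g i * zcol k' g j = 0.
Proof.
move=> kN; have kN1 : (offset k'.+1 <= N)%N by rewrite (leq_trans (leq_offset (leqnSn _))).
have -> : \sum_(g < N) wrow k g i * zcol k' g j =
    (\sum_(g < N) lrows (Vlev_inv k)^T g i * lrows (Vlev k') g j + \sum_(g < N) lrows (Ulev_inv k.+1)^T g i * lrows (Vlev k') g j)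
    - (\sum_(g < N) lrows (Vlev_inv k)^T g i * lrows (Ulev k'.+1) g j + \sum_(g < N) lrows (Ulev_inv k.+1)^T g i * lrows (Ulev k'.+1) g j).
  rewrite -!big_split -sumrB; apply: eq_bigr => g _ /=; rewrite /wrow /zcol; ring.
have [kk'|kk'] := eqVneq k k'.
  subst k'; rewrite lrows_sum// trmxK (lrows_sum0 (k := k.+1) (k' := k)) ?addr0; last by rewrite neq_ltn ltnSn orbT.
  rewrite (lrows_sum0 (k := k) (k' := k.+1)) ?add0r; last by rewrite neq_ltn ltnSn.
  by rewrite lrows_sum// trmxK /Vlev_inv /Vlev /Ulev_inv /Ulev (VinvV (svalP (bases k))) (UinvU (svalP (bases k.+1))) subrr.
rewrite (lrows_sum0 (k := k) (k' := k'))// add0r.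
rewrite (lrows_sum0 (k := k.+1) (k' := k'.+1)) ?eqSS// addr0.
have -> : \sum_(g < N) lrows (Ulev_inv k.+1)^T g i * lrows (Vlev k') g j = 0.
  have [e|ne] := eqVneq k.+1 k'; last exact: lrows_sum0.
  by subst k'; rewrite lrows_sum// trmxK /Ulev_inv /Vlev (UinvV (svalP (bases k.+1))) mxE.
have [e|ne] := eqVneq k k'.+1; last by rewrite lrows_sum0// subrr.
by subst k; rewrite lrows_sum// trmxK /Vlev_inv /Ulev (VinvU (svalP (bases k'.+1))) mxE subrr.
Qed.

Definition block_coef k : R := (dim k.+1)%:R^-1.

Lemma block_coefS k : block_coef k = 2 * block_coef k.+1.
Proof.
rewrite /block_coef.
have -> : (dim k.+2)%:R = (dim k.+1)%:R + (dim k.+1)%:R :> R by rewrite -natrD.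
set d : R := (dim k.+1)%:R.
have -> : d + d = 2 * d by ring.
by rewrite invfM mulrA divff ?pnatr_eq0// mul1r.
Qed.

Lemma block_coef_gt0 k : 0 < block_coef k.
Proof. by rewrite invr_gt0 ltr0n dim_gt0. Qed.

(** The sum is over all [k], but Z_k vanishes at [g] for [k > g], since level
    [k] starts at [k] or later. *)
Definition traceful_matrix g h : R := \sum_(k < g.+1) block_coef k * \sum_i zcol k g i * wrow k h i.

(** Z_k vanishes at [g] for [k > g], and W_k at [h] for [k > h]. *)
Lemma traceful_matrixE B g h : (g < B)%N || (h < B)%N ->
  traceful_matrix g h = \sum_(k < B) block_coef k * \sum_i zcol k g i * wrow k h i.
Proof.
pose F k := block_coef k * \sum_i zcol k g i * wrow k h i.
have Fg k : (g < k)%N || (h < k)%N -> F k = 0.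
  move=> /orP[gk|hk]; rewrite /F big1 ?mulr0// => i _.
    by rewrite zcol0// mul0r.
  by rewrite wrow0// mulr0.
move=> gB; rewrite /traceful_matrix -(big_mkord xpredT F) -(big_mkord xpredT F).
have cut N1 N2 : (N1 <= N2)%N -> (forall k, (N1 <= k)%N -> F k = 0) ->
    \sum_(0 <= k < N2) F k = \sum_(0 <= k < N1) F k.
  move=> N12 h0; rewrite (@big_cat_nat _ _ _ N1)//= [X in _ + X]big_nat_cond [X in _ + X]big1 ?addr0//.
  by move=> k /andP[/andP[k1 _] _]; exact: h0.
have g1 k : (g.+1 <= k)%N -> F k = 0 by move=> gk; apply: Fg; rewrite gk.
case/orP: gB => [gB|hB].
  by rewrite (cut g.+1 B).
have h1 k : (h.+1 <= k)%N -> F k = 0 by move=> hk; apply: Fg; rewrite hk orbT.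
have [gh|hg] := leqP g h.
  rewrite -(cut g.+1 h.+1)// (cut h.+1 B)//.
rewrite (cut h.+1 g.+1)//; last exact: ltnW.
by rewrite (cut h.+1 B).
Qed.

(** Column [m] meets only the Z_k with [k <= m], which end with level [m.+1]. *)
Definition col_bound m := offset m.+2.

Lemma traceful_matrix_col g h : (col_bound h <= g)%N -> traceful_matrix g h = 0.
Proof.
move=> hg; rewrite (@traceful_matrixE h.+1) ?ltnSn ?orbT// big1// => k _.
rewrite big1 ?mulr0// => i _; rewrite zcol_high ?mul0r//.
by rewrite (leq_trans _ hg)// leq_offset// ltnS.
Qed.

Lemma traceful_matrix_sq g h : \sum_(l < col_bound h) traceful_matrix g l * traceful_matrix l h = 0.
Proof.
pose T (k k' : nat) i j l := block_coef k * block_coef k' * zcol k g i * wrow k' h j * (wrow k l i * zcol k' l j).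
have E (l : 'I_(col_bound h)) : traceful_matrix g l * traceful_matrix l h = \sum_(k < g.+1) \sum_(k' < h.+1) \sum_i \sum_j T k k' i j l.
  rewrite (@traceful_matrixE g.+1 g l) ?ltnSn// (@traceful_matrixE h.+1 l h) ?ltnSn ?orbT// big_distrlr /=.
  apply: eq_bigr => k _; apply: eq_bigr => k' _; rewrite mulrACA big_distrlr /= mulr_sumr.
  apply: eq_bigr => i _; rewrite mulr_sumr; apply: eq_bigr => j _; rewrite /T; ring.
rewrite (eq_bigr _ (fun l _ => E l)).
rewrite exchange_big big1// => k _; rewrite exchange_big big1// => k' _.
rewrite exchange_big big1// => i _; rewrite exchange_big big1// => j _.
rewrite -mulr_sumr wz_orth ?mulr0//.
by rewrite leq_offset// ltnS.
Qed.

(** The term of index [k] has trace 1 on level [k] and -1 on level [k.+1], so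
    before level [K] only the one with [k.+1 = K] is left unbalanced. *)
Lemma traceful_matrix_trace K : (0 < K)%N -> \sum_(g < offset K) traceful_matrix g g = 1.
Proof.
case: K => // K _.
have E (g : 'I_(offset K.+1)) : traceful_matrix g g = \sum_(k < offset K.+1) block_coef k * \sum_i zcol k g i * wrow k g i.
  by rewrite (@traceful_matrixE (offset K.+1))// ltn_ord.
rewrite (eq_bigr _ (fun g _ => E g)) exchange_big /=.
have S (k : nat) : \sum_(g < offset K.+1) block_coef k * \sum_i zcol k g i * wrow k g i = (k == K)%:R.
  rewrite -mulr_sumr exchange_big /=.
  have zw (i : 'I_(dim k.+1)) : \sum_(g < offset K.+1) zcol k g i * wrow k g i =
      \sum_(g < offset K.+1) lrows (Vlev_inv k)^T g i * lrows (Vlev k) g i -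
      \sum_(g < offset K.+1) lrows (Ulev_inv k.+1)^T g i * lrows (Ulev k.+1) g i.
    rewrite -sumrB; apply: eq_bigr => g _; rewrite /zcol /wrow.
    have d1 : lrows (Vlev k) g i * lrows (Ulev_inv k.+1)^T g i = 0 by rewrite lrows_disj// neq_ltn ltnSn.
    have d2 : lrows (Ulev k.+1) g i * lrows (Vlev_inv k)^T g i = 0 by rewrite lrows_disj// neq_ltn ltnSn orbT.
    rewrite mulrBl !mulrDr d1 d2; ring.
  rewrite (eq_bigr _ (fun i _ => zw i)).
  have VV (i : 'I_(dim k.+1)) : (offset k.+1 <= offset K.+1)%N ->
     \sum_(g < offset K.+1) lrows (Vlev_inv k)^T g i * lrows (Vlev k) g i = 1.
    by move=> h; rewrite lrows_sum// trmxK /Vlev_inv /Vlev (VinvV (svalP (bases k))) mxE eqxx.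
  have UU (i : 'I_(dim k.+1)) : (offset k.+2 <= offset K.+1)%N ->
     \sum_(g < offset K.+1) lrows (Ulev_inv k.+1)^T g i * lrows (Ulev k.+1) g i = 1.
    by move=> h; rewrite lrows_sum// trmxK /Ulev_inv /Ulev (UinvU (svalP (bases k.+1))) mxE eqxx.
  case: (ltngtP k K) => kK.
  - rewrite big1 ?mulr0// => i _; rewrite VV ?UU ?subrr//; rewrite leq_offset//.
    by rewrite (leq_trans kK).
  - rewrite big1 ?mulr0// => i _; rewrite !lrows_sum_low ?subrr// leq_offset//.
    by rewrite (leq_trans kK).
  - subst k; rewrite (eq_bigr (fun=> 1)); last first.
      by move=> i _; rewrite VV// lrows_sum_low ?subr0.
    by rewrite sumr_const card_ord /block_coef mulVf// pnatr_eq0 -lt0n dim_gt0.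
rewrite (eq_bigr (fun k : 'I_(offset K.+1) => ((k : nat) == K)%:R)); last by move=> k _; exact: S.
have KM : (K < offset K.+1)%N by exact: leq_id_offset.
rewrite (bigD1 (Ordinal KM))//= eqxx big1 ?addr0// => k kK.
by rewrite (_ : (k == K :> nat) = false)//; apply: contraNF kK => /eqP kK; exact/eqP/val_inj.
Qed.

Lemma VV'E k : Vlev k *m Vlev_inv k = 1%:M - Ulev k *m Ulev_inv k :> 'M[R]_(lsize k).
Proof.
have E : Vlev k *m Vlev_inv k + Ulev k *m Ulev_inv k = 1%:M :> 'M[R]_(lsize k) := VVinv_UUinv (svalP (bases k)).
by rewrite -E addrK.
Qed.

(** A row on level [l] meets the terms of index [l] and [l - 1], the second with
    twice the weight of the first. Within the level they contribute V_l V_l^-1 and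
    - 2 U_l U_l^-1, that is 1 - 3 U_l U_l^-1 together, which is flat. Towards the
    next and the preceding level they contribute V_l U_(l+1)^-1 and
    - 2 U_l V_(l-1)^-1, flat because the bases of a level are flat against V_k and
    V_k^-1 for the level k before. Level 0 lacks the second term, but there the
    flatness is at least 1 and a crude bound suffices. *)
Lemma traceful_matrix_le g h : `|traceful_matrix g h| <=
  block_coef (level g) * (3 * flatness (level g) + flatness (level g).+1).
Proof.
have [r gE] := level_decomp g; set k := level g in r gE *; rewrite gE {gE}.
have zk (j : nat) (i : 'I_(dim j.+1)) : j != k -> j.+1 != k -> zcol j (offset k + r) i = 0.
  by move=> jk jk1; rewrite /zcol !lrows_out ?subrr// level_add eq_sym.
have zV i : zcol k (offset k + r) i = Vlev k r i.
  rewrite /zcol lrows_in lrows_out ?subr0//.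
  by rewrite level_add neq_ltn ltnSn.
have F0 j := flatness_gt0 (R := R) j.
have kB : (k < (offset k + r).+1)%N by rewrite ltnS (leq_trans (leq_id_offset k))// leq_addr.
rewrite /traceful_matrix (bigD1 (Ordinal kB))//=.
have VW : \sum_i zcol k (offset k + r) i * wrow k h i =
    lrows (Vlev k *m Vlev_inv k)^T h r + lrows (Vlev k *m Ulev_inv k.+1)^T h r.
  rewrite -!lrows_mul -big_split; apply: eq_bigr => i _ /=.
  by rewrite zV /wrow mulrDr.
rewrite VW.
have VU : `|lrows (Vlev k *m Ulev_inv k.+1)^T h r| <= flatness k.+1.
  by apply: lrows_le => [|q]; [exact: ltW|rewrite mxE flat_VU'].
have VVE := VV'E k.
case: k r VU VVE zV zk VW kB => [|k] r VU VVE zV zk VW kB.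
  rewrite big1 ?addr0; last first.
    move=> j jk; have j0 : (j : nat) != 0%N.
      by apply: contraNneq jk => j0; apply/eqP/val_inj.
    by rewrite big1 ?mulr0// => i _; rewrite zk ?mul0r.
  rewrite normrM ger0_norm ?(ltW (block_coef_gt0 _))// ler_wpM2l ?(ltW (block_coef_gt0 _))//.
  rewrite (le_trans (ler_normD _ _))// lerD//.
  apply: lrows_le => [|q]; first by rewrite mulr_ge0 ?(ltW (F0 _)).
  rewrite mxE VVE; have := @flat_UU R 0 r q.
  have f1 : 1 <= flatness 0 :> R.
    have : 0 <= ln (10 * 1 * 1)%:R :> R by rewrite ln_ge0// ler1n.
    by rewrite /flatness expr0 divr1 /=; lra.
  have E (B : 'M[R]_(lsize 0)) (c : R) : (1%:M - c *: B) r q = (r == q)%:R - c * B r q by rewrite !mxE.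
  rewrite E -[Ulev 0 *m Ulev_inv 0]scale1r E mul1r scale1r; move: f1; set u := (_ *m _) r q.
  set F := flatness 0; case: (r == q) => /= f1; rewrite !ler_norml => /andP[h1 h2];
    apply/andP; split; lra.
have zU i : zcol k (offset k.+1 + r) i = - Ulev k.+1 r i.
  rewrite /zcol lrows_in lrows_out ?sub0r//.
  by rewrite level_add neq_ltn ltnSn orbT.
have kB' : (k < (offset k.+1 + r).+1)%N by rewrite (ltn_trans (ltnSn k)).
rewrite (bigD1 (Ordinal kB'))/=; last by rewrite -val_eqE /= neq_ltn ltnSn.
rewrite [X in _ + (_ + X)]big1 ?addr0; last first.
  move=> [j jB] /andP[/= jk jk1]; rewrite big1 ?mulr0// => i _; rewrite zk ?mul0r//.
have UW : \sum_i zcol k (offset k.+1 + r) i * wrow k h i =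
    - (lrows (Ulev k.+1 *m Vlev_inv k)^T h r + lrows (Ulev k.+1 *m Ulev_inv k.+1)^T h r).
  rewrite -!lrows_mul -big_split -sumrN; apply: eq_bigr => i _ /=.
  by rewrite zU /wrow mulNr mulrDr.
rewrite UW (block_coefS k).
have UV : `|lrows (Ulev k.+1 *m Vlev_inv k)^T h r| <= flatness k.+1.
  by apply: lrows_le => [|q]; [exact: ltW|rewrite mxE; exact: flat_UV'].
have diag : lrows (Vlev k.+1 *m Vlev_inv k.+1)^T h r - 2 * lrows (Ulev k.+1 *m Ulev_inv k.+1)^T h r =
    lrows (1%:M - 3 *: (Ulev k.+1 *m Ulev_inv k.+1))^T h r.
  rewrite VVE /lrows; case: ifP => _; last by rewrite mulr0 subr0.
  case: insubP => [q _ _|_]; last by rewrite mulr0 subr0.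
  have E (B : 'M[R]_(lsize k.+1)) : (1%:M - B)^T q r - 2 * B^T q r = (1%:M - 3 *: B)^T q r.
    by rewrite !mxE; ring.
  exact: E.
have DU : `|lrows (1%:M - 3 *: (Ulev k.+1 *m Ulev_inv k.+1))^T h r| <= flatness k.+1.
  by apply: lrows_le => [|q]; [exact: ltW|rewrite mxE; exact: flat_UU].
set vv := lrows (Vlev k.+1 *m Vlev_inv k.+1)^T h r in diag *.
set uu := lrows (Ulev k.+1 *m Ulev_inv k.+1)^T h r in diag *.
set vu := lrows (Vlev k.+1 *m Ulev_inv k.+2)^T h r in VU *.
set uv := lrows (Ulev k.+1 *m Vlev_inv k)^T h r in UV *.
have -> : block_coef k.+1 * (vv + vu) + 2 * block_coef k.+1 * - (uv + uu) =
    block_coef k.+1 * ((vv - 2 * uu) + vu - 2 * uv) by ring.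
rewrite diag normrM ger0_norm ?(ltW (block_coef_gt0 _))// ler_wpM2l ?(ltW (block_coef_gt0 _))//.
rewrite (le_trans (ler_normB _ _))// (@le_trans _ _ (flatness k.+1 + flatness k.+2 + 2 * flatness k.+1))//.
  rewrite lerD//; first by rewrite (le_trans (ler_normD _ _))// lerD.
  by rewrite normrM ger0_norm// ler_wpM2l.
lra.
Qed.

End flattening.

(** * Summability of the rows *)

Section summability.
Context {R : realType}.

Lemma sum_by_level (f : nat -> R) K L : (K <= L)%N ->
  \sum_(offset K <= n < offset L) f (level n) = \sum_(K <= k < L) (lsize k)%:R * f k.
Proof.
elim: L => [|L IH]; first by rewrite leqn0 => /eqP ->; rewrite !big_geq.
rewrite leq_eqVlt => /predU1P[->|KL]; first by rewrite !big_geq.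
rewrite big_nat_recr//= -IH// (@big_cat_nat _ _ _ (offset L))/= ?leq_offset//; congr (_ + _).
rewrite -{1}[offset L]add0n big_addn offsetS addKn big_mkord (eq_bigr (fun=> f L)).
  by rewrite sumr_const card_ord mulr_natl.
by move=> r _; rewrite addnC level_add.
Qed.

Lemma geometric_tail (th : R) K L : 0 <= th < 1 -> (K <= L)%N ->
  \sum_(K <= k < L) th ^+ k <= th ^+ K / (1 - th).
Proof.
move=> /andP[th0 th1] KL; rewrite ler_pdivlMr ?subr_gt0//.
have -> : (\sum_(K <= k < L) th ^+ k) * (1 - th) = th ^+ K - th ^+ L.
  elim: L KL => [|L IH]; first by rewrite leqn0 => /eqP ->; rewrite big_geq// mul0r subrr.
  rewrite leq_eqVlt => /predU1P[->|KL]; first by rewrite big_geq// mul0r subrr.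
  by rewrite big_nat_recr//= mulrDl IH// exprS; ring.
by rewrite gerBl exprn_ge0.
Qed.

Lemma level_tail (f : nat -> R) (C th : R) K N : 0 <= C -> 0 <= th < 1 ->
  (forall k, 0 <= f k) -> (forall k, (lsize k)%:R * f k <= C * th ^+ k) ->
  \sum_(offset K <= n < N) f (level n) <= C * (th ^+ K / (1 - th)).
Proof.
move=> C0 th01 f0 fC; pose L := maxn K N.
have NL : (N <= offset L)%N by rewrite (leq_trans (leq_maxr K N))// leq_id_offset.
have KL : (K <= L)%N by exact: leq_maxl.
apply: (@le_trans _ _ (\sum_(offset K <= n < offset L) f (level n))).
  have [KN|NK] := leqP (offset K) N; last by rewrite big_geq ?sumr_ge0// ltnW.
  by rewrite [leRHS](@big_cat_nat _ _ _ N)//= lerDl sumr_ge0.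
rewrite sum_by_level// (@le_trans _ _ (\sum_(K <= k < L) C * th ^+ k))//.
  exact: ler_sum.
by rewrite -mulr_sumr ler_wpM2l// geometric_tail.
Qed.

Lemma bernoulli_ineq (d : R) k : 0 <= d -> 1 + k%:R * d <= (1 + d) ^+ k.
Proof.
move=> d0; elim: k => [|k IH]; first by rewrite mul0r addr0 expr0.
rewrite exprS; have := ler_wpM2l (_ : 0 <= 1 + d) IH; rewrite addr_ge0// => /(_ isT).
have : 0 <= k%:R * d * d by rewrite !mulr_ge0.
rewrite -natr1; nra.
Qed.

(** The factor [k.+2] is absorbed by a slightly larger ratio; the constant comes
    from Bernoulli's inequality for [th / y]. *)
Lemma linear_le_geometric (y th : R) : 0 < y -> y < th ->
  exists2 C, 0 <= C & forall k, k.+2%:R * y ^+ k <= C * th ^+ k.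
Proof.
move=> y0 yth; pose d := th / y - 1.
have d0 : 0 < d by rewrite subr_gt0 ltr_pdivlMr// mul1r.
exists (2 + d^-1); first by rewrite addr_ge0// invr_ge0 ltW.
move=> k; have -> : th = (1 + d) * y by rewrite /d addrCA subrr addr0 divfK// gt_eqF.
rewrite exprMn mulrA ler_pM2r ?exprn_gt0//.
apply: (@le_trans _ _ ((2 + d^-1) * (1 + k%:R * d))); last first.
  by rewrite ler_wpM2l ?bernoulli_ineq ?(ltW d0)// addr_ge0// invr_ge0 ltW.
have e : d^-1 * (k%:R * d) = k%:R by rewrite mulrCA mulVf ?mulr1// gt_eqF.
have h1 : 0 <= k%:R * d by rewrite mulr_ge0// ltW.
have h2 : 0 <= d^-1 by rewrite invr_ge0 ltW.
have -> : (2 + d^-1) * (1 + k%:R * d) = 2 + 2 * (k%:R * d) + d^-1 + k%:R.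
  by rewrite -[X in _ = _ + X]e; ring.
rewrite -addn2 natrD; lra.
Qed.

Lemma expr_small (x e : R) : 0 <= x < 1 -> 0 < e -> exists K, x ^+ K <= e.
Proof.
move=> /andP[x0 x1] e0.
have /cvgrPdist_le/(_ _ e0)[K _ /(_ K (leqnn K))] : x ^+ n @[n --> \oo] --> (0 : R).
  by apply: cvg_expr; rewrite ger0_norm.
by rewrite sub0r normrN ger0_norm ?exprn_ge0// => h; exists K.
Qed.

(** On level [k] there are [3 * 2 ^ k] rows, of norm at most a multiple of
    [k.+2 * 2 ^ (- 3 k / 2)]. The weight [x ^+ k] with [x = 2 ^ (- t)] makes [w] belong
    to [l_p] for [t > p^-1] and [b / w] summable for [t < 2^-1]. *)
Theorem traceful_square_zero_exists (p : R) : 2 < p ->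
  exists b w, traceful_square_zero (@traceful_matrix R) col_bound b w p.
Proof.
move=> p2; have p0 : 0 < p by lra.
(* Halfway between the two requirements on t, which are compatible as p > 2. *)
pose t : R := (p^-1 + 2^-1) / 2.
have pi : p^-1 < 2^-1 by rewrite ltf_pV2 ?posrE.
have pi0 : 0 < p^-1 by rewrite invr_gt0.
have t1 : p^-1 < t by rewrite /t; lra.
have t2 : t < 2^-1 by rewrite /t; lra.
have ln20 : 0 < ln (2 : R) by rewrite ln_gt0// ltr1n.
pose x : R := expR (- (t * ln 2)).
have x0 : 0 < x by exact: expR_gt0.
have x1 : x < 1 by rewrite /x expR_lt1 oppr_lt0 mulr_gt0//; lra.
have sE : Num.sqrt 2 = expR (2^-1 * ln 2) :> R.
  by rewrite -powR12_sqrt// /powR pnatr_eq0.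
(* The ratio at which b / w decreases, summed over a level. *)
pose y := (Num.sqrt 2 * x)^-1.
have y0 : 0 < y by rewrite invr_gt0 mulr_gt0// sqrtr_gt0.
have y1 : y < 1.
  rewrite invf_lt1 ?mulr_gt0 ?sqrtr_gt0// sE /x -expRD expR_gt1.
  by rewrite -mulNr -mulrDl mulr_gt0// subr_gt0.
pose v := x `^ p.
have v0 : 0 < v by exact: powR_gt0.
have v1 : 2 * v < 1.
  have -> : v = expR (- (t * p * ln 2)).
    by rewrite /v /powR (gt_eqF x0) expRK; congr expR; ring.
  have {1}-> : 2 = expR (ln 2) :> R by rewrite lnK// posrE.
  rewrite -expRD expR_lt1 -{1}[ln 2]mul1r -mulNr -mulrDl pmulr_llt0// subr_lt0.
  by rewrite -ltr_pdivrMr// div1r.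
have [c0 c00 hc0] := @flatness_le R.
pose b k := block_coef k * (3 * flatness k + flatness k.+1) : R.
have b0 k : 0 <= b k.
  have F0 j := ltW (flatness_gt0 (R := R) j).
  by rewrite mulr_ge0 ?(ltW (block_coef_gt0 _))//; apply: addr_ge0 => //; exact: mulr_ge0.
pose th := (1 + y) / 2.
have th01 : 0 <= th < 1 by rewrite /th; apply/andP; split; lra.
have [C C0 hC] : exists2 C, 0 <= C & forall k, k.+2%:R * y ^+ k <= C * th ^+ k.
  by apply: linear_le_geometric => //; rewrite /th; lra.
have Db k : (lsize k)%:R * block_coef k = 3 / 2 :> R.
  rewrite /lsize /block_coef /= !natrD.
  have d0 : (dim k)%:R != 0 :> R by rewrite pnatr_eq0 -lt0n dim_gt0.
  by field; rewrite -mulr2n mulrn_eq0.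
have level_sum k : (lsize k)%:R * (b k / x ^+ k) <= (6 * c0 * C) * th ^+ k.
  have f1 : 3 * flatness k + flatness k.+1 <= 4 * c0 * (k.+2%:R / Num.sqrt 2 ^+ k) :> R.
    have s0 : 0 < Num.sqrt 2 ^+ k :> R by rewrite exprn_gt0// sqrtr_gt0.
    have g1 : flatness k <= c0 * (k.+2%:R / Num.sqrt 2 ^+ k) :> R.
      rewrite (le_trans (hc0 k))// -mulrA ler_pM2l// ler_pM2r ?invr_gt0//.
      by rewrite ler_nat.
    have g2 : flatness k.+1 <= c0 * (k.+2%:R / Num.sqrt 2 ^+ k) :> R.
      rewrite (le_trans (hc0 k.+1))// -mulrA ler_pM2l// ler_pM2l ?ltr0n//.
      rewrite lef_pV2 ?posrE ?exprn_gt0 ?sqrtr_gt0// exprS ler_peMl ?(ltW s0)//.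
      by rewrite -[leLHS]sqrtr1 ler_wsqrtr// ler1n.
    lra.
  rewrite /b mulrA [(lsize k)%:R * _]mulrA Db.
  apply: (@le_trans _ _ (3 / 2 * (4 * c0 * (k.+2%:R / Num.sqrt 2 ^+ k)) / x ^+ k)).
    by rewrite ler_pM2r ?invr_gt0 ?exprn_gt0// ler_pM2l.
  have -> : 3 / 2 * (4 * c0 * (k.+2%:R / Num.sqrt 2 ^+ k)) / x ^+ k = 6 * c0 * (k.+2%:R * y ^+ k).
    rewrite /y exprVn exprMn invfM; field.
    by rewrite !expf_neq0 ?sqrt2_neq0// gt_eqF.
  by rewrite -[leRHS]mulrA ler_wpM2l// mulr_ge0// ltW.
exists (fun n => b (level n)), (fun n => x ^+ level n); split.
- move=> n m mn; exact: traceful_matrix_col.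
- move=> n m; exact: traceful_matrix_sq.
- move=> n m; exact: traceful_matrix_le.
- by move=> n; rewrite exprn_gt0//= exprn_ile1 ?ltW.
- move=> e e0; have [|K hK] := @expr_small x e _ e0; first by rewrite (ltW x0).
  exists (offset K) => n Kn; apply: le_trans hK; apply: ler_wiXn2l; rewrite ?ltW//.
  rewrite leqNgt; apply/negP => h; have /andP[_] := levelP n.
  by rewrite ltnNge (leq_trans (leq_offset h)).
- have v01 : 0 <= 2 * v < 1 by rewrite v1 mulr_ge0// ltW.
  exists (3 * ((2 * v) ^+ 0 / (1 - 2 * v))) => N.
  rewrite (eq_bigr (fun n : 'I_N => v ^+ level n)); last first.
    by move=> n _; rewrite -(powR_mulrn _ (ltW x0)) -(powR_mulrn _ (ltW v0)) -!powRrM mulrC.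
  rewrite -(big_mkord xpredT (fun n => v ^+ level n)).
  have {1}<- : offset 0 = 0%N by rewrite /offset big_ord0.
  apply: (@level_tail (fun k => v ^+ k)) => // k; first by rewrite exprn_ge0// ltW.
  rewrite exprMn mulrA ler_wpM2r ?exprn_ge0 ?(ltW v0)//.
  rewrite /lsize dimE -natrX -natrM ler_nat.
  by rewrite !mulSn mul0n addn0.
- move=> e e0.
  pose C1 := 6 * c0 * C / (1 - th) + 1.
  have C10 : 0 < C1.
    rewrite ltr_wpDl// divr_ge0 ?mulr_ge0 ?(ltW c00)// subr_ge0 ltW//.
    by case/andP: th01.
  have [K hK] := expr_small th01 (divr_gt0 e0 C10).
  exists (offset K) => N.
  have C60 : 0 <= 6 * c0 * C by rewrite !mulr_ge0// ltW.
  have f0 k : 0 <= b k / x ^+ k by rewrite divr_ge0// exprn_ge0// ltW.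
  rewrite (le_trans (@level_tail (fun k => b k / x ^+ k) _ _ K N C60 th01 f0 level_sum))//.
  have thK : 0 <= th ^+ K by rewrite exprn_ge0//; case/andP: th01.
  rewrite mulrA mulrAC (@le_trans _ _ (C1 * th ^+ K))//.
    by rewrite ler_wpM2r// lerDl.
  by rewrite mulrC -ler_pdivlMr.
- move=> m; exists (offset m.+1); last exact: traceful_matrix_trace.
  by rewrite (leq_trans (leq_id_offset m))// leq_offset.
Qed.

End summability.

Theorem proposition4p6 (R : realType) (s : scalars) (p : R) (hp : 2 < p) :
  exists X : completeNormedModType (scalar_field R s),
    [/\ local_MAP (p_integral_ideal s (lee1_gt2 hp)) X,
        local_MAP (p_nuclear_ideal s p) X,
        ~ weak_BAP (p_integral_ideal s (lee1_gt2 hp)) X &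
        ~ weak_BAP (p_nuclear_ideal s p) X].
Proof.
have [b [w H]] := traceful_square_zero_exists hp.
have p_gt1 : 1 < p by rewrite (lt_trans _ hp)// ltr1n.
exists (annihilator_space s col_bound (@traceful_matrix R)); split.
- exact: local_MAP_p_integral.
- exact/local_MAP_p_nuclear/lee1_gt2.
- apply: (not_weak_BAP (H := H)).
  + exact: weight_p_integral.
  + exact: weight_integral_norm.
  + by move=> U D; exact: integral_coord.
- apply: (not_weak_BAP (H := H)).
  + by do 2 eexists; exact: weight_nuclear_representation.
  + exact: weight_nuclear_norm.
  + by move=> U D; exact: nuclear_coord.
Qed.
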